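(* Assume that: (a) the model $r(x;\theta)$, $\theta\in\Theta$, includes the constant function $1$; (b) for every $\theta\in\Theta$, $1\in\mathcal{L}[\nabla\log r(x;\theta)]$; (c) $f(1)=f'(1)=0$. Let the model be $r(x;\theta)=\exp\{\alpha+\phi(x;\beta)\}$, $\theta=(\alpha,\beta)\in\mathbb{R}\times\mathbb{R}^{d-1}$; let $r(x;\theta^* )=1$ with $\theta^*=(\alpha^*,\beta^* )$ and $\theta_m=\theta^*+h_m/\sqrt m$ with $h_m\in\mathbb{R}^d$, $\lim_{m\to\infty}h_m=h\in\mathbb{R}^d$; let $p_{\mathrm d}(x)=p(x)$ for a fixed probability density $p$. Assume that the density ratio $p_{\mathrm n}^{(m)}/p_{\mathrm d}$ is not realized by the model $r(x;\theta)$, and that the probability density $p_{\mathrm n}^{(m)}$ is represented as $$p_{\mathrm n}^{(m)}(x)=p_{\mathrm d}(x)\Big(r(x;\theta_m)+\frac{s_m(x)+\varepsilon_m}{\sqrt m}\Big),$$ where $s_m$ satisfies $E[s_m(x)]=0$ under $p_{\mathrm d}=p$, and $\lim_{m\to\infty}\varepsilon_m=\varepsilon$. For each $m_{\mathrm n},m_{\mathrm d}$ the samples $x^{(\mathrm n)}_1,\dots,x^{(\mathrm n)}_{m_{\mathrm n}}$ are generated from $p_{\mathrm n}^{(m)}$ and $x^{(\mathrm d)}_1,\dots,x^{(\mathrm d)}_{m_{\mathrm d}}$ from $p_{\mathrm d}$, and $\rho$ is the limit of $m_{\mathrm n}/m_{\mathrm d}$. Assume that $$M(\theta)=\int p(x)\nabla\log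 r(x;\theta)\nabla\log r(x;\theta)^Tdx,\qquad U(\theta)=\int p(x)\frac{1}{1+\rho r(x;\theta)}\nabla\log r(x;\theta)\nabla\log r(x;\theta)^Tdx$$ are continuous and non-degenerate in the vicinity of $\theta^*$, and that, with $V[\nabla r]$ the variance-covariance matrix of $\nabla\log r(x;\theta^* )=\nabla r(x;\theta^* )$ under $p$, $$\frac1{m_{\mathrm n}}\sum_{j=1}^{m_{\mathrm n}}\nabla r(x^{(\mathrm n)}_j;\theta^* )\nabla r(x^{(\mathrm n)}_j;\theta^* )^T\stackrel{p}{\longrightarrow}M(\theta^* ),\qquad \sqrt m\,U(\theta_m)(\widehat\theta-\theta_m)\stackrel{\theta_m}{\longrightarrow}N\Big(0,\frac{1}{(1+\rho)^2}V[\nabla r]\Big).$$ Then, under this local alternative setup, the (asymptotic) power function of the $\widehat D_f$-based test is larger than or equal to that of the empirical likelihood test.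
   Context: $f$ is a strictly convex function with $f(1)=0$, and $f',f''$ are its first and second derivatives. $\nabla$ is the gradient in $\theta\in\Theta\subset\mathbb{R}^d$ (column vector), $\nabla_\beta$ the gradient in $\beta$. $\mathcal{L}[\nabla\log r(x;\theta)]$ is the linear span, as functions of $x$, of $\partial_1\log r(x;\theta),\dots,\partial_d\log r(x;\theta)$, where $\partial_k=\partial/\partial\theta_k$. $m=m_{\mathrm n}m_{\mathrm d}/(m_{\mathrm n}+m_{\mathrm d})$ and $0<\rho<\infty$; $\rho$ also denotes $m_{\mathrm n}/m_{\mathrm d}$ itself. The two samples are independent and each is i.i.d. The notation $X_m\stackrel{\theta_m}{\longrightarrow}P$ means that the distribution of $X_m$ under $p_{\mathrm n}^{(m)}$ and $p_{\mathrm d}$ converges in law to $P$ as $m\to\infty$; $\stackrel{p}{\longrightarrow}$ is convergence in probability under the samples from $p_{\mathrm n}^{(m)}$ as $m_{\mathrm n}\to\infty$. $\chi^2_{d-1}(1-\gamma)$ is the $100(1-\gamma)$ percent point of the chi-square distribution with $d-1$ degrees of freedom, $\gamma$ being the significance level (the same for both tests). Estimator: $\widehat\theta=(\widehat\alpha,\widehat\beta)$ is a solution of $Q(\widehat\theta)=0$, where $$Q(\theta)=\frac1{m_{\mathrm d}}\sum_{i=1}^{m_{\mathrm d}}r(x^{(\mathrm d)}_i;\theta)\eta_{\mathrm{opt}}(x^{(\mathrm d)}_i;\theta)-\frac1{m_{\mathrm n}}\sum_{j=1}^{m_{\mathrm n}}\eta_{\mathrm{opt}}(x^{(\mathrm n)}_j;\theta),\quad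 \eta_{\mathrm{opt}}(x;\theta)=\frac{\nabla\log r(x;\theta)}{1+\rho r(x;\theta)}$$ (the same $\widehat\theta$, called the empirical likelihood estimator, is used in both tests). $\widehat D_f$-based test of $H_0:p_{\mathrm n}=p_{\mathrm d}$ against $H_1:p_{\mathrm n}\ne p_{\mathrm d}$ at level $\gamma$: reject $H_0$ if $\widehat D_f\ge\frac{f''(1)}{2m}\chi^2_{d-1}(1-\gamma)$, where $$\widehat D_f=\frac1{m_{\mathrm d}}\sum_{i=1}^{m_{\mathrm d}}f_{\mathrm d}(r(x^{(\mathrm d)}_i;\widehat\theta))+\frac1{m_{\mathrm n}}\sum_{j=1}^{m_{\mathrm n}}f_{\mathrm n}(r(x^{(\mathrm n)}_j;\widehat\theta)),\quad f_{\mathrm d}(r)=\frac{f(r)}{1+\rho r},\ f_{\mathrm n}(r)=\frac{\rho f(r)}{1+\rho r}.$$ Empirical likelihood test at level $\gamma$: reject $H_0$ if $S=m(\widehat\beta-\beta^* )^T\widehat V_{\mathrm n}[\nabla_\beta\phi](\widehat\beta-\beta^* )$ is larger than $\chi^2_{d-1}(1-\gamma)$, where $\widehat V_{\mathrm n}[\nabla_\beta\phi]$ is a consistent estimator of the variance-covariance matrix $V_{\mathrm n}[\nabla_\beta\phi]$ of $\nabla_\beta\phi(x;\beta^* )$ under $p_{\mathrm n}$. The power function is the probability of rejection under the alternative $p_{\mathrm n}=p_{\mathrm n}^{(m)}$, $p_{\mathrm d}=p$; the comparison is between the limits as $m\to\infty$.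
   Formalization: The formal statement also assumes that the alternative density p_n^(m) tends to p in L^1 (a centred s_m alone does not ensure this, and the claim then fails), and takes the variance estimator to be consistent for the covariance of ∇_βφ under the limit density p. *)

(* Defs.v *)
(* MathComp-Analysis *)
From HB Require Import structures.
From mathcomp Require Import all_boot all_order all_algebra.
From mathcomp Require Import all_classical all_reals all_analysis.

Set Implicit Arguments.
Unset Strict Implicit.
Unset Printing Implicit Defensive.

Import Order.TTheory GRing.Theory Num.Theory numFieldNormedType.Exports.

Local Open Scope classical_set_scope.
Local Open Scope ring_scope.

Definition strictly_convex_pos (R : realType) (f : R -> R) : Prop :=
  forall x y t : R, 0 < x -> 0 < y -> x != y -> 0 < t -> t < 1 ->
    f (t * x + (1 - t) * y) < t * f x + (1 - t) * f y.

Definition grad (R : realType) (n : nat) (g : 'cV[R]_n -> R) (a : 'cV[R]_n)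
    : 'cV[R]_n :=
  \col_i 'D_(delta_mx i ord0) g a.

(* Densities are taken with respect to an arbitrary sigma-finite reference
   measure mu, written dx in the literature. *)
Definition is_density (R : realType) (dT : measure_display)
    (T : measurableType dT) (mu : {measure set T -> \bar R}) (q : T -> R)
    : Prop :=
  [/\ measurable_fun setT q, forall x, 0 <= q x &
      (\int[mu]_x (q x)%:E = 1)%E].

Definition Edens (R : realType) (dT : measure_display)
    (T : measurableType dT) (mu : {measure set T -> \bar R}) (q : T -> R)
    (g : T -> R) : R :=
  Rintegral mu setT (fun x => q x * g x).

Definition covmx (R : realType) (dT : measure_display)
    (T : measurableType dT) (mu : {measure set T -> \bar R}) (q : T -> R)
    (n : nat) (g : T -> 'cV[R]_n) : 'M[R]_n :=
  \matrix_(a, b) Edens mu q (fun x =>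
    (g x a ord0 - Edens mu q (fun y => g y a ord0)) *
    (g x b ord0 - Edens mu q (fun y => g y b ord0))).

(* Allowing A i = setT gives the product rule for every subfamily. *)
Definition mutually_independent (R : realType) (dO dT : measure_display)
    (O : measurableType dO) (T : measurableType dT) (P : probability O R)
    (I : finType) (X : I -> O -> T) : Prop :=
  forall A : I -> set T, (forall i, measurable (A i)) ->
    P (\bigcap_(i in [set: I]) (X i @^-1` A i)) =
    (\prod_(i : I) P (X i @^-1` A i))%E.

Definition has_density (R : realType) (dO dT : measure_display)
    (O : measurableType dO) (T : measurableType dT) (P : probability O R)
    (mu : {measure set T -> \bar R}) (q : T -> R) (X : O -> T) : Prop :=
  measurable_fun setT X /\
  forall A : set T, measurable A ->
    P (X @^-1` A) = (\int[mu]_(x in A) (q x)%:E)%E.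

Definition two_samples (R : realType) (dO dT : measure_display)
    (O : measurableType dO) (T : measurableType dT) (P : probability O R)
    (mu : {measure set T -> \bar R}) (qn qd : T -> R) (mn md : nat)
    (xn : 'I_mn -> O -> T) (xd : 'I_md -> O -> T) : Prop :=
  [/\ forall j, has_density P mu qn (xn j),
      forall i, has_density P mu qd (xd i) &
      mutually_independent P (fun s : 'I_mn + 'I_md =>
        match s with inl j => xn j | inr i => xd i end)].

Definition std_normal_vector (R : realType) (dO : measure_display)
    (O : measurableType dO) (P : probability O R) (n : nat)
    (G : 'I_n -> O -> R) : Prop :=
  [/\ forall i, measurable_fun setT (G i),
      forall i (A : set R), measurable A ->
        P (G i @^-1` A) = normal_prob 0 1 A &
      mutually_independent P G].

(* c is the 100 q percent point of the law of a sum of k squares of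
   independent standard normal variables. *)
Definition chi2_point (R : realType) (k : nat) (q c : R) : Prop :=
  exists (dO : measure_display) (O : measurableType dO)
    (P : probability O R) (G : 'I_k -> O -> R),
    std_normal_vector P G /\
    P [set w | \sum_(i < k) G i w ^+ 2 <= c] = q%:E.

Definition cvg_in_prob (R : realType) (dO : nat -> measure_display)
    (O : forall i, measurableType (dO i)) (P : forall i, probability (O i) R)
    (a b : nat) (X : forall i, O i -> 'M[R]_(a, b)) (L : 'M[R]_(a, b))
    : Prop :=
  forall (u : 'I_a) (v : 'I_b) (e : R), 0 < e ->
    (fun i => P i [set w | e < `|X i w u v - L u v|]) @ \oo --> 0%E.

Definition cvg_in_law (R : realType) (dO : nat -> measure_display)
    (O : forall i, measurableType (dO i)) (P : forall i, probability (O i) R)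
    (n : nat) (X : forall i, O i -> 'cV[R]_n)
    (dY : measure_display) (OY : measurableType dY) (Q : probability OY R)
    (Y : OY -> 'cV[R]_n) : Prop :=
  forall g : 'cV[R]_n -> R, continuous g ->
    (exists C : R, forall z, `|g z| <= C) ->
    (fun i => (\int[P i]_w (g (X i w))%:E)%E) @ \oo -->
    (\int[Q]_w (g (Y w))%:E)%E.

(* N(0, Sigma), with Sigma possibly singular, is the law of A G for G a
   standard normal vector and A A^T = Sigma. *)
Definition cvg_in_law_normal (R : realType) (dO : nat -> measure_display)
    (O : forall i, measurableType (dO i)) (P : forall i, probability (O i) R)
    (n : nat) (X : forall i, O i -> 'cV[R]_n) (Sigma : 'M[R]_n) : Prop :=
  exists (dY : measure_display) (OY : measurableType dY)
    (Q : probability OY R) (l : nat) (G : 'I_l -> OY -> R)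
    (A : 'M[R]_(n, l)),
    [/\ std_normal_vector Q G, A *m A^T = Sigma &
        cvg_in_law P X Q (fun w => A *m (\col_i G i w))].

(* The parameter is theta = (alpha, beta) in R x R^k, so that d = 1 + k and
   k = d - 1. *)
Definition beta_of (R : realType) (k : nat) (t : 'cV[R]_(1 + k)) : 'cV[R]_k :=
  dsubmx t.

Definition density_ratio (R : realType) (T : Type) (k : nat)
    (phi : T -> 'cV[R]_k -> R) (x : T) (t : 'cV[R]_(1 + k)) : R :=
  expR (usubmx t ord0 ord0 + phi x (beta_of t)).

Definition score (R : realType) (T : Type) (n : nat)
    (r : T -> 'cV[R]_n -> R) (x : T) (t : 'cV[R]_n) : 'cV[R]_n :=
  grad (fun u => ln (r x u)) t.

Definition one_in_score_span (R : realType) (T : Type) (n : nat)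
    (r : T -> 'cV[R]_n -> R) (t : 'cV[R]_n) : Prop :=
  exists c : 'I_n -> R,
    forall x, \sum_(i < n) c i * score r x t i ord0 = 1.

Definition Mmx (R : realType) (dT : measure_display)
    (T : measurableType dT) (mu : {measure set T -> \bar R}) (p : T -> R)
    (n : nat) (r : T -> 'cV[R]_n -> R) (t : 'cV[R]_n) : 'M[R]_n :=
  \matrix_(a, b) Edens mu p (fun x => score r x t a ord0 * score r x t b ord0).

Definition Umx (R : realType) (dT : measure_display)
    (T : measurableType dT) (mu : {measure set T -> \bar R}) (p : T -> R)
    (rho : R) (n : nat) (r : T -> 'cV[R]_n -> R) (t : 'cV[R]_n) : 'M[R]_n :=
  \matrix_(a, b) Edens mu p (fun x =>
    (1 + rho * r x t)^-1 * (score r x t a ord0 * score r x t b ord0)).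

Definition eff_size (R : realType) (mn md : nat) : R :=
  mn%:R * md%:R / (mn%:R + md%:R).

Definition eta_opt (R : realType) (T : Type) (n : nat)
    (r : T -> 'cV[R]_n -> R) (rho : R) (x : T) (t : 'cV[R]_n) : 'cV[R]_n :=
  (1 + rho * r x t)^-1 *: score r x t.

(* In eta_opt, f_d and f_n, which enter quantities computed from the data,
   rho is the sample ratio mn / md. *)
Definition Qstat (R : realType) (T : Type) (n : nat)
    (r : T -> 'cV[R]_n -> R) (mn md : nat) (xn : 'I_mn -> T) (xd : 'I_md -> T)
    (t : 'cV[R]_n) : 'cV[R]_n :=
  let rho := mn%:R / md%:R in
  md%:R^-1 *: (\sum_(i < md) r (xd i) t *: eta_opt r rho (xd i) t)
  - mn%:R^-1 *: (\sum_(j < mn) eta_opt r rho (xn j) t).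

Definition f_d (R : realType) (f : R -> R) (rho z : R) : R :=
  f z / (1 + rho * z).

Definition f_n (R : realType) (f : R -> R) (rho z : R) : R :=
  rho * f z / (1 + rho * z).

Definition Df_hat (R : realType) (T : Type) (n : nat) (f : R -> R)
    (r : T -> 'cV[R]_n -> R) (mn md : nat) (xn : 'I_mn -> T) (xd : 'I_md -> T)
    (t : 'cV[R]_n) : R :=
  let rho := mn%:R / md%:R in
  md%:R^-1 * (\sum_(i < md) f_d f rho (r (xd i) t))
  + mn%:R^-1 * (\sum_(j < mn) f_n f rho (r (xn j) t)).

Definition EL_stat (R : realType) (k : nat) (m : R) (V : 'M[R]_k)
    (b bs : 'cV[R]_k) : R :=
  m * ((b - bs)^T *m V *m (b - bs)) ord0 ord0.

Definition Df_reject (R : realType) (T : Type) (n : nat) (f : R -> R)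
    (r : T -> 'cV[R]_n -> R) (c m : R) (mn md : nat)
    (xn : 'I_mn -> T) (xd : 'I_md -> T) (t : 'cV[R]_n) : Prop :=
  (f^`(2))%classic 1 / (2 * m) * c <= Df_hat f r xn xd t.

Definition EL_reject (R : realType) (k : nat) (c m : R) (V : 'M[R]_k)
    (b bs : 'cV[R]_k) : Prop :=
  c < EL_stat m V b bs.

Definition power (R : realType) (dO : measure_display)
    (O : measurableType dO) (P : probability O R) (reject : O -> Prop)
    : \bar R :=
  P [set w | reject w].

(* Main.v *)
Require Import Defs.
From HB Require Import structures.
From mathcomp Require Import all_boot all_order all_algebra.
From mathcomp Require Import all_classical all_reals all_analysis.
From mathcomp Require Import ring lra measurable_realfun normal_distribution.
From mathcomp Require Import random_variable.
Import Order.TTheory GRing.Theory Num.Theory numFieldNormedType.Exports.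
Local Open Scope classical_set_scope.
Local Open Scope ring_scope.

(** Put [u = sqrt m (that - ts)], let [M] be the second moment matrix of the
    score at [ts], and let [V] be the covariance matrix of the gradient of
    [phi]. The empirical likelihood statistic is [u_beta^T V u_beta + o(1)].
    The first component of the score is [1], so [M] minus the product of its
    first column and first row is [V] bordered by zeros, and that statistic is
    at most [u^T M u + o(1)].

    Since [f >= 0], only a lower bound of the divergence statistic is needed.
    Keep in both samples only the points where the score is bounded and where
    the first order expansion of [r] at [ts] is accurate on a fixed
    neighbourhood: the law of large numbers for bounded variables then gives
    [2 m Df_hat / f''(1) >= u^T M u - o(1)]. If [f''(1) <= 0], the divergence
    test always rejects.

    The limit of [u] is Gaussian, and [u^T M u] converges in law to a polynomial
    of degree exactly [2] in one standard normal variable, conditionally on the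
    other ones. Such a law has no atom at the critical value, so the limits of
    the probabilities that [u^T M u] exceeds [c - o(1)] and [c + o(1)]
    coincide. *)

Set Implicit Arguments.
Unset Strict Implicit.
Unset Printing Implicit Defensive.

(** * Independence and product laws *)

(** Both statistics are compared on the same sample, so only [u^T M u] needs a limit law: [u]
    behaves like [invmx U *m Y + h], where [Y] is the Gaussian limit assumed for the estimator. The
    obstacle is that [r] is differentiable in the parameter only pointwise in the data and that the
    score has only second moments under [p], so no expansion is uniform over the sample. The points
    sharing a given radius and bound form an increasing sequence of measurable sets that covers the
    data space, and by dominated convergence one of them carries [M] up to a small error. Discarding
    the other points gives a one-sided bound, which is the side required. The truncation also makes
    the averaged functions bounded, and for these [L^1] convergence of [pn i] to [p] controls the
    means. The weights of the two samples tend to [1 / (1 + rho)] and [rho / (1 + rho)]; they add up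
    to one, which is why the mixture of the two empirical moments tends to [M] itself. The quadratic
    polynomial has degree two because the covariance of the score is nonzero; this comes from [M]
    being invertible and from [0 < k], which a level strictly between [0] and [1] forces. *)

Lemma integrable_bounded (R : realType) (d : measure_display)
    (T : measurableType d) (P : {finite_measure set T -> \bar R}) (g : T -> R)
    (C : R) :
  measurable_fun setT g -> (forall x, `|g x| <= C) ->
  P.-integrable setT (EFin \o g).
Proof.
move=> mg gC; apply: measurable_bounded_integrable => //.
  by rewrite -ge0_fin_numE// fin_num_measure.
exists C; split; first by rewrite num_real.
by move=> y Cy x _; apply: le_trans (gC x) (ltW Cy).
Qed.

Lemma Rintegral_sum (R : realType) (d : measure_display)
    (T : measurableType d) (mu : {measure set T -> \bar R}) (D : set T)
    (I : Type) (l : seq I) (g : I -> T -> R) :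
  measurable D -> (forall i, mu.-integrable D (EFin \o g i)) ->
  Rintegral mu D (fun x => \sum_(i <- l) g i x) =
  \sum_(i <- l) Rintegral mu D (g i).
Proof.
move=> mD ig; rewrite /Rintegral.
rewrite (eq_integral (fun x => \sum_(i <- l) (g i x)%:E)%E); last first.
  by move=> x _; rewrite sumEFin.
rewrite integral_sum// -sum_fine// => i _.
exact: (integrable_fin_num mD (ig i)).
Qed.

Section independence.
Context (R : realType) (d d1 d2 : measure_display) (O : measurableType d)
  (T1 : measurableType d1) (T2 : measurableType d2) (P : probability O R).
Variables (X : {mfun O >-> T1}) (Y : {mfun O >-> T2}).
Hypothesis XY : forall A B, measurable A -> measurable B ->
  P (X @^-1` A `&` Y @^-1` B) = (P (X @^-1` A) * P (Y @^-1` B))%E.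

Definition pairmap (w : O) : T1 * T2 := (X w, Y w).

Lemma measurable_pairmap : measurable_fun setT pairmap.
Proof. exact: measurable_fun_pair. Qed.

HB.instance Definition _ :=
  isMeasurableFun.Build _ _ _ _ pairmap measurable_pairmap.

(** Rectangles determine a finite measure on the product sigma-algebra, so the product rule on them
    is enough. *)
Lemma joint_law_product (E : set (T1 * T2)) : measurable E ->
  P (pairmap @^-1` E) =
  (distribution P X \x distribution P Y)%E E.
Proof.
move=> mE; symmetry.
rewrite (@product_measure_unique _ _ _ _ _ (distribution P X)
  (distribution P Y) (distribution P pairmap))//.
Qed.

(** Fubini with [Y] on the outside: a statement that holds for [X] at each fixed value of [Y] passes
    to the joint law. *)
Lemma independent_null (E : set (T1 * T2)) : measurable E ->
  (forall y, P (X @^-1` ysection E y) = 0%E) ->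
  P (pairmap @^-1` E) = 0%E.
Proof.
move=> mE E0; rewrite joint_law_product//.
(* The product is rewritten with the order of integration that uses sections at fixed [y], the ones
   controlled by the hypothesis. *)
transitivity ((distribution P X \x^ distribution P Y)%E E).
  apply: product_measure_unique => // A B mA mB.
  exact: product_measure2E.
rewrite /product_measure2/=; apply: integral0_eq => y _ /=.
exact: E0.
Qed.

Lemma independent_expectation_mul (f : T1 -> R) (g : T2 -> R) (C : R) :
  measurable_fun setT f -> measurable_fun setT g ->
  (forall x, `|f x| <= C) -> (forall x, `|g x| <= C) ->
  Rintegral P setT (fun w => f (X w) * g (Y w)) =
  Rintegral P setT (f \o X) * Rintegral P setT (g \o Y).
Proof.
move=> mf mg fC gC.
pose F (z : T1 * T2) : \bar R := (f z.1 * g z.2)%:E.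
have mF' : measurable_fun setT (fun z : T1 * T2 => f z.1 * g z.2).
  by apply: measurable_funM; exact: measurableT_comp.
have mF : measurable_fun setT F by exact/measurable_EFinP.
have FC z : `|f z.1 * g z.2| <= C * C.
  by rewrite normrM ler_pM.
have iX : P.-integrable setT (EFin \o (f \o X)).
  by apply: (@integrable_bounded _ _ _ _ _ C) => [|x]//=; exact: measurableT_comp.
have iY : P.-integrable setT (EFin \o (g \o Y)).
  by apply: (@integrable_bounded _ _ _ _ _ C) => [|x]//=; exact: measurableT_comp.
have iXY : P.-integrable setT (F \o pairmap).
  apply: (@integrable_bounded _ _ _ _ (fun w => f (X w) * g (Y w)) (C * C)).
    by apply: measurable_funM => /=; exact: measurableT_comp.
  by move=> w; exact: (FC (X w, Y w)).
suff E1 : (\int[P]_w (F \o pairmap) w =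
    (\int[P]_w (f (X w))%:E) * (\int[P]_w (g (Y w))%:E))%E.
  rewrite /Rintegral -fineM//; last 2 first.
  - exact: (integrable_fin_num measurableT iX).
  - exact: (integrable_fin_num measurableT iY).
  by congr fine.
rewrite -(integral_distribution (X := pairmap))//.
rewrite (eq_measure_integral (distribution P X \x distribution P Y)%E); last first.
  by move=> A mA _; exact: joint_law_product.
rewrite -integral12_prod_meas1//; last first.
  apply: measurable_bounded_integrable => //.
    rewrite [ltLHS](_ : _ = 1%E) ?ltry//.
    transitivity (P (pairmap @^-1` setT)); last first.
      by rewrite preimage_setT probability_setT.
    exact/esym/joint_law_product.
  exists (C * C); split; first by rewrite num_real.
  by move=> y Cy x _; apply: le_trans (FC x) (ltW Cy).
have iY' : (distribution P Y).-integrable setT (EFin \o g).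
  exact: (@integrable_bounded _ _ _ _ _ C).
have iX' : (distribution P X).-integrable setT (EFin \o f).
  exact: (@integrable_bounded _ _ _ _ _ C).
have fY : (\int[distribution P Y]_y (g y)%:E)%E \is a fin_num.
  exact: (integrable_fin_num measurableT iY').
transitivity (\int[distribution P X]_x
    ((f x)%:E * \int[distribution P Y]_y (g y)%:E))%E.
  apply: eq_integral => x _; rewrite -integralZl//.
rewrite -(fineK fY) integralZr// fineK//.
rewrite (integral_distribution (f := EFin \o f))//; last exact/measurable_EFinP.
by rewrite (integral_distribution (f := EFin \o g))//; exact/measurable_EFinP.
Qed.

End independence.

(** * Quadratic forms of normal vectors have no atoms *)

(** A polynomial of degree two has finitely many roots, and the normal law is dominated by Lebesgue
    measure. *)
Lemma normal_prob_quadratic0 (R : realType) (m s a b c : R) : a != 0 ->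
  normal_prob m s [set x | a * x ^+ 2 + b * x + c = 0] = 0%E.
Proof.
move=> a0; set S := [set x | _].
have [->|/set0P[x Sx]] := eqVneq S set0; first by rewrite measure0.
have Sfin : S `<=` [set x; - b / a - x].
  move=> y Sy; have : (y - x) * (a * (y + x) + b) = 0.
    transitivity ((a * y ^+ 2 + b * y + c) - (a * x ^+ 2 + b * x + c)).
      by ring.
    by rewrite Sx Sy subrr.
  move/eqP; rewrite mulf_eq0 => /orP[|] /eqP H.
    by left => /=; move/eqP: H; rewrite subr_eq0 => /eqP.
  right => /=; apply: (mulfI a0).
  by rewrite mulrBr [a * (- b / a)]mulrC divfK//; lra.
have fS : finite_set S by apply: sub_finite_set Sfin _; exact: finite_set2.
have mS : measurable S.
  by apply: countable_measurable; [exact: measurable_set1|exact: finite_set_countable].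
have S0 : lebesgue_measure S = 0%E.
  by apply: countable_lebesgue_measure0; exact: finite_set_countable.
have /null_content_dominatesP dom := @normal_prob_dominates R m s.
exact: dom mS S0.
Qed.

Section rest_independence.
Context (R : realType) (d : measure_display) (O : measurableType d)
  (P : probability O R) (l : nat) (G : 'I_l -> O -> R) (j : 'I_l).
Hypothesis Gmeas : forall i, measurable_fun setT (G i).
Hypothesis Gind : mutually_independent P G.

(** A pi-system that generates the sigma-algebra of the [G i] with [i != j]; imposing [B j = setT]
    keeps the index type ['I_l]. *)
Definition cylinders_off : set (set O) := [set C | exists B : 'I_l -> set R,
  [/\ forall i, measurable (B i), B j = setT &
      C = \bigcap_(i in [set: 'I_l]) (G i @^-1` B i)]].

Lemma measurable_cylinders_off : cylinders_off `<=` measurable.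
Proof.
move=> _ [B [mB _ ->]]; apply: fin_bigcap_measurable => // i _.
by rewrite -[X in measurable X]setTI; exact: Gmeas.
Qed.

Lemma setI_closed_cylinders_off : setI_closed cylinders_off.
Proof.
move=> _ _ [B [mB Bj ->]] [C [mC Cj ->]]; exists (fun i => B i `&` C i); split.
- by move=> i; exact: measurableI.
- by rewrite Bj Cj setIT.
- by rewrite -bigcapI; apply: eq_bigcapr => i _; rewrite preimage_setI.
Qed.

Lemma cylinders_off_independent (A : set R) (C : set O) : measurable A ->
  cylinders_off C -> P (G j @^-1` A `&` C) = (P (G j @^-1` A) * P C)%E.
Proof.
move=> mA [B [mB Bj ->]].
pose B' i := if i == j then A else B i.
have mB' i : measurable (B' i) by rewrite /B'; case: ifP.
rewrite (_ : _ `&` _ = \bigcap_(i in [set: 'I_l]) (G i @^-1` B' i)).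
  rewrite !Gind//.
  rewrite (bigD1 j)//= [in RHS](bigD1 j)//= /B' eqxx Bj preimage_setT.
  rewrite probability_setT mul1e; congr (_ * _)%E.
  by apply: eq_bigr => i /negbTE ->.
apply/seteqP; split=> [w /= [Aw Bw] i _|w Bw].
  by rewrite /B'; case: eqP => [->//|_]; exact: Bw.
split; first by have := Bw j Logic.I; rewrite /B' /= eqxx.
move=> i _; have := Bw i Logic.I; rewrite /B'/=; case: eqP => // ->.
by rewrite Bj.
Qed.

(** Pi-lambda argument: as functions of [D], the two sides are [P] restricted to the event of [G j]
    and [P] scaled by its probability; these measures agree on the pi-system. *)
Lemma sigma_cylinders_off_independent (A : set R) (D : set O) : measurable A ->
  <<s cylinders_off >> D -> P (G j @^-1` A `&` D) = (P (G j @^-1` A) * P D)%E.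
Proof.
move=> mA sD.
have mGA : measurable (G j @^-1` A).
  by rewrite -[X in measurable X]setTI; exact: Gmeas.
have p0 : (0 <= fine (P (G j @^-1` A)))%R by exact: fine_ge0.
pose m1 := mrestr P mGA.
pose m2 := mscale (NngNum p0) P.
have m2E X : m2 X = (P (G j @^-1` A) * P X)%E.
  by rewrite /m2/mscale/= fineK// fin_num_measure.
have HE : [set X | cylinders_off X /\ X `<=` setT] = cylinders_off.
  by apply/seteqP; split=> [X []//|X cX]; split.
rewrite -m2E setIC.
apply: (@g_sigma_algebra_measure_unique_trace _ _ _ cylinders_off setT
  measurableT _ _ m1 m2) => //; rewrite ?HE//.
- exact: measurable_cylinders_off.
- exact: setI_closed_cylinders_off.
- apply: eq_trans (esym (m2E _)); rewrite probability_setT mule1.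
  by rewrite /m1 /= /mrestr setTI.
- move=> X cX; apply: eq_trans (esym (m2E _)); rewrite /m1 /= /mrestr setIC.
  exact: cylinders_off_independent.
- by rewrite /m1 /= /mrestr setTI ltey_eq fin_num_measure.
Qed.

(** The carrier is still [O], with a smaller sigma-algebra: measurability on it expresses dependence
    on the coordinates other than [G j] only. *)
Definition off_type := g_sigma_algebraType cylinders_off.

Lemma measurable_off (i : 'I_l) : i != j ->
  measurable_fun [set: off_type] (G i : off_type -> R).
Proof.
move=> ij _ A mA; rewrite setTI; apply: sub_sigma_algebra.
exists (fun i' => if i' == i then A else setT); split.
- by move=> i'; case: ifP.
- by rewrite eq_sym (negbTE ij).
- apply/seteqP; split=> [w Aw i' _|w /(_ i Logic.I)/=]; last by rewrite eqxx.
  by rewrite /=; case: eqP => // ->.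
Qed.

End rest_independence.

(** * Quadratic forms and entrywise measurability of matrices *)

Definition qform (R : pzRingType) (n : nat) (N : 'M[R]_n) (z : 'cV[R]_n) : R :=
  (z^T *m N *m z) ord0 ord0.

Section measurable_matrix.
Context (R : realType) (d : measure_display) (T : measurableType d).

Definition mxmeasurable (m n : nat) (A : T -> 'M[R]_(m, n)) : Prop :=
  forall i j, measurable_fun setT (fun w => A w i j).

Lemma mxmeasurable_cst (m n : nat) (A : 'M[R]_(m, n)) :
  mxmeasurable (fun=> A).
Proof. by move=> i j; exact: measurable_cst. Qed.

Lemma mxmeasurableD (m n : nat) (A B : T -> 'M[R]_(m, n)) :
  mxmeasurable A -> mxmeasurable B -> mxmeasurable (fun w => A w + B w).
Proof.
move=> mA mB i j; under eq_fun do rewrite mxE.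
by apply: measurable_funD; [exact: mA|exact: mB].
Qed.

Lemma mxmeasurableZ (m n : nat) (c : R) (A : T -> 'M[R]_(m, n)) :
  mxmeasurable A -> mxmeasurable (fun w => c *: A w).
Proof.
move=> mA i j; under eq_fun do rewrite mxE.
by apply: measurable_funM; [exact: measurable_cst|exact: mA].
Qed.

Lemma mxmeasurableB (m n : nat) (A B : T -> 'M[R]_(m, n)) :
  mxmeasurable A -> mxmeasurable B -> mxmeasurable (fun w => A w - B w).
Proof.
move=> mA mB i j; under eq_fun do rewrite !mxE.
by apply: measurable_funB; [exact: mA|exact: mB].
Qed.

Lemma mxmeasurableM (m n p : nat) (A : T -> 'M[R]_(m, n))
    (B : T -> 'M[R]_(n, p)) :
  mxmeasurable A -> mxmeasurable B -> mxmeasurable (fun w => A w *m B w).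
Proof.
move=> mA mB i j; under eq_fun do rewrite mxE.
by apply: measurable_sum => k; apply: measurable_funM; [exact: mA|exact: mB].
Qed.

Lemma mxmeasurable_tr (m n : nat) (A : T -> 'M[R]_(m, n)) :
  mxmeasurable A -> mxmeasurable (fun w => (A w)^T).
Proof. by move=> mA i j; under eq_fun do rewrite mxE; exact: mA. Qed.

Lemma measurable_qform (n : nat) (N : T -> 'M[R]_n) (z : T -> 'cV[R]_n) :
  mxmeasurable N -> mxmeasurable z ->
  measurable_fun setT (fun w => qform (N w) (z w)).
Proof.
move=> mN mz; apply: mxmeasurableM => //; apply: mxmeasurableM => //.
exact: mxmeasurable_tr.
Qed.

End measurable_matrix.

Lemma qformD (R : comPzRingType) (n : nat) (N : 'M[R]_n) (y v : 'cV[R]_n)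
    (g : R) :
  qform N (y + g *: v) = qform N v * g ^+ 2
    + ((v^T *m N *m y) ord0 ord0 + (y^T *m N *m v) ord0 ord0) * g + qform N y.
Proof.
have -> : qform N (y + g *: v) =
    ((y^T + g *: v^T) *m N *m (y + g *: v)) ord0 ord0.
  by congr ((_ *m _ *m _) _ _); rewrite linearD linearZ.
rewrite /qform !mulmxDl !mulmxDr -!scalemxAl -!scalemxAr.
rewrite !mxE; ring.
Qed.

Section normal_quadratic.
Context (R : realType) (d : measure_display) (O : measurableType d)
  (P : probability O R) (l : nat) (G : 'I_l -> O -> R).
Hypothesis Gstd : std_normal_vector P G.

(** The pair [(Y1, Y2)] depends on the other coordinates only, hence is independent of [G j]; once
    it is frozen, the event is the root set of a polynomial of degree two. *)
Lemma normal_quadratic_null (j : 'I_l) (a c : R)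
    (Y1 Y2 : off_type G j -> R) : a != 0 ->
  measurable_fun setT Y1 -> measurable_fun setT Y2 ->
  P [set w | a * G j w ^+ 2 + Y1 w * G j w + Y2 w = c] = 0%E.
Proof.
move=> a0 mY1 mY2; have [mG lawG indG] := Gstd.
have mYO (Y : off_type G j -> R) :
    measurable_fun setT Y -> measurable_fun [set: O] (Y : O -> R).
  move=> mY _ A mA; rewrite setTI.
  have := mY measurableT A mA; rewrite setTI => sA.
  apply: (@smallest_sub _ (sigma_algebra setT)
    (cylinders_off G j) measurable) sA.
    exact: sigma_algebra_measurable.
  exact: (measurable_cylinders_off mG).
pose X : {mfun O >-> R} := HB.pack (G j) (isMeasurableFun.Build _ _ _ _ _ (mG j)).
have mY : measurable_fun [set: O] (fun w => (Y1 w, Y2 w)).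
  by apply: measurable_fun_pair; exact: mYO.
pose Y : {mfun O >-> (R * R)%type} :=
  HB.pack (fun w => (Y1 w, Y2 w)) (isMeasurableFun.Build _ _ _ _ _ mY).
pose F (z : R * (R * R)) := a * z.1 ^+ 2 + z.2.1 * z.1 + z.2.2.
have mF : measurable_fun setT F.
  apply: measurable_funD; last by apply: measurableT_comp.
  apply: measurable_funD.
    by apply: measurable_funM => //; exact: measurable_funX.
  by apply: measurable_funM => //; exact: measurableT_comp.
pose E := F @^-1` [set c].
have mE : measurable E.
  by rewrite -[E]setTI; apply: mF => //; exact: measurable_set1.
apply: (@independent_null _ _ _ _ _ _ _ P X Y _ E mE).
  move=> A B mA mB.
  apply: (sigma_cylinders_off_independent mG indG mA).
  have : measurable_fun setT (fun w : off_type G j => (Y1 w, Y2 w)).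
    exact: measurable_fun_pair.
  by move=> /(_ measurableT B mB); rewrite setTI.
move=> y; rewrite lawG; last exact: measurable_ysection.
rewrite -[RHS](normal_prob_quadratic0 0 1 y.1 (y.2 - c) a0).
congr (normal_prob _ _ _); apply/seteqP; split => x;
  rewrite /ysection/= inE/E/F/=; lra.
Qed.

(** The argument of the form is [y + G j v], where [v] is the [j]-th column of [L] and [y] involves
    the other coordinates; the coefficient of [G j ^+ 2] is then [qform N v]. *)
Lemma normal_qform_null (n : nat) (N : 'M[R]_n) (b : 'cV[R]_n)
    (L : 'M[R]_(n, l)) (j : 'I_l) (c : R) : qform N (col j L) != 0 ->
  P [set w | qform N (b + L *m \col_i G i w) = c] = 0%E.
Proof.
move=> Nj; have [mG _ _] := Gstd.
pose y (w : off_type G j) : 'cV[R]_n :=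
  b + L *m \col_i (if i == j then 0 else G i w).
have my : mxmeasurable y.
  apply: mxmeasurableD; first exact: mxmeasurable_cst.
  apply: mxmeasurableM; first exact: mxmeasurable_cst.
  move=> i u; under eq_fun do rewrite mxE.
  have [ij|ij] := eqVneq i j; first exact: measurable_cst.
  exact: measurable_off.
pose v := col j L.
have yE w : b + L *m \col_i G i w = y w + G j w *: v.
  rewrite /y -addrA; congr (_ + _); apply/matrixP => i u; rewrite !mxE.
  rewrite (bigD1 j)//= [in RHS](bigD1 j)//= !mxE eqxx mulr0 add0r addrC.
  congr (_ + _); last by rewrite mulrC.
  by apply: eq_bigr => k /negbTE kj; rewrite !mxE kj.
rewrite -[RHS](@normal_quadratic_null j (qform N v) c
  (fun w => (v^T *m N *m y w) ord0 ord0 + ((y w)^T *m N *m v) ord0 ord0)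
  (fun w => qform N (y w)))//.
- by congr (P _); apply/seteqP; split => w /=; rewrite yE qformD.
- apply: measurable_funD.
    by apply: mxmeasurableM => //; exact: mxmeasurable_cst.
  apply: mxmeasurableM; last exact: mxmeasurable_cst.
  apply: mxmeasurableM; last exact: mxmeasurable_cst.
  exact: mxmeasurable_tr.
- by apply: measurable_qform => //; exact: mxmeasurable_cst.
Qed.

End normal_quadratic.

(** * Densities and the law of large numbers *)

Lemma Rintegral_probability_cst (R : realType) (d : measure_display)
    (T : measurableType d) (P : probability T R) (c : R) :
  Rintegral P setT (fun=> c) = c.
Proof.
transitivity (c * fine (P setT)); first exact: Rintegral_cst.
by rewrite probability_setT mulr1.
Qed.

Section density.
Local Open Scope charge_scope.
Context (R : realType) (dT : measure_display) (T : measurableType dT)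
  (mu : {sigma_finite_measure set T -> \bar R}).

Lemma is_density_integrable (q : T -> R) :
  is_density mu q -> mu.-integrable setT (EFin \o q).
Proof.
move=> [mq q0 q1]; apply/integrableP; split; first exact/measurable_EFinP.
under eq_integral do rewrite /= ger0_norm//.
by rewrite q1 ltry.
Qed.

Lemma density_mul_integrable (q g : T -> R) (C : R) :
  is_density mu q -> measurable_fun setT g -> (forall x, `|g x| <= C) ->
  mu.-integrable setT (EFin \o (fun x => q x * g x)).
Proof.
move=> qd mg gC; have [mq q0 _] := qd.
apply: (@le_integrable _ _ _ _ _ _ _ (fun x => C%:E * (q x)%:E)%E) => //.
- by apply/measurable_EFinP; exact: measurable_funM.
- move=> x _; rewrite /= lee_fin normrM mulrC normrM.
  by rewrite ler_pM// (le_trans (gC x))// ler_norm.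
- by apply: integrableZl => //; exact: is_density_integrable.
Qed.

(** The law of [X] is dominated by [mu], and its Radon-Nikodym derivative is almost everywhere [q],
    since both have the same integral over every measurable set. *)
Lemma has_density_expectation (dO : measure_display) (O : measurableType dO)
    (P : probability O R) (q g : T -> R) (X : O -> T) (C : R) :
  is_density mu q -> has_density P mu q X ->
  measurable_fun setT g -> (forall x, `|g x| <= C) ->
  Rintegral P setT (g \o X) = Edens mu q g.
Proof.
move=> qd [mX lawX] mg gC; have [mq q0 _] := qd.
pose X_ : {mfun O >-> T} := HB.pack X (isMeasurableFun.Build _ _ _ _ _ mX).
pose nu := distribution P X_.
have numu : nu `<< mu.
  apply/null_content_dominatesP => A mA muA0; rewrite /nu /distribution/pushforward/=.
  rewrite lawX//; apply: null_set_integral => //.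
  exact/measurable_funTS/measurable_EFinP.
have ig : nu.-integrable setT (EFin \o g) by exact: (@integrable_bounded _ _ _ _ _ C).
rewrite /Edens /Rintegral; congr fine.
transitivity (\int[nu]_x (g x)%:E)%E.
  rewrite /nu (integral_distribution (f := EFin \o g))//.
    exact/measurable_EFinP.
  apply: (@integrable_bounded _ _ _ _ (g \o X) C) => [|w].
    exact: measurableT_comp.
  exact: gC.
rewrite -(Radon_Nikodym_change_of_variables numu measurableT ig).
apply: ae_eq_integral => //.
- apply: emeasurable_funM; first exact/measurable_EFinP.
  apply: (measurable_int mu); exact: Radon_Nikodym_integrable.
- by apply/measurable_EFinP; exact: measurable_funM.
- have h : ae_eq mu setT ('d (charge_of_finite_measure nu) '/d mu) (EFin \o q).
    apply: integral_ae_eq => //.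
    + exact: Radon_Nikodym_integrable.
    + exact/measurable_EFinP.
    + move=> A _ mA; rewrite -Radon_Nikodym_integral//.
      by rewrite /charge_of_finite_measure/= /nu /distribution/pushforward lawX.
  apply: filterS h => x h _; rewrite h// mulrC.
  by rewrite EFinM.
Qed.

(** A bounded function sees no more than the [L^1] distance of two densities; this transfers means
    from [pn i] to [p]. *)
Lemma Edens_diff_le (q1 q2 g : T -> R) (C : R) :
  is_density mu q1 -> is_density mu q2 -> measurable_fun setT g ->
  (forall x, `|g x| <= C) ->
  (`|Edens mu q1 g - Edens mu q2 g|%:E <=
   C%:E * \int[mu]_x `|q1 x - q2 x|%:E)%E.
Proof.
move=> d1 d2 mg gC.
have i1 := density_mul_integrable d1 mg gC.
have i2 := density_mul_integrable d2 mg gC.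
have iD : mu.-integrable setT (EFin \o (fun x => q1 x - q2 x)).
  by apply: (integrableB measurableT (is_density_integrable d1)
    (is_density_integrable d2)).
have iN := integrable_norm iD.
rewrite /Edens -RintegralB//.
have C0 : 0 <= C by exact: le_trans (normr_ge0 _) (gC point).
rewrite (le_trans (y := (Rintegral mu setT (fun x => `|q1 x * g x - q2 x * g x|))%:E))//.
  rewrite lee_fin; apply: le_normr_Rintegral => //.
  exact: (integrableB measurableT i1 i2).
rewrite -integralZl//.
rewrite /Rintegral fineK; last first.
  apply: integrable_fin_num => //; apply: integrable_norm.
  exact: (integrableB measurableT i1 i2).
apply: ge0_le_integral => //.
- have := integrable_norm (integrableB measurableT i1 i2).
  exact: measurable_int.
- exact: (measurable_int _ (integrableZl measurableT C iN)).
- by move=> x _; rewrite -EFinM lee_fin -mulrBl normrM mulrC ler_wpM2r.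
Qed.

End density.

Lemma mutually_independent_pair (R : realType) (dO dT : measure_display)
    (O : measurableType dO) (T : measurableType dT) (P : probability O R)
    (I : finType) (X : I -> O -> T) (i j : I) (A B : set T) :
  mutually_independent P X -> i != j -> measurable A -> measurable B ->
  P (X i @^-1` A `&` X j @^-1` B) = (P (X i @^-1` A) * P (X j @^-1` B))%E.
Proof.
move=> ind ij mA mB.
pose C k := if k == i then A else if k == j then B else setT.
have mC k : measurable (C k) by rewrite /C; case: ifP => // _; case: ifP.
have ji : j == i = false by rewrite eq_sym (negbTE ij).
rewrite (_ : _ `&` _ = \bigcap_(k in [set: I]) (X k @^-1` C k)); last first.
  apply/seteqP; split=> [w /= [Aw Bw] k _|w Cw].
    by rewrite /C/=; case: eqP => [->//|_]; case: eqP => [->//|_].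
  split; first by have := Cw i Logic.I; rewrite /C /= eqxx.
  by have := Cw j Logic.I; rewrite /C /= eqxx ji.
rewrite ind// (bigD1 i)//= (bigD1 j)/=; last by rewrite eq_sym.
rewrite big1 ?mule1; first by rewrite /C !eqxx ji.
move=> k /andP[/negbTE ki /negbTE kj].
by rewrite /C ki kj preimage_setT probability_setT.
Qed.

(** Chebyshev's inequality. *)
Lemma prob_normr_gt_le (R : realType) (dO : measure_display)
    (O : measurableType dO) (P : probability O R) (S : O -> R) (C e : R) :
  measurable_fun setT S -> (forall w, `|S w| <= C) -> 0 < e ->
  (P [set w | e < `|S w|]%R <=
   (e ^- 2 * Rintegral P setT (fun w => S w ^+ 2))%:E)%E.
Proof.
move=> mS SC e0.
have mE : measurable [set w | e < `|S w|]%R.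
  have : measurable_fun setT (fun w => `|S w|) by exact: measurableT_comp.
  move=> /(_ measurableT `]e, +oo[%classic (measurable_itv _)).
  by rewrite setTI preimage_itvoy.
have i2 : P.-integrable setT (EFin \o (fun w => S w ^+ 2)).
  apply: (@integrable_bounded _ _ _ _ _ (C ^+ 2)).
    exact: measurable_funX.
  by move=> w; rewrite normrX lerXn2r// ?nnegrE// (le_trans _ (SC w)).
rewrite EFinM /Rintegral fineK; last exact: integrable_fin_num.
rewrite -integralZl//.
have -> : P [set w | e < `|S w|]%R =
    (\int[P]_w (\1_[set w | e < `|S w|]%R w)%:E)%E.
  by rewrite integral_indic// setIT.
apply: ge0_le_integral => //.
- exact/measurable_EFinP/measurable_indic.
- exact: (measurable_int _ (integrableZl measurableT (e ^- 2) i2)).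
- move=> w _; rewrite -EFinM lee_fin indicE; case: (boolP (_ \in _)) => [|_].
    rewrite inE /= => ew; rewrite ler_pdivlMl ?exprn_gt0// mulr1.
    by rewrite -[leRHS]real_normK ?num_real// lerXn2r ?nnegrE// ltW.
  by rewrite mulr_ge0 ?invr_ge0 ?sqr_ge0// exprn_ge0// ltW.
Qed.

(** Pairwise independence cancels the off-diagonal covariances, and [2 * C] bounds the centred
    variables. The bound is explicit and involves the law only through [C], because the law of the
    sample changes with its size. *)
Lemma lln_bounded (R : realType) (dO dT : measure_display)
    (O : measurableType dO) (T : measurableType dT) (P : probability O R)
    (n : nat) (X : 'I_n -> O -> T) (g : T -> R) (C e a : R) :
  (0 < n)%N -> 0 < e -> (forall j, measurable_fun setT (X j)) ->
  (forall i j A B, i != j -> measurable A -> measurable B ->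
    P (X i @^-1` A `&` X j @^-1` B) = (P (X i @^-1` A) * P (X j @^-1` B))%E) ->
  measurable_fun setT g -> (forall x, `|g x| <= C) ->
  (forall j, Rintegral P setT (g \o X j) = a) ->
  (P [set w | e < `|n%:R^-1 * (\sum_(j < n) g (X j w)) - a|]%R <=
   (e ^- 2 * ((2 * C) ^+ 2 / n%:R))%:E)%E.
Proof.
move=> n0 e0 mX ind mg gC ga.
have C0 : 0 <= C by exact: le_trans (normr_ge0 _) (gC point).
have nR : (0 : R) < n%:R by rewrite ltr0n.
have aC : `|a| <= C.
  rewrite -(ga (Ordinal n0)).
  have ig := @integrable_bounded _ _ _ P (g \o X (Ordinal n0)) C
    (measurableT_comp mg (mX _)) (fun x => gC _).
  apply: (le_trans (le_normr_Rintegral measurableT ig)).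
  rewrite -[leRHS](_ : Rintegral P setT (fun=> C) = C); last first.
    exact: Rintegral_probability_cst.
  apply: le_Rintegral => //; first exact: integrable_norm.
    exact: finite_measure_integrable_cst.
  by move=> w _; exact: gC.
pose h x := g x - a.
have mh : measurable_fun setT h by exact: measurable_funB.
have hC x : `|h x| <= 2 * C.
  have -> : 2 * C = C + C by ring.
  by apply: le_trans (ler_normB _ _) _; apply: lerD; [exact: gC|exact: aC].
have h0 j : Rintegral P setT (h \o X j) = 0.
  have ig : P.-integrable setT (EFin \o (g \o X j)).
    apply: (@integrable_bounded _ _ _ _ _ C) => [|w]; last exact: gC.
    exact: measurableT_comp.
  rewrite /h/= RintegralB//; last exact: finite_measure_integrable_cst.
  by rewrite Rintegral_probability_cst [X in X - _]ga subrr.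
have C20 : 0 <= 2 * C by rewrite mulr_ge0.
pose S w := n%:R^-1 * \sum_(j < n) h (X j w).
have SE w : n%:R^-1 * (\sum_(j < n) g (X j w)) - a = S w.
  rewrite /S /h big_split/= sumr_const card_ord -[_ *+ n]mulr_natr.
  by field; rewrite gt_eqF.
under eq_set do rewrite SE.
have mhX j : measurable_fun setT (fun w => h (X j w)).
  exact: (measurableT_comp mh (mX j)).
have mS : measurable_fun setT S.
  by apply: measurable_funM => //; exact: measurable_sum.
have SC w : `|S w| <= 2 * C.
  rewrite /S normrM gtr0_norm ?invr_gt0// ler_pdivrMl//.
  rewrite (le_trans (ler_norm_sum _ _ _))//.
  rewrite (le_trans (ler_sum _ (fun j _ => hC (X j w))))//.
  by rewrite sumr_const card_ord [leRHS]mulr_natl.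
apply: le_trans (prob_normr_gt_le P mS SC e0) _.
rewrite lee_fin; apply: ler_wpM2l; first by rewrite invr_ge0 exprn_ge0// ltW.
have ihh j k : P.-integrable setT (EFin \o (fun w => h (X j w) * h (X k w))).
  apply: (@integrable_bounded _ _ _ _ _ ((2 * C) * (2 * C))).
    exact: measurable_funM.
  by move=> w; rewrite normrM ler_pM.
have hh j k : j != k -> Rintegral P setT (fun w => h (X j w) * h (X k w)) = 0.
  move=> jk.
  pose Xj : {mfun O >-> T} := HB.pack (X j) (isMeasurableFun.Build _ _ _ _ _ (mX j)).
  pose Xk : {mfun O >-> T} := HB.pack (X k) (isMeasurableFun.Build _ _ _ _ _ (mX k)).
  have := @independent_expectation_mul _ _ _ _ _ _ _ P Xj Xk
    (fun A B mA mB => ind j k A B jk mA mB) h h (2 * C) mh mh hC hC.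
  by move=> ->; rewrite [X in X * _](h0 j) mul0r.
have hj j : Rintegral P setT (fun w => h (X j w) * h (X j w)) <= (2 * C) ^+ 2.
  rewrite -[leRHS](_ : Rintegral P setT (fun=> (2 * C) ^+ 2) = _); last first.
    exact: Rintegral_probability_cst.
  apply: le_Rintegral => //; first exact: finite_measure_integrable_cst.
  move=> w _; rewrite -expr2 -[leLHS]real_normK ?num_real//.
  by rewrite lerXn2r ?nnegrE.
have S2 : (fun w => S w ^+ 2) =
    (fun w => n%:R^-1 ^+ 2 * \sum_(j < n) \sum_(k < n) h (X j w) * h (X k w)).
  apply/funext => w; rewrite /S exprMn; congr (_ * _).
  by rewrite expr2 mulr_suml; apply: eq_bigr => j _; rewrite mulr_sumr.
have isum j : P.-integrable setT
    (EFin \o (fun w => \sum_(k < n) h (X j w) * h (X k w))).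
  rewrite (_ : EFin \o _ =
      (fun w => \sum_(k < n) (h (X j w) * h (X k w))%:E)%E).
    by apply: integrable_sum => // k _; exact: ihh.
  by apply/funext => w; rewrite /= sumEFin.
rewrite S2 RintegralZl//; last first.
  rewrite (_ : EFin \o _ = (fun w =>
      \sum_(j < n) (\sum_(k < n) h (X j w) * h (X k w))%:E)%E).
    by apply: integrable_sum => // k _; exact: isum.
  by apply/funext => w; rewrite /= sumEFin.
rewrite Rintegral_sum//.
under eq_bigr => j _.
  rewrite Rintegral_sum// (bigD1 j)//= big1; last first.
    by move=> k kj; apply: hh; rewrite eq_sym.
  rewrite addr0; over.
have n1 : n%:R^-1 ^+ 2 * ((2 * C) ^+ 2 *+ n) = (2 * C) ^+ 2 / n%:R.
  by rewrite -[_ *+ n]mulr_natr; field; rewrite gt_eqF.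
rewrite -n1; apply: ler_wpM2l; first by rewrite exprn_ge0// invr_ge0 ltW.
apply: (le_trans (ler_sum _ (fun j _ => hj j))).
by rewrite sumr_const card_ord.
Qed.

(** * Convergence in law and limits of powers *)

Section ramp.
Context (R : realType).

(** A continuous stand-in for the indicator of a half-line, equal to [0] up to [a] and to [1] from
    [b] on; convergence in law is only tested on continuous functions. *)
Definition ramp (a b t : R) : R := Num.min 1 (Num.max 0 ((t - a) / (b - a))).

Lemma ramp_ge0 (a b t : R) : 0 <= ramp a b t.
Proof. by rewrite /ramp le_min ler01/= le_max lexx. Qed.

Lemma ramp_le1 (a b t : R) : ramp a b t <= 1.
Proof. by rewrite /ramp ge_min lexx. Qed.

Lemma ramp1 (a b t : R) : a < b -> b <= t -> ramp a b t = 1.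
Proof.
move=> ab bt; rewrite /ramp; apply/min_idPl; rewrite le_max; apply/orP; right.
by rewrite ler_pdivlMr ?subr_gt0// mul1r lerB.
Qed.

Lemma ramp0 (a b t : R) : a < b -> t <= a -> ramp a b t = 0.
Proof.
move=> ab ta; rewrite /ramp (_ : Num.max _ _ = 0) ?(min_idPr _)//.
by apply/max_idPl; rewrite ler_pdivrMr ?subr_gt0// mul0r subr_le0.
Qed.

Lemma continuous_ramp (a b : R) : continuous (ramp a b).
Proof.
move=> t.
apply: (@continuous_min R R (cst 1) (cst 0 \max (fun t : R => (t - a) / (b - a)))).
  exact: cvg_cst.
apply: (@continuous_max R R (cst 0) (fun t : R => (t - a) / (b - a))).
  exact: cvg_cst.
by apply: cvgMl; apply: cvgB; [exact: cvg_id|exact: cvg_cst].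
Qed.

Lemma measurable_ramp (a b : R) : measurable_fun setT (ramp a b).
Proof. by apply: continuous_measurable_fun; exact: continuous_ramp. Qed.

End ramp.

Section prob_ramp.
Context (R : realType) (d : measure_display) (O : measurableType d)
  (P : probability O R) (Z : O -> R) (a b : R).
Hypotheses (mZ : measurable_fun setT Z) (ab : a < b).

Lemma measurable_ge_event (t : R) : measurable [set w | t <= Z w].
Proof.
rewrite -preimage_itvcy -[X in measurable X]setTI.
by apply: mZ => //; exact: measurable_itv.
Qed.

Lemma measurable_gt_event (t : R) : measurable [set w | t < Z w].
Proof.
rewrite -preimage_itvoy -[X in measurable X]setTI.
by apply: mZ => //; exact: measurable_itv.
Qed.

Let mrampZ : measurable_fun setT (fun w => (ramp a b (Z w))%:E).
Proof.
by apply/measurable_EFinP; apply: measurableT_comp => //; exact: measurable_ramp.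
Qed.

Lemma prob_le_ramp :
  (P [set w | (b <= Z w)%R] <= \int[P]_w (ramp a b (Z w))%:E)%E.
Proof.
rewrite -[in leLHS](setIT [set w | b <= Z w]) -integral_indic//;
  last exact: measurable_ge_event.
apply: ge0_le_integral => //.
- exact/measurable_EFinP/measurable_indic/measurable_ge_event.
- move=> w _; rewrite lee_fin indicE; case: (boolP (_ \in _)) => [|_].
    by rewrite inE/= => bw; rewrite ramp1.
  exact: ramp_ge0.
Qed.

Lemma ramp_le_prob :
  (\int[P]_w (ramp a b (Z w))%:E <= P [set w | (a < Z w)%R])%E.
Proof.
rewrite -[in leRHS](setIT [set w | a < Z w]) -integral_indic//;
  last exact: measurable_gt_event.
apply: ge0_le_integral => //.
- by move=> w _; rewrite lee_fin; exact: ramp_ge0.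
- exact/measurable_EFinP/measurable_indic/measurable_gt_event.
- move=> w _; rewrite lee_fin indicE; case: (boolP (_ \in _)) => [_|].
    exact: ramp_le1.
  by rewrite notin_setE/= => /negP; rewrite -leNgt => aw; rewrite ramp0.
Qed.

End prob_ramp.

Lemma near_ereal_le (R : realType) (u : nat -> \bar R) (l : \bar R) (e : R) :
  0 < e -> l \is a fin_num -> u @ \oo --> l ->
  \forall i \near \oo, (u i <= l + e%:E /\ l <= u i + e%:E)%E.
Proof.
move=> e0 lfin ul; have le : (l < l + e%:E)%E by rewrite lteDl// lte_fin.
have el : (l - e%:E < l)%E by rewrite lteBlDr// lteDl// lte_fin.
have h1 : \forall i \near \oo, (u i < l + e%:E)%E := ul _ (open_ereal_lt' le).
have h2 : \forall i \near \oo, (l - e%:E < u i)%E := ul _ (open_ereal_gt' el).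
near=> i; split; first by apply: ltW; near: i.
by rewrite -leeBlDr//; apply: ltW; near: i.
Unshelve. all: end_near. Qed.

Lemma near_ereal0_le (R : realType) (u : nat -> \bar R) (e : R) :
  0 < e -> u @ \oo --> 0%E -> \forall i \near \oo, (u i <= e%:E)%E.
Proof.
move=> e0 u0; apply: filterS (near_ereal_le e0 (isT : 0%E \is a fin_num) u0) => i [+ _].
by rewrite add0e.
Qed.

Lemma limn_esup_le_near (R : realType) (u : nat -> \bar R) (l : \bar R) :
  (\forall i \near \oo, (u i <= l)%E) -> (limn_esup u <= l)%E.
Proof.
move=> [n _ un]; rewrite limn_esup_lim; apply: lime_le.
  exact: is_cvg_esups.
exists n => // i /= ni; apply: ge_ereal_sup => _ [j /= ij <-].
by apply: un => /=; exact: leq_trans ij.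
Qed.

Lemma le_limn_einf_near (R : realType) (u : nat -> \bar R) (l : \bar R) :
  (\forall i \near \oo, (l <= u i)%E) -> (l <= limn_einf u)%E.
Proof.
move=> lu; rewrite /limn_einf leeNr; apply: limn_esup_le_near.
by apply: filterS lu => i; rewrite leeN2.
Qed.

(** * Events of probability tending to one *)

Section whp.
Context (R : realType) (dO : nat -> measure_display)
  (O : forall i, measurableType (dO i)) (P : forall i, probability (O i) R).

(* The exceptional set is required to be measurable instead of [A i], because a
   probability takes arbitrary values on non-measurable sets. *)
Definition whp (A : forall i, set (O i)) : Prop :=
  forall e : R, 0 < e -> \forall i \near \oo, exists N : set (O i),
    [/\ measurable N, (P i N <= e%:E)%E & ~` N `<=` A i].

Lemma whp_near (A : forall i, set (O i)) :
  (\forall i \near \oo, forall w, A i w) -> whp A.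
Proof.
move=> nA e e0; apply: filterS nA => i Ai; exists set0; split => //.
by rewrite measure0 lee_fin ltW.
Qed.

Lemma whpI (A B : forall i, set (O i)) :
  whp A -> whp B -> whp (fun i => A i `&` B i).
Proof.
move=> wA wB e e0.
have e20 : 0 < e / 2 by rewrite divr_gt0.
near=> i.
have [N [mN PN NA]] : exists N : set (O i),
    [/\ measurable N, (P i N <= (e / 2)%:E)%E & ~` N `<=` A i].
  by near: i; exact: wA.
have [N' [mN' PN' NB]] : exists N : set (O i),
    [/\ measurable N, (P i N <= (e / 2)%:E)%E & ~` N `<=` B i].
  by near: i; exact: wB.
exists (N `|` N'); split; first exact: measurableU.
  apply: (le_trans (measureU2 _ _ _)) => //.
  by rewrite [e in leRHS]splitr EFinD leeD.
by rewrite setCU => w [Nw N'w]; split; [exact: NA|exact: NB].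
Unshelve. all: end_near. Qed.

Lemma whp_sub (A B : forall i, set (O i)) :
  (\forall i \near \oo, A i `<=` B i) -> whp A -> whp B.
Proof.
move=> AB wA e e0; near=> i.
have [N [mN PN NA]] : exists N : set (O i),
    [/\ measurable N, (P i N <= e%:E)%E & ~` N `<=` A i].
  by near: i; exact: wA.
exists N; split => // w /NA; have : A i `<=` B i by near: i.
exact.
Unshelve. all: end_near. Qed.

Lemma whp_seq (I : eqType) (l : seq I) (A : I -> forall i, set (O i)) :
  (forall j, whp (A j)) ->
  whp (fun i => [set w | forall j, j \in l -> A j i w]).
Proof.
move=> wA; elim: l => [|j l IH]; first by apply: whp_near; near=> i.
apply: whp_sub (whpI (wA j) IH); near=> i => w [Aw lw] k.
by rewrite inE => /orP[/eqP ->//|]; exact: lw.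
Unshelve. all: end_near. Qed.

Lemma whp_fin (I : finType) (A : I -> forall i, set (O i)) :
  (forall j, whp (A j)) -> whp (fun i => [set w | forall j, A j i w]).
Proof.
move=> wA; apply: whp_sub (whp_seq (enum I) wA); near=> i => w Aw j.
by apply: Aw; rewrite mem_enum.
Unshelve. all: end_near. Qed.

(** There are finitely many entries, and their measurability makes the deviation events admissible
    exceptional sets. *)
Lemma cvg_in_prob_whp (a b : nat) (X : forall i, O i -> 'M[R]_(a, b))
    (L : 'M[R]_(a, b)) (e : R) :
  (forall i, mxmeasurable (X i)) -> cvg_in_prob P X L -> 0 < e ->
  whp (fun i => [set w | forall u v, `|X i w u v - L u v| <= e]).
Proof.
move=> mX XL e0.
apply: whp_sub (@whp_fin _ (fun (uv : 'I_a * 'I_b) i =>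
   [set w | `|X i w uv.1 uv.2 - L uv.1 uv.2| <= e]) _).
  by near=> i => w H u v; exact: (H (u, v)).
move=> [u v] /= eta eta0.
have := XL u v e e0.
move=> /(near_ereal0_le eta0); apply: filterS => i le.
exists [set w | e < `|X i w u v - L u v|]; split => //.
  apply: measurable_gt_event; apply: measurableT_comp => //.
  by apply: measurable_funB => //; exact: mX.
by move=> w /= /negP; rewrite -leNgt.
Unshelve. all: end_near. Qed.

End whp.

(** * Tails of the limit law and comparison of powers *)

Section portmanteau.
Context (R : realType) (dO : nat -> measure_display)
  (O : forall i, measurableType (dO i)) (P : forall i, probability (O i) R)
  (n : nat) (X : forall i, O i -> 'cV[R]_n)
  (dY : measure_display) (OY : measurableType dY) (Q : probability OY R)
  (Y : OY -> 'cV[R]_n).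
Arguments X : clear implicits.
Hypothesis XY : cvg_in_law P X Q Y.

(** [ramp a b] lies between the indicators of the two half-lines; the gap [a < b] replaces
    continuity of the limit law at the level. *)
Lemma cvg_in_law_tail (q : 'cV[R]_n -> R) (a b e : R) :
  continuous q -> (forall i, measurable_fun setT (q \o X i)) ->
  measurable_fun setT (q \o Y) -> a < b -> 0 < e ->
  \forall i \near \oo,
    (P i [set w | (b <= q (X i w))%R] <= Q [set w | (a < q (Y w))%R] + e%:E /\
     Q [set w | (b <= q (Y w))%R] <= P i [set w | (a < q (X i w))%R] + e%:E)%E.
Proof.
move=> qc mqX mqY ab e0.
have rq : continuous (fun z => ramp a b (q z)).
  by move=> z; apply: continuous_comp; [exact: qc|exact: continuous_ramp].
have rb : exists C : R, forall z, `|ramp a b (q z)| <= C.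
  by exists 1 => z; rewrite ger0_norm ?ramp_ge0 ?ramp_le1.
have iQ : (\int[Q]_w (ramp a b (q (Y w)))%:E)%E \is a fin_num.
  apply: (integrable_fin_num measurableT).
  apply: (@integrable_bounded _ _ _ _ (fun w => ramp a b (q (Y w))) 1) => [|w].
    by apply: measurableT_comp mqY; exact: measurable_ramp.
  by rewrite ger0_norm ?ramp_ge0 ?ramp_le1.
have := near_ereal_le e0 iQ (XY rq rb).
apply: filterS => i [H1 H2]; split.
  apply: (le_trans (prob_le_ramp (P i) (mqX i) ab)); apply: (le_trans H1).
  rewrite leeD2r//.
  exact: ramp_le_prob.
apply: (le_trans (prob_le_ramp Q mqY ab)); apply: (le_trans H2).
rewrite leeD2r//.
exact: ramp_le_prob.
Qed.

Lemma prob_gt_nat_cvg0 (d : measure_display) (T : measurableType d)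
    (mu : probability T R) (Z : T -> R) : measurable_fun setT Z ->
  (fun k : nat => mu [set w | (k%:R < Z w)%R]) @ \oo --> 0%E.
Proof.
move=> mZ; pose F (k : nat) := [set w | k%:R < Z w].
have F0 : \bigcap_k F k = set0.
  apply/seteqP; split => // w /(_ (Num.bound `|Z w|) Logic.I).
  rewrite /F/= ltNge => /negP; apply; apply: ltW.
  exact: le_lt_trans (ler_norm _) (archi_boundP (normr_ge0 _)).
rewrite -[X in _ --> X](_ : mu (\bigcap_k F k) = 0%E); last by rewrite F0 measure0.
apply: nonincreasing_cvg_mu.
- by rewrite ltey_eq fin_num_measure//; exact: measurable_gt_event.
- by move=> k; exact: measurable_gt_event.
- by rewrite F0.
- move=> k l kl; apply/subsetPset => w; rewrite /F/=; apply: le_lt_trans.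
  by rewrite ler_nat.
Qed.

(** Continuity from above: the windows decrease to the event [Z w = c]. *)
Lemma prob_window_cvg (d : measure_display) (T : measurableType d)
    (mu : probability T R) (Z : T -> R) (c : R) : measurable_fun setT Z ->
  mu [set w | Z w = c] = 0%E ->
  (fun k : nat => mu [set w | `|Z w - c| <= k.+1%:R^-1]) @ \oo --> 0%E.
Proof.
move=> mZ Z0; pose F (k : nat) := [set w | `|Z w - c| <= k.+1%:R^-1].
have mF k : measurable (F k).
  have : measurable_fun setT (fun w => `|Z w - c|).
    by apply: measurableT_comp => //; exact: measurable_funB.
  move=> /(_ measurableT `]-oo, k.+1%:R^-1]%classic (measurable_itv _)).
  by rewrite setTI preimage_itvNyc.
have F0 : \bigcap_k F k = [set w | Z w = c].
  apply/seteqP; split => [w Fw|w /= Zc k _]; last first.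
    by rewrite /F/= Zc subrr normr0 invr_ge0.
  apply/eqP; rewrite /= -subr_eq0 -normr_eq0 eq_le normr_ge0 andbT.
  apply/ler_addgt0Pl => e e0; rewrite addr0.
  have [k] := near_infty_natSinv_lt (PosNum e0).
  move=> _ /(_ k (leqnn _))/= /ltW; apply: le_trans.
  exact: (Fw k).
rewrite -[X in _ --> X](_ : mu (\bigcap_k F k) = 0%E); last by rewrite F0.
apply: nonincreasing_cvg_mu.
- by rewrite ltey_eq fin_num_measure//; exact: mF.
- exact: mF.
- exact: bigcapT_measurable.
- move=> k l kl; apply/subsetPset => w; rewrite /F/= => /le_trans; apply.
  by rewrite lef_pV2 ?posrE// ler_nat.
Qed.

(** [E] forces [q >= c - e] and [q > c + e] forces [D], so the two probabilities are separated by
    tails of the limit law that differ by the mass of a window around [c], small because [c] is not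
    an atom. The function [s] measures size: the comparison is required for bounded size only, and
    tightness of [s (Y w)] disposes of the rest. *)
Lemma limn_power_le (q s : 'cV[R]_n -> R) (c : R) (E D : forall i, set (O i)) :
  continuous q -> (forall i, measurable_fun setT (q \o X i)) ->
  measurable_fun setT (q \o Y) ->
  continuous s -> (forall i, measurable_fun setT (s \o X i)) ->
  measurable_fun setT (s \o Y) ->
  Q [set w | q (Y w) = c] = 0%E ->
  (forall i, measurable (E i)) -> (forall i, measurable (D i)) ->
  (forall e K : R, 0 < e -> whp P (fun i => [set w | s (X i w) <= K ->
     (E i w -> c - e <= q (X i w)) /\ (c + e < q (X i w) -> D i w)])) ->
  (limn_esup (fun i => P i (E i)) <= limn_einf (fun i => P i (D i)))%E.
Proof.
move=> qc mqX mqY sc msX msY Q0 mE mD H.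
apply/lee_addgt0Pr => eta eta0.
(* Five parts are allotted to each side of the pivot [A]: three for the exceptional event, one for
   convergence in law and one for the window, the last being slack in the lower bound. *)
pose et := eta / 10.
have et0 : 0 < et by rewrite divr_gt0.
have [K QK] : exists K : R, (Q [set w | (K < s (Y w))%R] <= et%:E)%E.
  have /(near_ereal0_le et0) := prob_gt_nat_cvg0 Q msY.
  by move=> [k _ /(_ k (leqnn _)) ?]; exists k%:R.
have [e e0 Qe] : exists2 e : R, 0 < e &
    (Q [set w | `|(q \o Y) w - c| <= e]%R <= et%:E)%E.
  have /(near_ereal0_le et0) := prob_window_cvg mqY Q0.
  move=> [k _ /(_ k (leqnn _)) ?].
  by exists k.+1%:R^-1 => //; rewrite invr_gt0.
(* A tolerance strictly below [e] leaves the gap between levels required by [cvg_in_law_tail]. *)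
pose e2 := e / 2.
have e20 : 0 < e2 by rewrite divr_gt0.
have ee2 : e2 < e by rewrite /e2; lra.
pose A := Q [set w | (c + e <= q (Y w))%R].
have Afin : A \is a fin_num.
  by rewrite fin_num_measure//; exact: (measurable_ge_event mqY).
have QA : (Q [set w | (c - e < q (Y w))%R] <= A + et%:E)%E.
  apply: (@le_trans _ _ (A + Q [set w | `|(q \o Y) w - c| <= e]%R)%E); last first.
    by rewrite leeD2l.
  have m1 : measurable [set w | (c + e <= q (Y w))%R] by exact: (measurable_ge_event mqY).
  have m2 : measurable [set w | `|(q \o Y) w - c| <= e]%R.
    have : measurable_fun setT (fun w => `|(q \o Y) w - c|).
      by apply: measurableT_comp => //; exact: measurable_funB.
    move=> /(_ measurableT `]-oo, e]%classic (measurable_itv _)).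
    by rewrite setTI preimage_itvNyc.
  apply: (le_trans _ (measureU2 _ m1 m2)).
  apply: le_measure; rewrite ?inE.
  - exact: (measurable_gt_event mqY).
  - exact: measurableU.
  - move=> w /= cq; have [?|?] := leP (c + e) (q (Y w)); first by left.
    by right; rewrite ler_norml; apply/andP; split; lra.
have bad : \forall i \near \oo, exists N : set (O i), [/\ measurable N,
    (P i N <= (3 * et)%:E)%E &
    ~` N `<=` [set w |
      (E i w -> c - e2 <= q (X i w)) /\ (c + e2 < q (X i w) -> D i w)]].
  near=> i.
  have [N [mN PN NA]] : exists N : set (O i), [/\ measurable N,
      (P i N <= et%:E)%E &
      ~` N `<=` [set w | s (X i w) <= K + 1 ->
     (E i w -> c - e2 <= q (X i w)) /\ (c + e2 < q (X i w) -> D i w)]].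
    by near: i; exact: H.
  have [Ps _] : (P i [set w | (K + 1 <= s (X i w))%R] <=
       Q [set w | (K < s (Y w))%R] + et%:E /\
     Q [set w | (K + 1 <= s (Y w))%R] <= P i [set w | (K < s (X i w))%R] + et%:E)%E.
    by near: i; apply: cvg_in_law_tail => //; rewrite ltrDl.
  have mS : measurable [set w | K + 1 <= s (X i w)] by exact: (measurable_ge_event (msX i)).
  exists (N `|` [set w | K + 1 <= s (X i w)]); split; first exact: measurableU.
    apply: (le_trans (measureU2 _ mN mS)).
    have -> : (3 * et)%:E = (et%:E + (et%:E + et%:E))%E.
      by rewrite -!EFinD; congr EFin; lra.
    by rewrite leeD// (le_trans Ps)// leeD2r.
  rewrite setCU => w [/NA/= h /negP]; rewrite -ltNge => /ltW; exact: h.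
have up : \forall i \near \oo, (P i (E i) <= A + (5 * et)%:E)%E.
  near=> i.
  have [N [mN PN NA]] : exists N : set (O i), [/\ measurable N,
    (P i N <= (3 * et)%:E)%E &
    ~` N `<=` [set w |
      (E i w -> c - e2 <= q (X i w)) /\ (c + e2 < q (X i w) -> D i w)]].
    by near: i.
  have [Pq _] : (P i [set w | (c - e2 <= q (X i w))%R] <=
       Q [set w | (c - e < q (Y w))%R] + et%:E /\
     Q [set w | (c - e2 <= q (Y w))%R] <= P i [set w | (c - e < q (X i w))%R] + et%:E)%E.
    by near: i; apply: cvg_in_law_tail => //; lra.
  have m1 : measurable [set w | (c - e2 <= q (X i w))%R] by exact: (measurable_ge_event (mqX i)).
  apply: (@le_trans _ _ (P i (N `|` [set w | (c - e2 <= q (X i w))%R]))).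
    apply: le_measure; rewrite ?inE//; first exact: measurableU.
    move=> w Ew; have [|Nw] := pselect (N w); first by left.
    by right; apply: (NA _ Nw).1.
  apply: (le_trans (measureU2 _ mN m1)).
  have -> : (5 * et)%:E = (et%:E + et%:E + (3 * et)%:E)%E.
    by rewrite -!EFinD; congr EFin; lra.
  rewrite addeC !addeA leeD//; apply: (le_trans Pq).
  by rewrite leeD2r.
have lo : \forall i \near \oo, (A <= P i (D i) + (5 * et)%:E)%E.
  near=> i.
  have [N [mN PN NA]] : exists N : set (O i), [/\ measurable N,
    (P i N <= (3 * et)%:E)%E &
    ~` N `<=` [set w |
      (E i w -> c - e2 <= q (X i w)) /\ (c + e2 < q (X i w) -> D i w)]].
    by near: i.
  have [_ Pq] : (P i [set w | (c + e <= q (X i w))%R] <=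
       Q [set w | (c + e2 < q (Y w))%R] + et%:E /\
     Q [set w | (c + e <= q (Y w))%R] <= P i [set w | (c + e2 < q (X i w))%R] + et%:E)%E.
    by near: i; apply: cvg_in_law_tail => //; lra.
  apply: (le_trans Pq).
  have -> : (5 * et)%:E = ((4 * et)%:E + et%:E)%E.
    by rewrite -!EFinD; congr EFin; lra.
  rewrite addeA leeD2r//.
  apply: (@le_trans _ _ (P i (D i `|` N))).
    apply: le_measure; rewrite ?inE//; last 2 first.
    - exact: measurableU.
    - move=> w qw; have [|Nw] := pselect (N w); first by right.
      by left; apply: (NA _ Nw).2.
    exact: (measurable_gt_event (mqX i)).
  apply: (le_trans (measureU2 _ (mD i) mN)).
  by rewrite leeD2l// (le_trans PN)// lee_fin; lra.
have L : (A - (5 * et)%:E <= limn_einf (fun i => P i (D i)))%E.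
  by apply: le_limn_einf_near; apply: filterS lo => i; rewrite leeBlDr.
apply: (le_trans (limn_esup_le_near up)).
have -> : (eta%:E = (5 * et)%:E + (5 * et)%:E)%E.
  by rewrite -EFinD; congr EFin; rewrite /et; lra.
by rewrite addeA leeD2r// -leeBlDr.
Unshelve. all: end_near. Qed.

End portmanteau.

(** * Measurability and uniform differentiability of the model *)

Section matrix_norm.
Context (R : realType).

Let mx_norm_bigmax (m n : nat) (A : 'M[R]_(m, n)) :
  `|A| = \big[Num.max/0]_ij `|A ij.1 ij.2|.
Proof. exact: mx_normrE. Qed.

Lemma mx_entry_norm_le (m n : nat) (A : 'M[R]_(m, n)) (i : 'I_m) (j : 'I_n) :
  `|A i j| <= `|A|.
Proof.
rewrite [leRHS]mx_norm_bigmax.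
by apply/bigmax_geP; right; exists (i, j).
Qed.

Lemma mx_norm_le (m n : nat) (A : 'M[R]_(m, n)) (C : R) : 0 <= C ->
  (forall i j, `|A i j| <= C) -> `|A| <= C.
Proof.
move=> C0 AC; rewrite mx_norm_bigmax; by apply/bigmax_leP; split.
Qed.

Lemma mx_norm_lt (m n : nat) (A : 'M[R]_(m, n)) (C : R) : 0 < C ->
  (forall i j, `|A i j| < C) -> `|A| < C.
Proof.
move=> C0 AC; rewrite mx_norm_bigmax; by apply/bigmax_ltP; split.
Qed.

(** A countable dense family of parameters, over which uncountable quantifiers become countable
    intersections. *)
Definition ratmx (m n : nat) (A : 'M[rat]_(m, n)) : 'M[R]_(m, n) :=
  map_mx ratr A.

Lemma ratmx_dense (m n : nat) (A : 'M[R]_(m, n)) (e : R) : 0 < e ->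
  exists q, `|ratmx q - A| < e.
Proof.
move=> e0.
have H (ij : 'I_m * 'I_n) : exists q : rat, `|ratr q - A ij.1 ij.2| < e.
  have : A ij.1 ij.2 - e < A ij.1 ij.2 + e by lra.
  move=> /rat_in_itvoo[q]; rewrite in_itv/= => /andP[q1 q2]; exists q.
  by rewrite ltr_norml; apply/andP; split; lra.
have [f fP] := choice H.
exists (\matrix_(i, j) f (i, j)); apply: mx_norm_lt => // i j.
by rewrite !mxE; exact: (fP (i, j)).
Qed.

End matrix_norm.

Lemma measurable_bigcap_countType (d : measure_display) (T : measurableType d)
    (I : countType) (F : I -> set T) :
  (forall i, measurable (F i)) -> measurable (\bigcap_i F i).
Proof.
move=> mF; rewrite -[X in measurable X]setCK setC_bigcap; apply: measurableC.
apply: countable_bigcupT_measurable; first exact: countableP.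
by move=> i; exact: measurableC.
Qed.

(** * Measurability of the model at a random parameter *)

Section caratheodory.
Context (R : realType) (d dT : measure_display) (O : measurableType d)
  (T : measurableType dT) (n : nat) (Theta : set 'cV[R]_n)
  (r : T -> 'cV[R]_n -> R).
Hypotheses (Theta_open : open Theta)
  (r_meas : forall t, Theta t -> measurable_fun setT (fun x => r x t))
  (r_cont : forall x t, Theta t -> {for t, continuous (r x)}).

(** By continuity, [a < r (X w) (Y w)] holds exactly when, for some [N], every rational point of
    [Theta] within [1 / (N + 1)] of [Y w] gives a value of at least [a + 1 / (N + 1)]. At a fixed
    rational parameter only measurability in the data is involved. *)
Lemma measurable_caratheodory (X : O -> T) (Y : O -> 'cV[R]_n) :
  measurable_fun setT X -> mxmeasurable Y -> (forall w, Theta (Y w)) ->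
  measurable_fun setT (fun w => r (X w) (Y w)).
Proof.
move=> mX mY YTheta.
apply: (measurability _ (RGenOInfty.measurableE R)) => _ [_ [a ->] <-].
rewrite preimage_itvoy setTI.
pose S N (q : 'cV[rat]_n) : set O := [set w |
  (forall i, `|ratmx R q i ord0 - Y w i ord0| < N.+1%:R^-1) ->
  Theta (ratmx R q) -> a + N.+1%:R^-1 <= r (X w) (ratmx R q)].
have mS N q : measurable (S N q).
  have [Tq|nTq] := pselect (Theta (ratmx R q)); last first.
    rewrite (_ : S N q = setT) //; apply/seteqP; split => // w _ _ Tq.
    by case: (nTq Tq).
  rewrite (_ : S N q = ~` (\bigcap_(i in [set: 'I_n])
      [set w | `|ratmx R q i ord0 - Y w i ord0| < N.+1%:R^-1]) `|`
      [set w | a + N.+1%:R^-1 <= r (X w) (ratmx R q)]).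
    apply: measurableU; last first.
      apply: measurable_ge_event; exact: (measurableT_comp (r_meas Tq) mX).
    apply/measurableC/fin_bigcap_measurable => // i _.
    have mi : measurable_fun setT (fun w => `|ratmx R q i ord0 - Y w i ord0|).
      apply: measurableT_comp => //; apply: measurable_funB => //; exact: mY.
    rewrite -preimage_itvNyo -[X in measurable X]setTI.
    by apply: mi => //; exact: measurable_itv.
  apply/seteqP; split => w.
    move=> Sw; have [|] := pselect (forall i,
        `|ratmx R q i ord0 - Y w i ord0| < N.+1%:R^-1).
      by move=> h; right; exact: Sw.
    by move=> h; left => h'; apply: h => i; exact: (h' i Logic.I).
  by case=> [h h' _|h _ _] //; exfalso; apply: h => i _; exact: h'.
rewrite (_ : [set w | _] = \bigcup_N \bigcap_q S N q).
  apply: bigcupT_measurable => N; exact: measurable_bigcap_countType.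
apply/seteqP; split => w.
  move=> /= aw.
  have /cvgrPdist_lt/(_ ((r (X w) (Y w) - a) / 2)) := r_cont (x := X w) (YTheta w).
  rewrite divr_gt0 ?subr_gt0// => /(_ isT) /nbhs_ballP[e /= e0 He].
  (* Half of the excess over [a] pays for the move to a rational point; the other half leaves room
     for [1 / (N + 1)]. *)
  pose de := Num.min e ((r (X w) (Y w) - a) / 2).
  have de0 : 0 < de by rewrite lt_min e0/= divr_gt0// subr_gt0.
  have [N _ /(_ N (leqnn _)) /= HN] := near_infty_natSinv_lt (PosNum de0).
  move: HN; rewrite lt_min => /andP[Ne Na].
  exists N => // q _ qY _.
  have : ball (Y w) e (ratmx R q).
    rewrite -ball_normE/=; apply: mx_norm_lt => // i j.
    have -> : `|(Y w - ratmx R q) i j| = `|ratmx R q i ord0 - Y w i ord0|.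
      by rewrite (ord1 j) distrC !mxE.
    exact: lt_trans (qY i) Ne.
  move=> /He; rewrite /= ltr_norml => /andP[_ H].
  by move: (N.+1%:R^-1) Na H => v /= Na H; lra.
move=> [N _ Sw] /=.
have N0 : (0 : R) < N.+1%:R^-1 by rewrite invr_gt0.
suff : a + N.+1%:R^-1 <= r (X w) (Y w) by apply: lt_le_trans; rewrite ltrDl.
apply/ler_addgt0Pl => e e0.
have /cvgrPdist_lt/(_ e e0)/nbhs_ballP[e1 /= e10 He1] := r_cont (x := X w) (YTheta w).
have /nbhs_ballP[e2 /= e20 He2] : nbhs (Y w) Theta by exact: open_nbhs_nbhs.
pose e3 := Num.min (N.+1%:R^-1) (Num.min e1 e2).
have e30 : 0 < e3 by rewrite !lt_min N0 e10 e20.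
have [q qe3] := ratmx_dense (Y w) e30.
move: (qe3); rewrite !lt_min => /and3P[qN qe1 qe2].
have : a + N.+1%:R^-1 <= r (X w) (ratmx R q).
  apply: (Sw q Logic.I) => [i|].
    apply: le_lt_trans qN; apply: le_trans (mx_entry_norm_le _ i ord0).
    by rewrite !mxE.
  by apply: He2; rewrite -ball_normE/= distrC.
have := He1 (ratmx R q); rewrite -ball_normE/= distrC => /(_ qe1).
rewrite ltr_norml => /andP[H1 H2] H3.
by move: (N.+1%:R^-1) H1 H2 H3 => v /= H1 H2 H3; lra.
Qed.

End caratheodory.

(** * First order expansions with a radius common to many data points *)

Section differentiable_expansion.
Context (R : realType) (n : nat).

Lemma colvec_sum_delta (h : 'cV[R]_n) : h = \sum_i h i ord0 *: delta_mx i ord0.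
Proof.
rewrite [LHS]matrix_sum_delta; apply: eq_bigr => i _.
by rewrite big_ord1.
Qed.

(** A radius of the form [1 / (N + 1)] lets the points be classified by an integer. *)
Lemma differentiable_expansion (f : 'cV[R]_n -> R) (a : 'cV[R]_n) (e : R) :
  differentiable f a -> 0 < e -> exists2 N : nat, True &
    forall h, `|h| < N.+1%:R^-1 ->
    `|f (h + a) - f a - \sum_i h i ord0 * grad f a i ord0| <= e * `|h|.
Proof.
move=> df e0.
have := diff_locally df; move/eqaddoP => /(_ e e0)/nbhs_ballP[d /= d0 Hd].
have [N _ /(_ N (leqnn _)) /= HN] := near_infty_natSinv_lt (PosNum d0).
exists N => // h hN.
have : ball (0 : 'cV[R]_n) d h.
  by rewrite -ball_normE/= sub0r normrN; exact: lt_trans HN.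
move=> /Hd /=; rewrite !fctE/= /cst/= opprD addrA.
congr (`|_ - _| <= _).
rewrite [in LHS](colvec_sum_delta h) linear_sum; apply: eq_bigr => i _.
by rewrite linearZ/= mxE deriveE.
Qed.

End differentiable_expansion.

Lemma continuous_at_sum (R : realType) (T : topologicalType) (I : Type)
    (l : seq I) (f : I -> T -> R) (x : T) :
  (forall i, {for x, continuous (f i)}) ->
  {for x, continuous (fun y => \sum_(i <- l) f i y)}.
Proof.
move=> cf; elim: l => [|i l IH].
  rewrite (_ : (fun y => _) = cst 0); first exact: cvg_cst.
  by apply/funext => y; rewrite big_nil.
rewrite (_ : (fun y => _) = f i + (fun y => \sum_(i <- l) f i y)).
  exact: continuousD.
by apply/funext => y; rewrite big_cons.
Qed.

Section good_set.
Context (R : realType) (dT : measure_display) (T : measurableType dT) (n : nat)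
  (Theta : set 'cV[R]_n) (r : T -> 'cV[R]_n -> R) (ts : 'cV[R]_n).
Hypotheses (Theta_open : open Theta) (Theta_ts : Theta ts)
  (r_meas : forall t, Theta t -> measurable_fun setT (fun x => r x t))
  (r_diff : forall x t, Theta t -> differentiable (r x) t).

Let g (x : T) := grad (r x) ts.

Lemma measurable_grad (i : 'I_n) : measurable_fun setT (fun x => g x i ord0).
Proof.
pose v : 'cV[R]_n := delta_mx i ord0.
have nv : `|v| <= 1.
  apply: mx_norm_le => // a b; rewrite mxE.
  by case: andP => _; rewrite ?normr1 ?normr0.
have [N0 _ HN0] : \forall N \near \oo, Theta (N.+1%:R^-1 *: v + ts).
  have : (fun N : nat => N.+1%:R^-1 *: v + ts) @ \oo --> (0 : R) *: v + ts.
    by apply: cvgD; [apply: cvgZl; exact: cvg_harmonic|exact: cvg_cst].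
  rewrite scale0r add0r; apply; exact: open_nbhs_nbhs.
(* Increments of the difference quotients that converge to the gradient; the shift by [N0] keeps
   them inside [Theta], where [r] is measurable. *)
pose u N : R := (N + N0).+1%:R^-1.
pose D N x := (u N)^-1 * (r x (u N *: v + ts) - r x ts).
apply: (@measurable_fun_cvg _ _ _ setT D) => [N|x _].
  apply: measurable_funM => //; apply: measurable_funB; last exact: r_meas.
  by apply: r_meas; apply: HN0; rewrite /= leq_addl.
apply/cvgrPdist_le => e e0.
have [K _ HK] := differentiable_expansion (r_diff x Theta_ts) e0.
exists K.+1 => // N /= KN.
have u0 : 0 < u N by rewrite invr_gt0.
have nuv : `|u N *: v| <= u N.
  by rewrite normrZ gtr0_norm// ler_piMr// ltW.
have uK : u N < K.+1%:R^-1.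
  by rewrite /u ltf_pV2 ?posrE// ltr_nat ltnS (leq_trans KN)// leq_addr.
have := HK _ (le_lt_trans nuv uK).
rewrite (bigD1 i)//= big1 ?addr0; last first.
  by move=> j ji; rewrite !mxE (negbTE ji) mulr0 mul0r.
rewrite [X in X * _](_ : _ = u N); last by rewrite !mxE !eqxx mulr1.
move=> H; rewrite distrC /D.
have -> : (u N)^-1 * (r x (u N *: v + ts) - r x ts) - g x i ord0 =
    (u N)^-1 * (r x (u N *: v + ts) - r x ts - u N * grad (r x) ts i ord0).
  by rewrite /g; field; rewrite gt_eqF.
rewrite normrM gtr0_norm ?invr_gt0// ler_pdivrMl// (le_trans H)//.
by rewrite mulrC ler_wpM2r// ltW.
Qed.

Definition remainder (x : T) (h : 'cV[R]_n) : R :=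
  r x (h + ts) - r x ts - \sum_i h i ord0 * g x i ord0.

(* The neighbourhood on which the expansion holds does not depend on [x]; the
   set is measurable because rational [h] suffice. *)
Definition good (e : R) (N : nat) : set T := [set x |
  (forall i, `|g x i ord0| <= N%:R) /\
  forall h, `|h| < N.+1%:R^-1 -> Theta (h + ts) -> `|remainder x h| <= e * `|h|].

Lemma good_nondecreasing (e : R) (N K : nat) :
  (N <= K)%N -> good e N `<=` good e K.
Proof.
move=> NK x [g1 g2]; split=> [i|h hK].
  by apply: le_trans (g1 i) _; rewrite ler_nat.
apply: g2; apply: lt_le_trans hK _.
by rewrite lef_pV2 ?posrE// ler_nat.
Qed.

Lemma good_cover (e : R) (x : T) : 0 < e -> exists N, good e N x.
Proof.
move=> e0.
have [K _ HK] := differentiable_expansion (r_diff x Theta_ts) e0.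
pose L := Num.bound `|g x|.
exists (maxn K L); split=> [i|h hK _].
  apply: le_trans (mx_entry_norm_le _ i ord0) _.
  apply: (@le_trans _ _ L%:R); first exact: ltW (archi_boundP (normr_ge0 _)).
  by rewrite ler_nat leq_maxr.
apply: HK; apply: lt_le_trans hK _.
by rewrite lef_pV2 ?posrE// ler_nat ltnS leq_maxl.
Qed.

Lemma remainder_continuous (x : T) (h : 'cV[R]_n) : Theta (h + ts) ->
  {for h, continuous (remainder x)}.
Proof.
move=> Th.
have c1 : {for h, continuous (r x \o (fun h => h + ts))}.
  apply: continuous_comp; last exact: differentiable_continuous (r_diff x Th).
  exact: (cvgD (@cvg_id _ _) (cvg_cst ts)).
have c2 : {for h, continuous (fun h : 'cV[R]_n => \sum_i h i ord0 * g x i ord0)}.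
  apply: continuous_at_sum => i.
  exact: (cvgM (@coord_continuous R n 1 i ord0 h) (cvg_cst (g x i ord0))).
exact: (cvgB (cvgB c1 (cvg_cst (r x ts))) c2).
Qed.

Lemma measurable_good (e : R) (N : nat) : measurable (good e N).
Proof.
pose G1 := \bigcap_(i in [set: 'I_n]) [set x | `|g x i ord0| <= N%:R].
pose F (q : 'cV[rat]_n) : set T := [set x |
  `|ratmx R q| < N.+1%:R^-1 -> Theta (ratmx R q + ts) ->
  `|remainder x (ratmx R q)| <= e * `|ratmx R q|].
have le_meas (Z : T -> R) (b : R) : measurable_fun setT Z ->
    measurable [set x | `|Z x| <= b].
  move=> mZ; have mi : measurable_fun setT (fun w => `|Z w|) by exact: measurableT_comp.
  rewrite -preimage_itvNyc -[X in measurable X]setTI.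
  by apply: mi => //; exact: measurable_itv.
rewrite (_ : good e N = G1 `&` \bigcap_q F q); last first.
  apply/seteqP; split=> [x [g1 g2]|x [g1 Fx]].
    by split=> [i _|q _]; [exact: g1|exact: g2].
  split=> [i|h hN Th]; first exact: g1.
  have cL : {for h, continuous (fun h => `|remainder x h| - e * `|h|)}.
    exact: (cvgB (cvg_norm (remainder_continuous (x := x) Th))
      (cvgM (cvg_cst e) (@norm_continuous _ _ h))).
  rewrite -subr_le0; apply/ler_addgt0Pl => d d0; rewrite addr0.
  have /cvgrPdist_lt/(_ d d0)/nbhs_ballP[e1 /= e10 He1] := cL.
  have /nbhs_ballP[e2 /= e20 He2] : nbhs h [set h | Theta (h + ts)].
    have : (fun h : 'cV[R]_n => h + ts) @ h --> h + ts.
      exact: (cvgD (@cvg_id _ _) (cvg_cst ts)).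
    by apply; exact: open_nbhs_nbhs.
  (* The first term keeps the rational point within the radius that defines [good]; the others keep
     it where [cL] applies and inside [Theta]. *)
  pose e3 := Num.min (N.+1%:R^-1 - `|h|) (Num.min e1 e2).
  have e30 : 0 < e3 by rewrite !lt_min subr_gt0 hN e10 e20.
  have [q] := ratmx_dense h e30.
  rewrite !lt_min => /and3P[qN qe1 qe2].
  have q1 : `|ratmx R q| < N.+1%:R^-1.
    rewrite -[ratmx R q](subrK h) (le_lt_trans (ler_normD _ _))//.
    by rewrite -ltrBrDr.
  have q2 : Theta (ratmx R q + ts) by apply: He2; rewrite -ball_normE/= distrC.
  have := Fx q Logic.I q1 q2.
  have := He1 (ratmx R q); rewrite -ball_normE/= distrC => /(_ qe1).
  by rewrite ltr_norml => /andP[H1 H2] H3; lra.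
apply: measurableI.
  by apply: fin_bigcap_measurable => // i _; apply: le_meas; exact: measurable_grad.
apply: measurable_bigcap_countType => q.
have [Tq|nTq] := pselect (`|ratmx R q| < N.+1%:R^-1 /\ Theta (ratmx R q + ts)).
  rewrite (_ : F q = [set x | `|remainder x (ratmx R q)| <= e * `|ratmx R q|]).
    apply: le_meas; apply: measurable_funB.
      by apply: measurable_funB; apply: r_meas => //; exact: Tq.2.
    apply: measurable_sum => i; apply: measurable_funM => //.
    exact: measurable_grad.
  by apply/seteqP; split=> [x Fx|x H _ _] //; apply: Fx; [exact: Tq.1|exact: Tq.2].
rewrite (_ : F q = setT)//; apply/seteqP; split => // x _ t1 t2.
by case: nTq.
Qed.

End good_set.

(** Dominated convergence with bound [|g|]: at each point the indicator is eventually [1]. *)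
Lemma Rintegral_indic_cvg (R : realType) (d : measure_display)
    (T : measurableType d) (mu : {measure set T -> \bar R}) (F : nat -> set T)
    (g : T -> R) :
  (forall N, measurable (F N)) ->
  (forall N K, (N <= K)%N -> F N `<=` F K) -> (forall x, exists N, F N x) ->
  mu.-integrable setT (EFin \o g) ->
  (fun N => Rintegral mu setT (fun x => \1_(F N) x * g x)) @ \oo -->
  Rintegral mu setT g.
Proof.
move=> mF ndF cF ig; rewrite /Rintegral.
have mg : measurable_fun setT g.
  by apply/measurable_EFinP; exact: measurable_int ig.
have le1 N x : `|\1_(F N) x * g x| <= `|g x|.
  rewrite normrM ler_piMl// indicE.
  by case: (_ \in _); rewrite ?normr1 ?normr0.
have m1 N : measurable_fun setT (fun x => (\1_(F N) x * g x)%:E).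
  by apply/measurable_EFinP; apply: measurable_funM.
apply: fine_cvg; rewrite fineK; last exact: integrable_fin_num ig.
apply: (@dominated_cvg _ _ _ mu setT measurableT
  (fun N x => (\1_(F N) x * g x)%:E) (EFin \o g) (fun x => `|g x|%:E)) => //.
- move=> x _; have [N0 FN0] := cF x.
  apply: cvg_near_cst; exists N0 => // N /= N0N.
  by rewrite indicE mem_set ?mul1r//; exact: ndF FN0.
- exact: integrable_norm.
- by move=> N x _ /=; rewrite lee_fin; exact: le1.
Qed.

(** * The divergence function *)

Lemma derivable_expansion (R : realType) (f : R -> R) (a e : R) :
  derivable f a 1 -> 0 < e -> exists2 d : R, 0 < d &
    forall h, `|h| < d -> `|f (h + a) - f a - h * (f^`())%classic a| <= e * `|h|.
Proof.
move=> df e0; have dfd := (derivable1_diffP _ _).1 df.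
have := diff_locally dfd; move/eqaddoP => /(_ e e0)/nbhs_ballP[d /= d0 Hd].
exists d => // h hd.
have : ball (0 : R) d h by rewrite -ball_normE/= sub0r normrN.
move=> /Hd /=; rewrite !fctE/= /cst/= opprD addrA.
congr (`|_ - _| <= _).
by rewrite derive1E' // -[in LHS](mulr1 h) -[h * 1]/(h *: (1 : R)) linearZ.
Qed.

Section divergence_function.
Context (R : realType) (f : R -> R).
Hypotheses (f_convex : strictly_convex_pos f)
  (f_diff : forall x : R, 0 < x -> derivable f x 1)
  (f_diff2 : forall x : R, 0 < x -> derivable (f^`())%classic x 1)
  (f1 : f 1 = 0) (f'1 : (f^`())%classic 1 = 0).

(** [f] lies below its chord from [1] to [x]. If [f x < 0], that chord leaves the value [0] with a
    nonzero slope, against [f'(1) = 0]. *)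
Lemma divergence_ge0 (x : R) : 0 < x -> 0 <= f x.
Proof.
move=> x0; rewrite leNgt; apply/negP => fx.
have x1 : x != 1 by apply: contraTneq fx => ->; rewrite f1 ltxx.
have y0 : 0 < `|x - 1| by rewrite normr_gt0 subr_eq0.
(* The tolerance is half the absolute slope of the chord. *)
have e0 : 0 < - f x / (2 * `|x - 1|) by rewrite divr_gt0 ?oppr_gt0 ?mulr_gt0.
have [d d0 Hd] := derivable_expansion (f_diff ltr01) e0.
pose t := Num.min (1 / 2) (d / (2 * `|x - 1|)).
have t0 : 0 < t by rewrite lt_min !divr_gt0 ?mulr_gt0.
have t1 : t < 1 by rewrite gt_min; apply/orP; left; lra.
have td : `|t * (x - 1)| < d.
  rewrite normrM gtr0_norm// -ltr_pdivlMr// gt_min; apply/orP; right.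
  by rewrite ltr_pM2l// ltf_pV2 ?posrE ?mulr_gt0//; lra.
have := f_convex x0 ltr01 x1 t0 t1; rewrite f1 mulr0 addr0.
rewrite (_ : t * x + (1 - t) * 1 = t * (x - 1) + 1); last by ring.
have := Hd _ td; rewrite f1 f'1 mulr0 !subr0 normrM (gtr0_norm t0).
rewrite ler_norml => /andP[H1 _] H2.
have H3 : - f x / (2 * `|x - 1|) * (t * `|x - 1|) = - (t * f x) / 2.
  by field; rewrite gt_eqF.
move: H1; rewrite H3 => H1.
have : t * f x < 0 by rewrite pmulr_rlt0.
lra.
Qed.

(** [f''] need not be continuous at [1], so no Taylor remainder at an intermediate point is
    available. The expansion of [f'] at [1] gives the sign of the derivative of [f z - K (z - 1)^2]
    on each side of [1], and the mean value theorem concludes. *)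
Lemma divergence_quadratic_minorant (t : R) : 0 < t -> exists2 d : R, 0 < d &
  forall z, `|z - 1| < d ->
    ((f^`(2))%classic 1 / 2 - t) * (z - 1) ^+ 2 <= f z.
Proof.
move=> t0; set F := (f^`(2))%classic 1; pose K := F / 2 - t.
(* The tolerance is [2 * t] because the parabola has derivative [(F - 2 t) (z - 1)]. *)
have [d d0 Hd] := derivable_expansion (f_diff2 ltr01) (mulr_gt0 (@ltr0n R 2) t0).
exists (Num.min d (1 / 2)); first by rewrite lt_min d0; lra.
move=> z; rewrite lt_min => /andP[zd z1].
have near_pos y : `|y - 1| <= `|z - 1| -> 0 < y.
  move=> yz; have := le_lt_trans yz z1; rewrite ltr_norml => /andP[]; lra.
have f'E y : `|y - 1| <= `|z - 1| ->
    `|(f^`())%classic y - (y - 1) * F| <= 2 * t * `|y - 1|.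
  move=> yz; have := Hd (y - 1) (le_lt_trans yz zd).
  by rewrite subrK f'1 subr0.
pose G (y : R) : R := f y - K * (y - 1) ^+ 2.
pose G' (y : R) : R := (f^`())%classic y - K * (2 * (y - 1)).
have dG (y : R) : 0 < y -> is_derive y (1 : R) G (G' y).
  move=> y0; have d1 : is_derive y (1 : R) f ((f^`())%classic y).
    by rewrite derive1E; apply: derivableP; exact: f_diff.
  have d2 : is_derive y (1 : R) (id - cst (1 : R)) (1 - 0) by apply: is_deriveB.
  have d3 := is_deriveB d1 (is_deriveZ K (is_deriveM d2 d2)).
  apply: (is_derive_eq d3); rewrite /G' /GRing.scale/= !fctE/= /cst; ring.
have [->|zneq1] := eqVneq z 1; first by rewrite subrr expr0n/= mulr0 f1.
suff : 0 <= G z by rewrite /G subr_ge0.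
have G1 : G 1 = 0 by rewrite /G subrr f1 expr0n/= mulr0 subrr.
have cG a b : 0 < a -> {within `[a, b], continuous G}.
  move=> a0; apply: derivable_within_continuous => y.
  rewrite in_itv/= => /andP[ay _].
  by have [] := dG y (lt_le_trans a0 ay).
have [zlt|zgt] : z < 1 \/ 1 < z by move: zneq1; rewrite neq_lt => /orP.
- have z0 : 0 < z by exact: near_pos.
  have [y|y /[!in_itv]/= /andP[zy y1] HG] := MVT zlt _ (cG z 1 z0) (df := G').
    by rewrite in_itv/= => /andP[zy y1]; apply: dG; exact: lt_trans zy.
  have yz : `|y - 1| <= `|z - 1|.
    by rewrite !ltr0_norm ?subr_lt0//; lra.
  have := f'E y yz; rewrite [`|y - 1|]ltr0_norm ?subr_lt0// ler_norml => /andP[H1 H2].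
  have : G' y * (1 - z) <= 0.
    rewrite mulr_le0_ge0 ?subr_ge0 ?(ltW zlt)// /G' /K; nra.
  by rewrite -HG G1; lra.
- have [y|y /[!in_itv]/= /andP[zy y1] HG] := MVT zgt _ (cG 1 z ltr01) (df := G').
    by rewrite in_itv/= => /andP[zy y1]; apply: dG; exact: lt_trans zy.
  have yz : `|y - 1| <= `|z - 1|.
    by rewrite !gtr0_norm ?subr_gt0//; lra.
  have := f'E y yz; rewrite [`|y - 1|]gtr0_norm ?subr_gt0// ler_norml => /andP[H1 H2].
  have : 0 <= G' y * (z - 1).
    rewrite mulr_ge0 ?subr_ge0 ?(ltW zgt)// /G' /K; nra.
  by rewrite -HG G1; lra.
Qed.

Lemma measurable_divergence (d : measure_display) (O : measurableType d)
    (Z : O -> R) : measurable_fun setT Z -> (forall w, 0 < Z w) ->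
  measurable_fun setT (f \o Z).
Proof.
move=> mZ Z0.
have cf : {within `]0, +oo[, continuous f}.
  apply: derivable_within_continuous => y; rewrite in_itv/= andbT.
  exact: f_diff.
have mf : measurable_fun (`]0, +oo[%classic : set R) f.
  exact: subspace_continuous_measurable_fun.
apply: (measurable_comp _ _ mf mZ) => //.
by move=> _ [w _ <-]; rewrite /= in_itv/= Z0.
Qed.

End divergence_function.

(** The event has positive probability, so it is nonempty and [c] dominates a sum of squares; for
    [k = 0] it would be the whole space, of probability one. *)
Lemma chi2_point_nontrivial (R : realType) (k : nat) (q c : R) :
  0 < q -> q < 1 -> chi2_point k q c -> (0 < k)%N /\ 0 <= c.
Proof.
move=> q0 q1 [dO [OO [P [G [ _ Pc]]]]].
have [w Sw] : [set w | \sum_(i < k) G i w ^+ 2 <= c] !=set0.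
  apply/set0P; apply: contraTneq q0 => S0; move: Pc; rewrite S0 measure0.
  by move=> /(congr1 fine) /= <-; rewrite ltxx.
have c0 : 0 <= c by apply: le_trans Sw; apply: sumr_ge0 => i _; exact: sqr_ge0.
split => //; case: k G Pc {Sw} => // G.
rewrite (_ : [set w | _] = setT).
  by rewrite probability_setT => -[q1']; move: q1; rewrite -q1' ltxx.
by apply/seteqP; split => // v _ /=; rewrite big_ord0.
Qed.

(** * Quadratic forms *)

Section quadratic_forms.
Context (R : realType).

(** The matrix norm is the largest absolute entry, hence the factor [n]. *)
Lemma mulmx_norm_le (m n p : nat) (A : 'M[R]_(m, n)) (B : 'M[R]_(n, p)) :
  `|A *m B| <= n%:R * `|A| * `|B|.
Proof.
apply: mx_norm_le => [|i j]; first by rewrite !mulr_ge0.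
rewrite mxE (le_trans (ler_norm_sum _ _ _))//.
rewrite (@le_trans _ _ (\sum_(l < n) `|A| * `|B|))//.
  by apply: ler_sum => l _; rewrite normrM ler_pM// mx_entry_norm_le.
by rewrite sumr_const card_ord -mulrA [leRHS]mulr_natl.
Qed.

Lemma trmx_norm (m n : nat) (A : 'M[R]_(m, n)) : `|A^T| = `|A|.
Proof.
apply/eqP; rewrite eq_le; apply/andP; split;
  apply: mx_norm_le => // i j; have := mx_entry_norm_le A;
  [by rewrite mxE|have := mx_entry_norm_le A^T j i; rewrite mxE].
by [].
Qed.

Lemma bilinear_norm_le (n : nat) (N : 'M[R]_n) (y z : 'cV[R]_n) :
  `|(y^T *m N *m z) ord0 ord0| <= n%:R ^+ 2 * `|N| * `|y| * `|z|.
Proof.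
apply: le_trans (mx_entry_norm_le _ _ _) _.
apply: le_trans (mulmx_norm_le _ _) _.
rewrite [leRHS](_ : _ = n%:R * (n%:R * `|y| * `|N|) * `|z|); last by ring.
rewrite ler_wpM2r// ler_wpM2l// -(trmx_norm y).
exact: mulmx_norm_le.
Qed.

Lemma qform_matrix_diff (n : nat) (N N' : 'M[R]_n) (z : 'cV[R]_n) :
  `|qform N z - qform N' z| <= n%:R ^+ 2 * `|N - N'| * `|z| ^+ 2.
Proof.
have -> : qform N z - qform N' z = (z^T *m (N - N') *m z) ord0 ord0.
  by rewrite /qform mulmxBr mulmxBl [RHS]mxE [X in _ = _ + X]mxE.
by rewrite expr2 mulrA bilinear_norm_le.
Qed.

Lemma qform_vector_diff (n : nat) (N : 'M[R]_n) (y z : 'cV[R]_n) :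
  `|qform N y - qform N z| <= n%:R ^+ 2 * `|N| * (`|y| + `|z|) * `|y - z|.
Proof.
have -> : qform N y - qform N z =
    ((y - z)^T *m N *m y) ord0 ord0 + (z^T *m N *m (y - z)) ord0 ord0.
  rewrite /qform (_ : (y - z)^T = y^T - z^T); last by rewrite linearB.
  by rewrite !mulmxBl !mulmxBr !mxE; ring.
apply: le_trans (ler_normD _ _) _.
rewrite [leRHS](_ : _ = n%:R ^+ 2 * `|N| * `|y - z| * `|y| +
  n%:R ^+ 2 * `|N| * `|z| * `|y - z|); last by ring.
by apply: lerD; exact: bilinear_norm_le.
Qed.

Lemma qform_continuous (n : nat) (N : 'M[R]_n) : continuous (qform N).
Proof.
move=> z; apply/(@cvgrPdist_le _ _ _ (nbhs z)) => e e0.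
pose K := n%:R ^+ 2 * `|N| * (`|z| + (`|z| + 1)) + 1.
have K0 : 0 < K by rewrite ltr_wpDl// !mulr_ge0.
have eK : 0 < Num.min 1 (e / K) by rewrite lt_min ltr01 divr_gt0.
apply/nbhs_ballP; exists (Num.min 1 (e / K)) => //= y.
rewrite -ball_normE/= lt_min => /andP[y1 yK].
have yz : `|y| <= `|z| + 1.
  rewrite -[y](subrK z) addrC (le_trans (ler_normD _ _))// lerD2l.
  by rewrite distrC ltW.
apply: le_trans (qform_vector_diff N z y) _.
rewrite -(@divfK _ K _ e) ?gt_eqF// [leRHS]mulrC; apply: ler_pM => //; last exact: ltW.
rewrite (@le_trans _ _ (n%:R ^+ 2 * `|N| * (`|z| + (`|z| + 1))))//.
  by rewrite ler_wpM2l ?mulr_ge0// lerD2l.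
by rewrite lerDl.
Qed.

(* Stated for a solution [y] of [W y = x], so that neither the invertibility of
   [W] nor the continuity of matrix inversion is needed. *)
Lemma near_solution (n : nat) (U : 'M[R]_n) (K e : R) : U \in unitmx ->
  0 <= K -> 0 < e -> exists2 d : R, 0 < d & forall (W : 'M[R]_n) (y : 'cV[R]_n),
    `|W - U| <= d -> `|W *m y| <= K -> `|y - invmx U *m (W *m y)| <= e.
Proof.
move=> Uu K0 e0; pose V := invmx U.
pose c := n%:R ^+ 2 * `|V| + 1; pose b := n%:R * `|V| * K + 1.
have c0 : 0 < c by rewrite ltr_wpDl// !mulr_ge0.
have b0 : 0 < b by rewrite ltr_wpDl// !mulr_ge0.
(* The first term makes the error at most half of [|y|], which gives [|y| <= 2 * b] by absorption;
   the second then brings the error below [e]. *)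
pose d := Num.min (1 / (2 * c)) (e / (c * (2 * b))).
have d0 : 0 < d by rewrite lt_min !divr_gt0 ?mulr_gt0.
exists d => // W y WU WK.
have yE : y - V *m (W *m y) = V *m ((U - W) *m y).
  by rewrite mulmxBl mulmxBr [V *m (U *m y)]mulmxA mulVmx// mul1mx.
have D : `|y - V *m (W *m y)| <= c * d * `|y|.
  rewrite yE; apply: le_trans (mulmx_norm_le _ _) _.
  apply: (@le_trans _ _ (n%:R * `|V| * (n%:R * d * `|y|))).
    rewrite ler_wpM2l ?mulr_ge0//; apply: le_trans (mulmx_norm_le _ _) _.
    by rewrite ler_wpM2r// ler_wpM2l// distrC.
  rewrite [leLHS](_ : _ = (n%:R ^+ 2 * `|V|) * (d * `|y|)); last by ring.
  rewrite -[leRHS]mulrA; apply: ler_wpM2r; first by rewrite mulr_ge0// ltW.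
  by rewrite lerDl.
have cd : c * d <= 1 / 2.
  apply: (@le_trans _ _ (c * (1 / (2 * c)))).
    by rewrite ler_wpM2l ?(ltW c0)// ge_min lexx.
  rewrite (_ : c * _ = 1 / 2)//; field.
  by rewrite gt_eqF.
have y2 : `|y| <= 2 * b.
  have : `|y| <= `|V *m (W *m y)| + `|y - V *m (W *m y)|.
    by rewrite -[in leLHS](subrK (V *m (W *m y)) y) addrC ler_normD.
  have : `|V *m (W *m y)| <= b.
    apply: le_trans (mulmx_norm_le _ _) _.
    apply: (@le_trans _ _ (n%:R * `|V| * K)); last by rewrite lerDl.
    by rewrite ler_wpM2l ?mulr_ge0.
  have : c * d * `|y| <= 1 / 2 * `|y| by rewrite ler_wpM2r.
  move: D; lra.
apply: (le_trans D).
apply: (@le_trans _ _ (c * (e / (c * (2 * b))) * (2 * b))).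
  rewrite ler_pM// ?mulr_ge0 ?(ltW c0) ?(ltW d0)//.
  by rewrite ler_wpM2l ?(ltW c0)// ge_min lexx orbT.
rewrite [leLHS](_ : _ = e)//; field.
by rewrite !gt_eqF.
Qed.

(** At a zero [z] of the form, its value at [y + g z] is affine in [g], so non-negativity forces the
    slope to vanish. For [y = N z] the slope is twice the squared Euclidean norm of [N z]. *)
Lemma psd_unitmx_qform_eq0 (n : nat) (N : 'M[R]_n) (z : 'cV[R]_n) :
  N^T = N -> N \in unitmx -> (forall y, 0 <= qform N y) ->
  qform N z = 0 -> z = 0.
Proof.
move=> sN uN pN z0.
suff Nz : N *m z = 0 by rewrite -[z](mulKmx uN) Nz mulmx0.
pose y := N *m z; pose s := (y^T *m y) ord0 ord0.
have yN : (y^T *m N *m z) ord0 ord0 = s by rewrite -mulmxA.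
have zN : (z^T *m N *m y) ord0 ord0 = s.
  by rewrite -[in LHS]sN -trmx_mul.
have s0 : 0 <= s.
  by rewrite /s mxE sumr_ge0// => i _; rewrite mxE -expr2 sqr_ge0.
have s00 : s = 0.
  apply/eqP; rewrite eq_le s0 andbT leNgt; apply/negP => sgt0.
  (* This multiple of [z] would bring the form down to [-1]. *)
  have := pN (y + (- (qform N y + 1) / (2 * s)) *: z).
  rewrite qformD z0 mul0r add0r yN zN.
  rewrite (_ : (s + s) * _ = - (qform N y + 1)); last by field; rewrite gt_eqF.
  lra.
apply/matrixP => i j; rewrite (ord1 j) [RHS]mxE.
have sE : s = \sum_a y a ord0 ^+ 2.
  by rewrite /s [LHS]mxE; apply: eq_bigr => a _; rewrite [y^T _ _]mxE expr2.
have : \sum_a y a ord0 ^+ 2 = 0 by rewrite -sE.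
move/eqP; rewrite psumr_eq0 => [/allP/(_ i)|a _]; last exact: sqr_ge0.
by rewrite mem_index_enum => /(_ isT)/=; rewrite sqrf_eq0 => /eqP.
Qed.

Lemma block_mx_first0 (k : nat) (C : 'M[R]_(1 + k)) :
  (forall j, C ord0 j = 0) -> (forall j, C j ord0 = 0) ->
  C = block_mx 0 0 0 (drsubmx C).
Proof.
move=> C0 Cj0; rewrite -[LHS]submxK; congr block_mx; apply/matrixP => i j.
- by rewrite !mxE (ord1 i) lshift0 C0.
- by rewrite !mxE (ord1 i) lshift0 C0.
- by rewrite !mxE (ord1 j) lshift0 Cj0.
Qed.

(** * Centering a second moment matrix *)

Section centering.
Context (k : nat) (M : 'M[R]_(1 + k)).
Let m0 := row ord0 M.
Let C := M - m0^T *m m0.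
Hypotheses (Msym : M^T = M) (M00 : M ord0 ord0 = 1).

(** If [M] is the second moment matrix of a vector with first coordinate [1], then [m0] is its mean
    and [C] its covariance: variance is second moment minus squared mean. *)
Lemma qform_center (z : 'cV[R]_(1 + k)) :
  qform C z = qform M z - (m0 *m z) ord0 ord0 ^+ 2.
Proof.
rewrite /qform /C mulmxBr mulmxBl [LHS]mxE [X in _ + X]mxE; congr (_ - _).
have -> : z^T *m (m0^T *m m0) *m z = (m0 *m z)^T *m (m0 *m z).
  by rewrite trmx_mul !mulmxA.
by rewrite mxE big_ord1 mxE expr2.
Qed.

Lemma center_block : C = block_mx 0 0 0 (drsubmx C).
Proof.
have C0 j : C ord0 j = 0.
  by rewrite /C !mxE big_ord1 !mxE M00 mul1r subrr.
have Cj0 j : C j ord0 = 0.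
  rewrite /C !mxE big_ord1 !mxE M00 mulr1.
  by rewrite -[in X in _ - X]Msym mxE subrr.
exact: block_mx_first0.
Qed.

Lemma qform_center_dsubmx (z : 'cV[R]_(1 + k)) :
  qform (drsubmx C) (dsubmx z) = qform C z.
Proof.
rewrite /qform -[in RHS](vsubmxK z) tr_col_mx center_block.
rewrite mul_row_block !mulmx0 !addr0 add0r mul_row_col mul0mx add0r.
by rewrite block_mxKdr.
Qed.

Lemma qform_dsubmx_le (z : 'cV[R]_(1 + k)) :
  qform (drsubmx C) (dsubmx z) <= qform M z.
Proof. by rewrite qform_center_dsubmx qform_center lerBlDr lerDl sqr_ge0. Qed.

(** If [C] were zero, the form of [M] would be the square of [m0 z] and would vanish at any [z]
    orthogonal to [m0]. Such a nonzero [z] is a basis vector of the last [k] coordinates, corrected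
    in the first one. *)
Lemma center_neq0 : (0 < k)%N -> M \in unitmx -> (forall y, 0 <= qform M y) ->
  C != 0.
Proof.
move=> k0 uM pM; apply/eqP => C0.
pose b : 'I_k := Ordinal k0.
pose z : 'cV[R]_(1 + k) := col_mx (const_mx (- M ord0 (rshift 1 b))) (delta_mx b ord0).
have mz : (m0 *m z) ord0 ord0 = 0.
  rewrite mxE big_split_ord/= big_ord1 (bigD1 b)//= big1; last first.
    by move=> j /negbTE jb; rewrite col_mxEd !mxE jb mulr0.
  by rewrite addr0 col_mxEu col_mxEd !mxE lshift0 M00 !eqxx mul1r mulr1 addNr.
have qz : qform M z = 0.
  have := qform_center z; rewrite C0 mz expr0n/= subr0 => <-.
  by rewrite /qform mulmx0 mul0mx mxE.
have := psd_unitmx_qform_eq0 Msym uM pM qz.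
move=> /(congr1 dsubmx); rewrite col_mxKd => /matrixP/(_ b ord0)/eqP.
by rewrite !mxE !eqxx oner_eq0.
Qed.

End centering.

End quadratic_forms.

(** * Moments of the score *)

Section moments.
Context (R : realType) (dT : measure_display) (T : measurableType dT)
  (mu : {sigma_finite_measure set T -> \bar R}) (p : T -> R)
  (n : nat) (g : T -> 'cV[R]_n).
Hypotheses (p_density : is_density mu p)
  (g_int : forall a b, mu.-integrable setT
    (fun x => (p x * (g x a ord0 * g x b ord0))%:E)).

Let S : 'M[R]_n := \matrix_(a, b) Edens mu p (fun x => g x a ord0 * g x b ord0).

(** The form is the integral of [p] times the square of the combination of the [g x a ord0] with
    coefficients [z]. *)
Lemma second_moment_psd (z : 'cV[R]_n) : 0 <= qform S z.
Proof.
have igz a b : mu.-integrable setT (EFin \o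
    (fun x => (z a ord0 * z b ord0) * (p x * (g x a ord0 * g x b ord0)))).
  rewrite (_ : EFin \o _ = (fun x => (z a ord0 * z b ord0)%:E *
    (p x * (g x a ord0 * g x b ord0))%:E)%E).
    exact: integrableZl.
  by apply/funext => x; rewrite /= EFinM.
rewrite (_ : qform S z = Rintegral mu setT
    (fun x => p x * (\sum_a z a ord0 * g x a ord0) ^+ 2)).
  have [_ p0 _] := p_density.
  by apply: Rintegral_ge0 => x _; rewrite mulr_ge0// sqr_ge0.
rewrite (_ : (fun x => _) = (fun x => \sum_b \sum_a
    (z a ord0 * z b ord0) * (p x * (g x a ord0 * g x b ord0)))); last first.
  apply/funext => x; rewrite expr2 mulr_sumr mulr_sumr; apply: eq_bigr => b _.
  by rewrite !mulr_suml !mulr_sumr; apply: eq_bigr => a _; ring.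
rewrite Rintegral_sum//; last first.
  move=> b; rewrite (_ : EFin \o _ = (fun x => \sum_a
      ((z a ord0 * z b ord0) * (p x * (g x a ord0 * g x b ord0)))%:E)%E).
    by apply: integrable_sum => // a _; exact: igz.
  by apply/funext => x; rewrite /= sumEFin.
rewrite /qform mxE; apply: eq_bigr => b _.
rewrite Rintegral_sum// mxE mulr_suml; apply: eq_bigr => a _.
rewrite RintegralZl//; last exact: g_int.
rewrite !mxE /Edens; ring.
Qed.

Lemma second_moment_sym : S^T = S.
Proof.
by apply/matrixP => a b; rewrite !mxE; congr Edens; apply/funext => x; rewrite mulrC.
Qed.

(** The coordinate equal to [1] places the first moments in row [i0] of [S], so integrability of the
    products also yields that of the coordinates. *)
Lemma covmx_second_moment (i0 : 'I_n) : (forall x, g x i0 ord0 = 1) ->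
  covmx mu p g = S - (row i0 S)^T *m row i0 S.
Proof.
move=> g1; apply/matrixP => a b.
have i1 c : mu.-integrable setT (EFin \o (fun x => p x * g x c ord0)).
  rewrite (_ : EFin \o _ = (fun x => (p x * (g x i0 ord0 * g x c ord0))%:E))//.
  by apply/funext => x; rewrite g1 mul1r.
have Sm c : S i0 c = Edens mu p (fun y => g y c ord0).
  by rewrite mxE; congr Edens; apply/funext => x; rewrite g1 mul1r.
have ip := is_density_integrable p_density.
have p1 : Rintegral mu setT p = 1.
  by have [_ _ h] := p_density; rewrite /Rintegral h.
have [ma mb] := (Sm a, Sm b).
rewrite [RHS]mxE [X in _ + X]mxE [X in _ - X]mxE big_ord1.
rewrite ![_^T _ _]mxE ![row _ _ _ _]mxE.
rewrite ma mb /covmx [LHS]mxE.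
set ua := Edens mu p (fun y => g y a ord0); set ub := Edens mu p (fun y => g y b ord0).
rewrite [S a b]mxE {1 2}/Edens.
have iZ (c : R) (f : T -> R) : mu.-integrable setT (EFin \o f) ->
    mu.-integrable setT (EFin \o (fun x => c * f x)).
  move=> fi; rewrite (_ : EFin \o _ = (fun x => c%:E * (f x)%:E)%E).
    exact: integrableZl.
  by apply/funext => x; rewrite /= EFinM.
rewrite (_ : (fun x => p x * ((g x a ord0 - ua) * (g x b ord0 - ub))) =
  (fun x => (p x * (g x a ord0 * g x b ord0) - (ub * (p x * g x a ord0)))
    - (ua * (p x * g x b ord0) - (ua * ub) * p x))); last first.
  by apply/funext => x; ring.
have iab : mu.-integrable setT (EFin \o (fun x => p x * (g x a ord0 * g x b ord0))).
  exact: g_int.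
rewrite RintegralB//; last 2 first.
- exact: (integrableB measurableT iab (iZ ub _ (i1 a))).
- exact: (integrableB measurableT (iZ ua _ (i1 b)) (iZ (ua * ub) _ ip)).
rewrite RintegralB//; last exact: iZ.
rewrite RintegralB//; [|exact: iZ|exact: iZ].
rewrite (RintegralZl _ _ (i1 a))// (RintegralZl _ _ (i1 b))//.
rewrite (RintegralZl _ _ ip)//.
rewrite p1 -/(Edens mu p (fun x => g x a ord0)) -/ua.
rewrite -/(Edens mu p (fun x => g x b ord0)) -/ub; ring.
Qed.

End moments.

(** * Score of the exponential model *)

Section density_ratio_gradient.
Context (R : realType) (T : Type) (k : nat) (phi : T -> 'cV[R]_k -> R)
  (ts : 'cV[R]_(1 + k)).
Let r := density_ratio phi.

(** [ln r] is the intercept plus a term free of it, so the difference quotient is constantly [1]. *)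
Lemma score_first (x : T) : score r x ts ord0 ord0 = 1.
Proof.
rewrite /score /grad mxE /derive; apply: cvg_lim => //.
apply: (@cvg_trans _ ((fun=> 1 : R) @ (0 : R)^')); last exact: cvg_cst.
apply: near_eq_cvg; apply: filterS (@nbhs_dnbhs_neq R 0) => h h0.
rewrite /= /r /density_ratio !expRK /beta_of.
have -> : dsubmx (h *: (delta_mx ord0 ord0 : 'cV[R]_(1 + k)) + ts) = dsubmx ts.
  by apply/matrixP => i j; rewrite !mxE/= mulr0 add0r.
have -> : usubmx (h *: (delta_mx ord0 ord0 : 'cV[R]_(1 + k)) + ts) ord0 ord0 =
    h + usubmx ts ord0 ord0.
  by rewrite !mxE lshift0 !eqxx mulr1.
rewrite (_ : h + _ + _ - _ = h); last by ring.
by rewrite /GRing.scale/= mulVf.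
Qed.

(** The intercept cancels, the difference quotients agree term by term, and hence so do their
    limits. *)
Lemma score_rshift (x : T) (b : 'I_k) :
  score r x ts (rshift 1 b) ord0 = grad (phi x) (beta_of ts) b ord0.
Proof.
rewrite /score /grad !mxE /derive.
apply: (congr1 (fun F : R -> R => lim (F @ (0 : R)^'))).
apply/funext => h /=; rewrite /r /density_ratio !expRK /beta_of.
have -> : dsubmx (h *: (delta_mx (rshift 1 b) ord0 : 'cV[R]_(1 + k)) + ts) =
    h *: delta_mx b ord0 + dsubmx ts.
  by apply/matrixP => i j; rewrite !mxE eq_rshift.
have -> : usubmx (h *: (delta_mx (rshift 1 b) ord0 : 'cV[R]_(1 + k)) + ts) ord0 ord0 =
    usubmx ts ord0 ord0.
  by rewrite !mxE eq_lrshift mulr0 add0r.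
by congr (_ *: _); rewrite opprD addrACA subrr add0r.
Qed.

Lemma score_eq_grad (x : T) : differentiable (r x) ts -> r x ts = 1 ->
  score r x ts = grad (r x) ts.
Proof.
move=> dr r1; apply/matrixP => i j; rewrite !mxE.
have lnd : is_derive (r x ts) (1 : R) (@ln R) (r x ts)^-1.
  by apply: is_derive1_ln; rewrite r1.
have dln : differentiable (@ln R) (r x ts).
  by apply/derivable1_diffP; case: lnd.
rewrite (deriveE _ dr) (_ : (fun u => ln (r x u)) = @ln R \o r x)//.
rewrite deriveE; last exact: differentiable_comp.
rewrite diff_comp//= deriv1E; last by case: lnd.
rewrite derive1E; have [_ ->] := lnd.
by rewrite r1 invr1 /GRing.scale/= mulr1.
Qed.

End density_ratio_gradient.

(** * Lower bound of the divergence statistic *)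

Section empirical_moment.
Context (R : realType) (T : Type) (n : nat) (g : T -> 'cV[R]_n) (B : set T).

(** Points outside [B] contribute zero but still count in the sample size, so the mean is the second
    moment truncated to [B]. *)
Definition emp_moment (l : nat) (xs : 'I_l -> T) : 'M[R]_n :=
  \matrix_(a, b) (l%:R^-1 *
    \sum_(j < l) \1_B (xs j) * (g (xs j) a ord0 * g (xs j) b ord0)).

Lemma qform_emp_moment (l : nat) (xs : 'I_l -> T) (u : 'cV[R]_n) :
  qform (emp_moment xs) u =
  l%:R^-1 * \sum_(j < l) \1_B (xs j) * (\sum_i u i ord0 * g (xs j) i ord0) ^+ 2.
Proof.
rewrite /qform mxE.
transitivity (\sum_b \sum_a \sum_(j < l) l%:R^-1 * (\1_B (xs j) *
    (u a ord0 * g (xs j) a ord0 * (u b ord0 * g (xs j) b ord0)))).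
  apply: eq_bigr => b _; rewrite mxE mulr_suml; apply: eq_bigr => a _.
  rewrite !mxE mulr_sumr mulr_sumr mulr_suml; apply: eq_bigr => j _; ring.
rewrite mulr_sumr (eq_bigr (fun b => \sum_(j < l) \sum_a l%:R^-1 * (\1_B (xs j) *
    (u a ord0 * g (xs j) a ord0 * (u b ord0 * g (xs j) b ord0))))); last first.
  by move=> b _; rewrite exchange_big.
rewrite exchange_big/=; apply: eq_bigr => j _.
rewrite expr2 mulr_sumr mulr_sumr mulr_sumr; apply: eq_bigr => b _.
by rewrite mulr_suml !mulr_sumr; apply: eq_bigr => a _; ring.
Qed.

End empirical_moment.

(** Continuity at [(rho, 1)] of the weights in [f_d] and [f_n], with the loss expressed as a factor
    [1 - t]. *)
Lemma weight_lower_bound (R : realType) (rho t : R) : 0 < rho -> 0 < t -> t < 1 ->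
  exists2 d : R, 0 < d & forall rh z : R, `|rh - rho| < d -> `|z - 1| < d ->
    [/\ 0 < rh, 0 < z, (1 - t) / (1 + rho) <= (1 + rh * z)^-1 &
        (1 - t) * rho / (1 + rho) <= rh / (1 + rh * z)].
Proof.
move=> rho0 t0 t1.
have r1 : 0 < 1 + rho by lra.
(* For [d <= 1] one has [rh z <= rho + d (rho + 2)]. [d1] absorbs this excess in the first weight;
   [d2] absorbs it in the second, together with the loss of [d] on the numerator [rh]. *)
pose d1 := t * (1 + rho) / (rho + 2).
pose D := rho * (rho + 2) + (1 + rho).
have D0 : 0 < D by rewrite /D; nra.
pose d2 := t * rho * (1 + rho) / D.
have d10 : 0 < d1 by rewrite divr_gt0 ?mulr_gt0//; lra.
have d20 : 0 < d2 by rewrite divr_gt0 ?mulr_gt0.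
pose d := Num.min (Num.min 1 rho) (Num.min d1 d2).
have d0 : 0 < d by rewrite !lt_min ltr01 rho0 d10 d20.
have dd1 : d * (rho + 2) <= t * (1 + rho).
  by rewrite -ler_pdivlMr; [rewrite !ge_min lexx !orbT|lra].
have dd2 : d * D <= t * rho * (1 + rho).
  by rewrite -ler_pdivlMr// !ge_min lexx !orbT.
have dle1 : d <= 1 by rewrite !ge_min lexx.
have dler : d <= rho by rewrite !ge_min lexx !orbT.
exists d => // rh z; rewrite !ltr_norml => /andP[h1 h2] /andP[z1 z2].
have rh0 : 0 < rh by lra.
have z0 : 0 < z by lra.
have rz : rh * z <= rho + d * (rho + 2).
  apply: (@le_trans _ _ ((rho + d) * (1 + d))).
    by apply: ler_pM; lra.
  nra.
have rz0 : 0 < 1 + rh * z by rewrite ltr_pwDl// ltW// mulr_gt0.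
split => //.
  rewrite ler_pdivrMr// mulrC ler_pdivlMr//; nra.
rewrite ler_pdivrMr// mulrAC ler_pdivlMr//.
rewrite /D in dd2.
apply: (@le_trans _ _ ((1 - t) * rho * (1 + (rho + d * (rho + 2))))).
  by rewrite ler_wpM2l//; [rewrite mulr_ge0; lra|lra].
have e1 : 0 <= t * (rho * (d * (rho + 2))).
  by rewrite !mulr_ge0//; lra.
have e2 : (rho - d) * (1 + rho) <= rh * (1 + rho) by rewrite ler_wpM2r//; lra.
lra.
Qed.

Section divergence_lower_bound.
Context (R : realType) (dT : measure_display) (T : measurableType dT) (n : nat)
  (Theta : set 'cV[R]_n) (r : T -> 'cV[R]_n -> R) (ts : 'cV[R]_n) (f : R -> R)
  (rho : R).
Hypotheses (r_gt0 : forall x t, 0 < r x t) (r_ts : forall x, r x ts = 1)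
  (rho_gt0 : 0 < rho)
  (f_ge0 : forall z, 0 < z -> 0 <= f z)
  (f_minorant : forall t, 0 < t -> exists2 d : R, 0 < d &
    forall z, `|z - 1| < d ->
      ((f^`(2))%classic 1 / 2 - t) * (z - 1) ^+ 2 <= f z).
Let F := (f^`(2))%classic 1.
Hypothesis F_gt0 : 0 < F.
Let g (x : T) := grad (r x) ts.
Let lin (x : T) (u : 'cV[R]_n) := \sum_i u i ord0 * g x i ord0.

(** Write [z - 1 = c y], with [y] within [t K] of [lin x u]. One factor [1 - t] is lost in the
    minorant of [f], one in the weight, and one in passing from [y ^+ 2] to [lin x u ^+ 2]. *)
Lemma summand_lower_bound (t K : R) (N : nat) : 0 < t -> t < 1 -> 0 <= K ->
  exists2 d : R, 0 < d & forall (x : T) (u : 'cV[R]_n) (c rh : R),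
    good Theta r ts t N x -> `|u| <= K -> 0 < c -> c < d -> `|rh - rho| < d ->
    Theta (c *: u + ts) ->
    let z := r x (c *: u + ts) in
    let low := (1 - t) ^+ 3 * lin x u ^+ 2 - t * K ^+ 2 in
    (1 + rho)^-1 * low <= 2 / (F * c ^+ 2) * f_d f rh z /\
    rho / (1 + rho) * low <= 2 / (F * c ^+ 2) * f_n f rh z.
Proof.
move=> t0 t1 K0.
(* With this tolerance the minorant has coefficient [(1 - t) F / 2]. *)
have tF0 : 0 < t * F / 2 by rewrite divr_gt0 ?mulr_gt0.
have [d1 d10 H1] := f_minorant tF0.
have [d2 d20 H2] := weight_lower_bound rho_gt0 t0 t1.
(* [L] bounds [|y|]: the linear term on a good point, the remainder, and [1] for positivity. *)
pose L := n%:R * N%:R * K + t * K + 1.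
have L0 : 0 < L by rewrite ltr_wpDl// addr_ge0 ?mulr_ge0// ltW.
pose d := Num.min (Num.min (N.+1%:R^-1 / (K + 1)) d2) (Num.min d1 d2 / L).
have K10 : 0 < K + 1 by lra.
have d0 : 0 < d by rewrite !lt_min !divr_gt0 ?lt_min ?d10 ?d20 ?invr_gt0.
exists d => // x u c rh [gN Bx] uK c0; rewrite !lt_min.
move=> /andP[/andP[cN _] cL] /andP[/andP[_ rhd] _] Th z low.
have cuN : `|c *: u| < N.+1%:R^-1.
  rewrite normrZ gtr0_norm//.
  apply: (@le_lt_trans _ _ (c * (K + 1))).
    by rewrite ler_wpM2l ?(ltW c0)//; lra.
  by rewrite -ltr_pdivlMr.
have := Bx _ cuN Th; rewrite /remainder r_ts.
have -> : \sum_i (c *: u) i ord0 * grad (r x) ts i ord0 = c * lin x u.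
  by rewrite /lin mulr_sumr; apply: eq_bigr => i _; rewrite mxE mulrA.
rewrite -/z normrZ gtr0_norm// => rem.
pose y := (z - 1) / c.
have zy : z - 1 = c * y by rewrite /y mulrC divfK ?gt_eqF.
have ly : `|y - lin x u| <= t * K.
  have : c * `|y - lin x u| <= c * (t * K).
    rewrite -[X in X * `|_|](gtr0_norm c0) -normrM mulrBr -zy.
    apply: (le_trans rem); rewrite [leRHS]mulrCA ler_wpM2l ?(ltW t0)//.
    by rewrite ler_wpM2l ?(ltW c0).
  by rewrite ler_pM2l.
have linL : `|lin x u| <= n%:R * N%:R * K.
  apply: (le_trans (ler_norm_sum _ _ _)).
  apply: (@le_trans _ _ (\sum_(i < n) K * N%:R)).
    apply: ler_sum => i _; rewrite normrM ler_pM//.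
    exact: le_trans (mx_entry_norm_le _ _ _) uK.
  by rewrite sumr_const card_ord -mulrA [X in _ <= _ * X]mulrC [leRHS]mulr_natl.
have yL : `|y| <= L.
  rewrite -[y](subrK (lin x u)) (le_trans (ler_normD _ _))// /L; lra.
have z1 : `|z - 1| < Num.min d1 d2.
  rewrite zy normrM gtr0_norm//.
  apply: (@le_lt_trans _ _ (c * L)); first by rewrite ler_wpM2l ?(ltW c0).
  by rewrite -ltr_pdivlMr.
move: (z1); rewrite lt_min => /andP[zd1 zd2].
have [rh0 z0 W1 W2] := H2 rh z rhd zd2.
have fz : (1 - t) * y ^+ 2 <= 2 / (F * c ^+ 2) * f z.
  have := H1 z zd1; rewrite -/F zy => Hf.
  rewrite mulrAC ler_pdivlMr ?mulr_gt0 ?exprn_gt0//.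
  rewrite [leLHS](_ : _ = 2 * ((F / 2 - t * F / 2) * (c * y) ^+ 2)); last by field.
  by rewrite ler_pM2l.
have y2 : (1 - t) * lin x u ^+ 2 - t * K ^+ 2 <= y ^+ 2.
  set a := lin x u in ly *; pose e := y - a.
  have e2 : e ^+ 2 <= (t * K) ^+ 2.
    rewrite -[leLHS]real_normK ?num_real// lerXn2r ?nnegrE//.
    by rewrite mulr_ge0// ltW.
  have -> : y = a + e by rewrite /e; ring.
  (* Used through [t (a + e)^2 = t (1 - t) a^2 + (t a + e)^2 - (1 - t) e^2]. *)
  have tsq : 0 <= (t * a + e) ^+ 2 by exact: sqr_ge0.
  have : t * ((1 - t) * a ^+ 2 - t * K ^+ 2) <= t * (a + e) ^+ 2.
    have : (1 - t) * e ^+ 2 <= (1 - t) * (t * K) ^+ 2.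
      by rewrite ler_wpM2l//; lra.
    have : 0 <= t * (t * K) ^+ 2 by rewrite mulr_ge0 ?sqr_ge0// ltW.
    move: tsq; rewrite !exprMn !sqrrD !mulr2n; nra.
  by rewrite ler_pM2l.
have t1' : 0 <= 1 - t by lra.
have lowy : low <= (1 - t) ^+ 2 * y ^+ 2.
  rewrite /low; apply: (@le_trans _ _ ((1 - t) ^+ 2 *
      ((1 - t) * lin x u ^+ 2 - t * K ^+ 2))); last first.
    by rewrite ler_wpM2l ?sqr_ge0.
  have : (1 - t) ^+ 2 * (t * K ^+ 2) <= t * K ^+ 2.
    rewrite ler_piMl ?mulr_ge0 ?sqr_ge0 ?(ltW t0)//.
    by rewrite expr_le1//; lra.
  move=> h; rewrite [leRHS](_ : _ = (1 - t) ^+ 3 * lin x u ^+ 2 -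
    (1 - t) ^+ 2 * (t * K ^+ 2)); last by ring.
  by rewrite lerD2l lerN2.
have y20 : 0 <= (1 - t) * y ^+ 2 by rewrite mulr_ge0 ?sqr_ge0.
have r10 : 0 < 1 + rho by rewrite addr_gt0.
split.
  rewrite /f_d mulrA.
  apply: (@le_trans _ _ ((1 - t) * y ^+ 2 * ((1 - t) / (1 + rho)))).
    rewrite [leRHS](_ : _ = (1 + rho)^-1 * ((1 - t) ^+ 2 * y ^+ 2)); last by ring.
    by rewrite ler_wpM2l// invr_ge0 ltW.
  by apply: ler_pM => //; rewrite divr_ge0// ltW.
rewrite /f_n.
apply: (@le_trans _ _ ((1 - t) * y ^+ 2 * ((1 - t) * rho / (1 + rho)))).
  rewrite [leRHS](_ : _ = rho / (1 + rho) * ((1 - t) ^+ 2 * y ^+ 2)); last by ring.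
  by rewrite ler_wpM2l// divr_ge0// ltW.
rewrite [leRHS](_ : _ = 2 / (F * c ^+ 2) * f z * (rh / (1 + rh * z))); last first.
  by rewrite [rh * f z]mulrC !mulrA.
by apply: ler_pM => //; rewrite divr_ge0 ?mulr_ge0// ltW.
Qed.

(** In [low] the indicator multiplies only the main term: outside the good set the bound is
    [- t K^2 <= 0], below any value of the summand, so one inequality covers all points. The two
    weights add up to one, so the averaged error is again [t K^2]. *)
Lemma Df_hat_lower_bound (t K : R) (N : nat) : 0 < t -> t < 1 -> 0 <= K ->
  exists2 d : R, 0 < d & forall (l1 l2 : nat) (xn : 'I_l1 -> T) (xd : 'I_l2 -> T)
      (u : 'cV[R]_n) (m : R),
    (0 < l1)%N -> (0 < l2)%N -> 0 < m -> (Num.sqrt m)^-1 < d ->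
    `|l1%:R / l2%:R - rho| < d -> `|u| <= K ->
    Theta ((Num.sqrt m)^-1 *: u + ts) ->
    (1 - t) ^+ 3 * qform ((1 + rho)^-1 *: emp_moment g (good Theta r ts t N) xd
       + (rho / (1 + rho)) *: emp_moment g (good Theta r ts t N) xn) u
      - t * K ^+ 2
    <= 2 * m / F * Df_hat f r xn xd ((Num.sqrt m)^-1 *: u + ts).
Proof.
move=> t0 t1 K0; have [d d0 H] := summand_lower_bound N t0 t1 K0.
exists d => // l1 l2 xn xd u m l10 l20 m0 cd rhd uK Th.
pose c := (Num.sqrt m)^-1.
have c0 : 0 < c by rewrite invr_gt0 sqrtr_gt0.
have mc : 2 * m / F = 2 / (F * c ^+ 2).
  rewrite /c exprVn sqr_sqrtr ?(ltW m0)//; field.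
  by rewrite !gt_eqF.
set rh := l1%:R / l2%:R in rhd.
have rh0 : 0 < rh by rewrite divr_gt0 ?ltr0n.
set B := good Theta r ts t N.
pose low x := \1_B x * ((1 - t) ^+ 3 * lin x u ^+ 2) - t * K ^+ 2.
have r10 : 0 < 1 + rho by rewrite addr_gt0.
have tK : 0 <= t * K ^+ 2 by rewrite mulr_ge0 ?sqr_ge0// ltW.
have Fc : 0 <= 2 / (F * c ^+ 2) by rewrite divr_ge0 ?mulr_ge0 ?sqr_ge0 ?ltW.
have P x : (1 + rho)^-1 * low x <= 2 / (F * c ^+ 2) * f_d f rh (r x (c *: u + ts)) /\
    rho / (1 + rho) * low x <= 2 / (F * c ^+ 2) * f_n f rh (r x (c *: u + ts)).
  rewrite /low indicE; case: (boolP (x \in B)) => [|_].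
    rewrite inE mul1r => Bx; exact: H Bx uK c0 cd rhd Th.
  rewrite mul0r sub0r; set z := r x _.
  have z0 : 0 < z by exact: r_gt0.
  have w0 : 0 < 1 + rh * z by rewrite ltr_pwDl// ltW// mulr_gt0.
  split; (apply: (@le_trans _ _ 0); [
    by rewrite mulr_ge0_le0 ?oppr_le0 ?divr_ge0 ?invr_ge0// ltW |
    rewrite mulr_ge0// /f_d /f_n divr_ge0 ?mulr_ge0 ?f_ge0// ltW//]).
have avg (l : nat) (xs : 'I_l -> T) (a : R) (h : T -> R) : (0 < l)%N ->
    (forall x, a * low x <= 2 / (F * c ^+ 2) * h x) ->
    a * ((1 - t) ^+ 3 * qform (emp_moment g B xs) u - t * K ^+ 2) <=
    2 / (F * c ^+ 2) * (l%:R^-1 * \sum_(j < l) h (xs j)).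
  move=> l0 Ph.
  have lR : (0 : R) < l%:R by rewrite ltr0n.
  have qE : qform (emp_moment g B xs) u =
      l%:R^-1 * \sum_(j < l) \1_B (xs j) * lin (xs j) u ^+ 2.
    exact: qform_emp_moment.
  rewrite qE.
  have -> : a * ((1 - t) ^+ 3 * (l%:R^-1 * \sum_(j < l) \1_B (xs j) *
      lin (xs j) u ^+ 2) - t * K ^+ 2) =
      l%:R^-1 * \sum_(j < l) a * low (xs j).
    have -> : \sum_(j < l) a * low (xs j) = a * ((1 - t) ^+ 3 *
        (\sum_(j < l) \1_B (xs j) * lin (xs j) u ^+ 2) - t * K ^+ 2 * l%:R).
      rewrite -mulr_sumr /low big_split/= sumr_const card_ord mulr_sumr.
      congr (_ * (_ + _)); last by rewrite mulNrn mulr_natr.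
      by apply: eq_bigr => j _; rewrite mulrCA.
    by field; rewrite gt_eqF.
  rewrite mulrCA ler_wpM2l ?invr_ge0 ?(ltW lR)// mulr_sumr.
  by apply: ler_sum => j _; exact: Ph.
have A1 := avg _ xd _ _ l20 (fun x => (P x).1).
have A2 := avg _ xn _ _ l10 (fun x => (P x).2).
rewrite mc /Df_hat -/rh [leRHS]mulrDr.
apply: le_trans (lerD A1 A2).
rewrite [qform (_ + _) u](_ : _ = (1 + rho)^-1 * qform (emp_moment g B xd) u +
  rho / (1 + rho) * qform (emp_moment g B xn) u); last first.
  rewrite /qform mulmxDr mulmxDl -!scalemxAr -!scalemxAl.
  by rewrite [LHS]mxE [X in X + _]mxE [X in _ + X]mxE.
rewrite le_eqVlt; apply/orP; left; apply/eqP; field.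
by rewrite gt_eqF.
Qed.

End divergence_lower_bound.

(** * Asymptotics along the local alternatives *)

Section sample_means.
Context (R : realType) (dT : measure_display) (T : measurableType dT)
  (mu : {sigma_finite_measure set T -> \bar R}) (dO : nat -> measure_display)
  (O : forall i, measurableType (dO i)) (P : forall i, probability (O i) R)
  (p : T -> R) (q : nat -> T -> R) (l : nat -> nat)
  (X : forall i, 'I_(l i) -> O i -> T).
Arguments X : clear implicits.
Hypotheses (p_density : is_density mu p)
  (q_density : forall i, is_density mu (q i))
  (q_local : (fun i => (\int[mu]_x `|q i x - p x|%:E)%E) @ \oo --> 0%E)
  (l_infty : l @ \oo --> \oo)
  (X_density : forall i j, has_density (P i) mu (q i) (X i j))
  (X_indep : forall i (j j' : 'I_(l i)) A B, j != j' ->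
    measurable A -> measurable B ->
    P i (X i j @^-1` A `&` X i j' @^-1` B) =
    (P i (X i j @^-1` A) * P i (X i j' @^-1` B))%E).

(** Half of [e] goes to the fluctuation about the mean under [q i], half to the distance between
    this mean and the one under [p]. *)
Lemma lln_whp (g : T -> R) (C e : R) :
  measurable_fun setT g -> (forall x, `|g x| <= C) -> 0 < e ->
  whp P (fun i => [set w |
    `|(l i)%:R^-1 * (\sum_(j < l i) g (X i j w)) - Edens mu p g| <= e]).
Proof.
move=> mg gC e0 eta eta0.
have C0 : 0 <= C by exact: le_trans (normr_ge0 _) (gC point).
have e20 : 0 < e / 2 by rewrite divr_gt0.
(* Beyond this sample size, the bound of [lln_bounded] at [e / 2] is at most [eta]. *)
pose K := (e / 2) ^- 2 * (2 * C) ^+ 2 / eta.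
have eC0 : 0 < e / 2 / (C + 1) by rewrite divr_gt0// ltr_wpDl.
near=> i.
have li : (Num.bound K < l i)%N.
  by near: i; move/cvgnyPgt : l_infty; exact.
have qi : (\int[mu]_x `|q i x - p x|%:E <= (e / 2 / (C + 1))%:E)%E.
  by near: i; exact: near_ereal0_le eC0 q_local.
have l0 : (0 < l i)%N by exact: leq_ltn_trans li.
have lR : (0 : R) < (l i)%:R by rewrite ltr0n.
have mXj j : measurable_fun setT (X i j) by have [] := X_density j.
have mean j : Rintegral (P i) setT (g \o X i j) = Edens mu (q i) g.
  exact: has_density_expectation (q_density i) (X_density j) mg gC.
have bound := @lln_bounded _ _ _ _ _ (P i) _ (X i) g C (e / 2)
  (Edens mu (q i) g) l0 e20 mXj (@X_indep i) mg gC mean.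
pose Z w := (l i)%:R^-1 * (\sum_(j < l i) g (X i j w)) - Edens mu (q i) g.
have mZ : measurable_fun setT (fun w => `|Z w|).
  apply: measurableT_comp => //; apply: measurable_funB => //.
  apply: measurable_funM => //; apply: measurable_sum => j.
  exact: (measurableT_comp mg (mXj j)).
exists [set w | e / 2 < `|Z w|]; split.
- exact: measurable_gt_event.
- apply: (le_trans bound); rewrite lee_fin mulrA ler_pdivrMr// [leRHS]mulrC -ler_pdivrMr//.
  have [K0|K0] := leP 0 K.
    by apply: ltW; apply: lt_trans (archi_boundP K0) _; rewrite ltr_nat.
  by apply: ltW; apply: lt_trans K0 _.
- move=> w /= /negP; rewrite -leNgt => Zw.
  have diff : `|Edens mu (q i) g - Edens mu p g| <= e / 2.
    rewrite -lee_fin.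
    apply: (le_trans (Edens_diff_le (q_density i) p_density mg gC)).
    apply: (@le_trans _ _ (C%:E * (e / 2 / (C + 1))%:E)%E).
      by apply: lee_wpmul2l => //; rewrite lee_fin.
    rewrite -EFinM lee_fin mulrCA ler_piMr ?(ltW e20)//.
    by rewrite ler_pdivrMr ?mul1r ?lerDl// ltr_wpDl.
  rewrite [leRHS]splitr.
  rewrite [X in `|X|](_ : _ = Z w + (Edens mu (q i) g - Edens mu p g)).
    by apply: le_trans (ler_normD _ _) _; exact: lerD.
  by rewrite /Z addrA subrK.
Unshelve. all: end_near. Qed.

End sample_means.

Lemma emp_moment_whp (R : realType) (dT : measure_display)
    (T : measurableType dT) (mu : {sigma_finite_measure set T -> \bar R})
    (dO : nat -> measure_display) (O : forall i, measurableType (dO i))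
    (P : forall i, probability (O i) R) (p : T -> R) (q : nat -> T -> R)
    (l : nat -> nat) (X : forall i, 'I_(l i) -> O i -> T) (n : nat)
    (g : T -> 'cV[R]_n) (B : set T) (C e : R) :
  is_density mu p -> (forall i, is_density mu (q i)) ->
  (fun i => (\int[mu]_x `|q i x - p x|%:E)%E) @ \oo --> 0%E ->
  l @ \oo --> \oo ->
  (forall i j, has_density (P i) mu (q i) (@X i j)) ->
  (forall i (j j' : 'I_(l i)) A A', j != j' -> measurable A -> measurable A' ->
    P i (@X i j @^-1` A `&` @X i j' @^-1` A') =
    (P i (@X i j @^-1` A) * P i (@X i j' @^-1` A'))%E) ->
  (forall a, measurable_fun setT (fun x => g x a ord0)) -> measurable B ->
  (forall x a, B x -> `|g x a ord0| <= C) -> 0 <= C -> 0 < e ->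
  whp P (fun i => [set w | forall a b,
    `|emp_moment g B (fun j => @X i j w) a b -
      Edens mu p (fun x => \1_B x * (g x a ord0 * g x b ord0))| <= e]).
Proof.
move=> pd qd ql li Xd Xi mg mB gC C0 e0.
apply: whp_sub (@whp_fin _ _ _ P _ (fun (ab : 'I_n * 'I_n) i => [set w |
  `|(l i)%:R^-1 * (\sum_(j < l i)
     \1_B (@X i j w) * (g (@X i j w) ab.1 ord0 * g (@X i j w) ab.2 ord0)) -
    Edens mu p (fun x => \1_B x * (g x ab.1 ord0 * g x ab.2 ord0))| <= e]) _).
  by near=> i => w H a b; rewrite mxE; exact: (H (a, b)).
move=> [a b] /=.
apply: (@lln_whp _ _ _ mu dO O P p q l X pd qd ql li Xd Xi
  (fun x => \1_B x * (g x a ord0 * g x b ord0)) (C * C)) => //.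
  by apply: measurable_funM => //; exact: measurable_funM.
move=> x; rewrite indicE; case: (boolP (x \in B)) => [|_].
  by rewrite inE mul1r normrM => Bx; rewrite ler_pM// gC.
by rewrite mul0r normr0 mulr_ge0.
Unshelve. all: end_near. Qed.

(** As soon as [mn i <= (rho + 1) md i], the effective size is at least [mn i / (rho + 2)]. *)
Lemma eff_size_infty (R : realType) (mn md : nat -> nat) (rho : R) (a : R) :
  mn @ \oo --> \oo -> md @ \oo --> \oo -> 0 < rho ->
  (fun i => (mn i)%:R / (md i)%:R : R) @ \oo --> rho ->
  \forall i \near \oo, a < eff_size R (mn i) (md i).
Proof.
move=> mny mdy rho0 lim; near=> i.
have mn1 : (Num.bound (`|a| * (rho + 2)) < mn i)%N.
  by near: i; move/cvgnyPgt : mny; exact.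
have md0 : (0 < md i)%N by near: i; move/cvgnyPgt : mdy; exact.
have ratio : (mn i)%:R / (md i)%:R <= rho + 1.
  have : `|rho - (mn i)%:R / (md i)%:R| < 1.
    by near: i; move/cvgrPdist_lt : lim; exact.
  by rewrite ltr_norml => /andP[h1 h2]; lra.
have mdR : (0 : R) < (md i)%:R by rewrite ltr0n.
have mnR : (0 : R) < (mn i)%:R by rewrite ltr0n; exact: leq_ltn_trans mn1.
have A0 : 0 <= `|a| * (rho + 2) by rewrite mulr_ge0//; lra.
have mnA : `|a| * (rho + 2) < (mn i)%:R.
  by apply: lt_trans (archi_boundP A0) _; rewrite ltr_nat.
apply: le_lt_trans (ler_norm a) _.
rewrite /eff_size ltr_pdivlMr ?addr_gt0//.
rewrite ler_pdivrMr// in ratio.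
apply: (@le_lt_trans _ _ (`|a| * (rho + 2) * (md i)%:R)).
  by rewrite -mulrA ler_wpM2l//; lra.
by rewrite ltr_pM2r.
Unshelve. all: end_near. Qed.

Lemma invr_sqrt_lt (R : realType) (m d : R) :
  0 < d -> d ^- 2 < m -> (Num.sqrt m)^-1 < d.
Proof.
move=> d0 dm; have m0 : 0 < m by apply: lt_trans dm; rewrite invr_gt0 exprn_gt0.
rewrite -[d]invrK ltf_pV2 ?posrE ?sqrtr_gt0 ?invr_gt0//.
rewrite -[d^-1]gtr0_norm ?invr_gt0// -sqrtr_sqr ltr_sqrt//.
by rewrite exprVn.
Qed.

(** The form of the identity is the sum of squares; the bound [1 + |K|] avoids a square root. *)
Lemma norm_le_sum_sqr (R : realType) (n : nat) (z : 'cV[R]_n) (K : R) :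
  qform 1%:M z <= K -> `|z| <= 1 + `|K|.
Proof.
rewrite /qform mulmx1 mxE => zK; apply: mx_norm_le => [|i j].
  by rewrite addr_ge0.
have zi : z i ord0 ^+ 2 <= `|K|.
  apply: le_trans (ler_norm K); apply: le_trans zK.
  rewrite (bigD1 i)//= mxE -expr2 lerDl; apply: sumr_ge0 => a _.
  by rewrite mxE -expr2 sqr_ge0.
rewrite (ord1 j) -(@ler_pXn2r _ 2) ?nnegrE ?addr_ge0//.
rewrite real_normK ?num_real//; apply: (le_trans zi).
have := normr_ge0 K; nra.
Qed.

Lemma qform_scale (R : realType) (n : nat) (c : R) (N : 'M[R]_n)
    (z : 'cV[R]_n) : qform N (c *: z) = c ^+ 2 * qform N z.
Proof.
have -> : qform N (c *: z) = ((c *: z^T) *m N *m (c *: z)) ord0 ord0.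
  by congr ((_ *m _ *m _) _ _); rewrite linearZ.
by rewrite -scalemxAr -!scalemxAl scalerA mxE expr2.
Qed.

Lemma EL_stat_qform (R : realType) (k : nat) (m : R) (V : 'M[R]_k)
    (b bs : 'cV[R]_k) : 0 <= m ->
  EL_stat m V b bs = qform V (Num.sqrt m *: (b - bs)).
Proof. by move=> m0; rewrite qform_scale sqr_sqrtr. Qed.

Lemma measurable_inv_pos (R : realType) (d : measure_display)
    (O : measurableType d) (Z : O -> R) :
  measurable_fun setT Z -> (forall w, 0 < Z w) ->
  measurable_fun setT (fun w => (Z w)^-1).
Proof.
move=> mZ Z0; rewrite (_ : (fun w => _) = expR \o (fun w => - ln (Z w))).
  apply: measurableT_comp; first exact: measurable_expR.
  apply: measurable_funN; apply: measurableT_comp mZ; exact: measurable_ln.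
by apply/funext => w; rewrite /= expRN lnK// posrE.
Qed.

Lemma measurable_Df_hat (R : realType) (d dT : measure_display)
    (O : measurableType d) (T : measurableType dT) (n : nat)
    (Theta : set 'cV[R]_n) (r : T -> 'cV[R]_n -> R) (f : R -> R) (l1 l2 : nat)
    (xn : 'I_l1 -> O -> T) (xd : 'I_l2 -> O -> T) (that : O -> 'cV[R]_n) :
  open Theta -> (forall t, Theta t -> measurable_fun setT (fun x => r x t)) ->
  (forall x t, Theta t -> {for t, continuous (r x)}) ->
  (forall x t, 0 < r x t) -> (forall x : R, 0 < x -> derivable f x 1) ->
  (forall j, measurable_fun setT (xn j)) ->
  (forall j, measurable_fun setT (xd j)) ->
  mxmeasurable that -> (forall w, Theta (that w)) ->
  measurable_fun setT (fun w =>
    Df_hat f r (fun j => xn j w) (fun j => xd j w) (that w)).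
Proof.
move=> oT rm rc r0 fd mxn mxd mt tT.
have rh0 : 0 <= l1%:R / l2%:R :> R by rewrite divr_ge0.
have main (X : O -> T) : measurable_fun setT X ->
    measurable_fun setT (fun w => f (r (X w) (that w))) /\
    measurable_fun setT (fun w => (1 + l1%:R / l2%:R * r (X w) (that w))^-1).
  move=> mX; have mr := measurable_caratheodory oT rm rc mX mt tT.
  split; first by apply: (measurable_divergence fd mr) => w; exact: r0.
  apply: measurable_inv_pos => [|w].
    by apply: measurable_funD => //; exact: measurable_funM.
  by rewrite ltr_pwDl// mulr_ge0// ltW.
rewrite /Df_hat; apply: measurable_funD; apply: measurable_funM => //;
  apply: measurable_sum => j.
  by have [h1 h2] := main _ (mxd j); exact: measurable_funM.
have [h1 h2] := main _ (mxn j).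
by apply: measurable_funM => //; exact: measurable_funM.
Qed.

(** Deterministic passage from the variable with a limit law to [u]: [W] stands for [U] at the local
    parameter, [y] for the rescaled error about it and [h'] for the local shift, so that [y + h'] is
    [u] and [W *m y] is the Gaussian-limit variable. *)
Lemma near_limit_quantities (R : realType) (n : nat) (M U : 'M[R]_n)
    (h : 'cV[R]_n) (K e : R) :
  U \in unitmx -> 0 <= K -> 0 < e -> exists2 d : R, 0 < d &
    exists2 Ku : R, 0 <= Ku &
    forall (W : 'M[R]_n) (h' y : 'cV[R]_n),
      `|W - U| <= d -> `|h' - h| <= d -> `|W *m y| <= K ->
      `|y + h'| <= Ku /\
      `|qform M (y + h') - qform M (invmx U *m (W *m y) + h)| <= e.
Proof.
move=> Uu K0 e0; pose V := invmx U.
pose Kz := n%:R * `|V| * K + `|h|; pose Ku := Kz + 2.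
have Kz0 : 0 <= Kz by rewrite addr_ge0// !mulr_ge0.
have Ku0 : 0 <= Ku by rewrite addr_ge0.
pose A := n%:R ^+ 2 * `|M| * (Ku + Kz).
have A0 : 0 <= A by rewrite !mulr_ge0// addr_ge0.
(* Both [y] and [h'] are off by at most [e1]; the cap at [1] is what makes [Kz + 2] a bound for
   [y + h']. *)
pose e1 := Num.min 1 (e / (2 * (A + 1))).
have A10 : 0 < 2 * (A + 1) by lra.
have e10 : 0 < e1 by rewrite lt_min ltr01 divr_gt0.
have [d0 d00 Hd] := near_solution Uu K0 e10.
exists (Num.min d0 e1); first by rewrite lt_min d00.
have md : Num.min d0 e1 <= d0 by rewrite ge_min lexx.
have me : Num.min d0 e1 <= e1 by rewrite ge_min lexx orbT.
exists Ku => // W h' y /le_trans/(_ md) Wd /le_trans/(_ me) hd WyK.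
have yV := Hd W y Wd WyK.
pose z := V *m (W *m y) + h.
have zK : `|z| <= Kz.
  apply: (le_trans (ler_normD _ _)); rewrite lerD2r.
  by apply: (le_trans (mulmx_norm_le _ _)); rewrite ler_wpM2l ?mulr_ge0.
have uz : `|y + h' - z| <= 2 * e1.
  rewrite [X in `|X|](_ : _ = (y - V *m (W *m y)) + (h' - h)); last first.
    by rewrite /z opprD addrACA.
  have -> : 2 * e1 = e1 + e1 by ring.
  by apply: (le_trans (ler_normD _ _)); apply: lerD; [exact: yV|exact: hd].
have e11 : e1 <= 1 by rewrite ge_min lexx.
have uK : `|y + h'| <= Ku.
  rewrite -[y + h'](subrK z) (le_trans (ler_normD _ _))// /Ku; lra.
split => //; apply: (le_trans (qform_vector_diff _ _ _)).
apply: (@le_trans _ _ (A * (2 * e1))).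
  by apply: ler_pM => //; rewrite ?mulr_ge0 ?addr_ge0// ler_wpM2l ?mulr_ge0// lerD.
apply: (@le_trans _ _ ((A + 1) * (2 * (e / (2 * (A + 1)))))).
  apply: ler_pM => //; first by rewrite mulr_ge0// ltW.
    by rewrite lerDl.
  by rewrite ler_pM2l// ge_min lexx orbT.
rewrite [leLHS](_ : _ = e)//; field.
by rewrite gt_eqF//; lra.
Qed.

Lemma continuous_affine (R : realType) (n : nat) (V : 'M[R]_n) (h : 'cV[R]_n) :
  continuous (fun z : 'cV[R]_n => V *m z + h).
Proof.
move=> z; apply/(@cvgrPdist_lt _ _ _ (nbhs z)) => e e0.
pose K := n%:R * `|V| + 1.
have K0 : 0 < K by rewrite ltr_wpDl// mulr_ge0.
apply/nbhs_ballP; exists (e / K); first by rewrite /= divr_gt0.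
move=> y; rewrite -ball_normE/= => zy.
rewrite opprD addrACA subrr addr0 -mulmxBr.
apply: (le_lt_trans (mulmx_norm_le _ _)).
apply: (@le_lt_trans _ _ (K * `|z - y|)); first by rewrite ler_wpM2r// lerDl.
by rewrite mulrC -ltr_pdivlMr.
Qed.

Lemma Df_hat_ge0 (R : realType) (T : Type) (n : nat) (f : R -> R)
    (r : T -> 'cV[R]_n -> R) (l1 l2 : nat) (xn : 'I_l1 -> T) (xd : 'I_l2 -> T)
    (t : 'cV[R]_n) :
  (forall x, 0 < r x t) -> (forall z, 0 < z -> 0 <= f z) ->
  0 <= Df_hat f r xn xd t.
Proof.
move=> r0 f0; rewrite /Df_hat; set rh := _ / _.
have rh0 : 0 <= rh by rewrite divr_ge0.
have w0 x : 0 <= 1 + rh * r x t by rewrite addr_ge0// mulr_ge0// ltW.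
by apply: addr_ge0; rewrite mulr_ge0 ?invr_ge0//; apply: sumr_ge0 => j _;
  rewrite /f_d /f_n divr_ge0 ?mulr_ge0// f0.
Qed.

(** By [(1 - t)^3 >= 1 - 3 t], shrinking costs at most [3 t A0], which together with [t K2] is at
    most one [e]; the other [e] pays for replacing [a] by [b]. *)
Lemma shrunken_lower_bound (R : realType) (t a b K2 A0 e : R) :
  0 < t -> t < 1 -> 0 <= a -> a <= A0 -> 0 <= K2 ->
  t * (3 * A0 + K2) <= e -> `|b - a| <= e ->
  a - e - e <= (1 - t) ^+ 3 * b - t * K2.
Proof.
move=> t0 t1 a0 aA K20 te; rewrite ler_norml => /andP[h1 h2].
pose s := (1 - t) ^+ 3.
have s0 : 0 <= s by rewrite exprn_ge0//; lra.
have s1 : s <= 1 by rewrite exprn_ile1//; lra.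
have s3 : 1 - 3 * t <= s.
  have -> : s = 1 - 3 * t + t ^+ 2 * (3 - t) by rewrite /s; ring.
  by rewrite lerDl mulr_ge0 ?sqr_ge0//; lra.
have e0 : 0 <= e by apply: le_trans te; rewrite mulr_ge0 ?addr_ge0 ?mulr_ge0//; lra.
have H1 : (1 - 3 * t) * a <= s * a by rewrite ler_wpM2r.
have H2 : s * (- e) <= s * (b - a) by rewrite ler_wpM2l.
have H3 : s * e <= 1 * e by rewrite ler_wpM2r.
have H4 : t * (3 * a + K2) <= t * (3 * A0 + K2) by rewrite ler_wpM2l//; lra.
rewrite -/s; lra.
Qed.

Lemma Umx_at_one (R : realType) (dT : measure_display) (T : measurableType dT)
    (mu : {measure set T -> \bar R}) (p : T -> R) (rho : R) (n : nat)
    (r : T -> 'cV[R]_n -> R) (t : 'cV[R]_n) :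
  (forall x, r x t = 1) ->
  (forall a b, mu.-integrable setT
    (fun x => (p x * (score r x t a ord0 * score r x t b ord0))%:E)) ->
  Umx mu p rho r t = (1 + rho)^-1 *: Mmx mu p r t.
Proof.
move=> r1 i1; apply/matrixP => a b; rewrite [LHS]mxE [RHS]mxE [X in _ * X]mxE.
rewrite /Edens -(RintegralZl _ measurableT (i1 a b)).
apply: eq_Rintegral => x _; rewrite r1 mulr1.
by rewrite mulrCA.
Qed.

(** [A A^T] is nonzero, so [A] has a nonzero column. Its image under [invmx U] is nonzero, and [M]
    is definite, so the quadratic coefficient of the corresponding normal variable does not
    vanish. *)
Lemma limit_qform_null (R : realType) (d : measure_display)
    (O : measurableType d) (Q : probability O R) (n l : nat)
    (G : 'I_l -> O -> R) (M U S : 'M[R]_n) (A : 'M[R]_(n, l)) (h : 'cV[R]_n)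
    (a c : R) :
  std_normal_vector Q G -> M^T = M -> M \in unitmx ->
  (forall y, 0 <= qform M y) -> U \in unitmx -> a != 0 -> S != 0 ->
  A *m A^T = a *: S ->
  Q [set w | qform M (invmx U *m (A *m \col_i G i w) + h) = c] = 0%E.
Proof.
move=> G_std M_sym M_u M_psd U_u a0 S0 AA.
have A_neq0 : A != 0.
  apply: contra_neq S0 => A0; move: AA; rewrite A0 mul0mx.
  by move/esym/eqP; rewrite scaler_eq0 (negbTE a0) => /eqP.
have [j colj] : exists j, col j A != 0.
  apply/existsP; apply: contra_neqT A_neq0; rewrite negb_exists => /forallP A0.
  apply/matrixP => u v; have := A0 v; rewrite negbK => /eqP/matrixP/(_ u ord0).
  by rewrite !mxE.
rewrite (_ : [set w | _] =
    [set w | qform M (h + (invmx U *m A) *m \col_i G i w) = c]); last first.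
  by apply/seteqP; split => w /=; rewrite mulmxA addrC.
apply: (@normal_qform_null _ _ _ _ _ _ G_std _ _ _ _ j).
apply: contra_neq colj => /(psd_unitmx_qform_eq0 M_sym M_u M_psd).
rewrite colE -mulmxA -colE => /(congr1 (mulmx U)).
by rewrite mulmx0 mulKVmx.
Qed.

Lemma mxmeasurable_dsubmx (R : realType) (d : measure_display)
    (O : measurableType d) (m1 m2 n : nat) (Z : O -> 'M[R]_(m1 + m2, n)) :
  mxmeasurable Z -> mxmeasurable (fun w => dsubmx (Z w)).
Proof.
move=> mZ a b; rewrite (_ : (fun w => _) = (fun w => Z w (rshift m1 a) b)).
  exact: mZ.
by apply/funext => w; rewrite mxE.
Qed.

Lemma measurable_EL_reject (R : realType) (d : measure_display)
    (O : measurableType d) (k : nat) (c m : R) (V : O -> 'M[R]_k)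
    (that : O -> 'cV[R]_(1 + k)) (bs : 'cV[R]_k) :
  mxmeasurable V -> mxmeasurable that ->
  measurable [set w | EL_reject c m (V w) (beta_of (that w)) bs].
Proof.
move=> mV mt; apply: measurable_gt_event; apply: measurable_funM => //.
apply: measurable_qform => //; apply: mxmeasurableB.
  exact: mxmeasurable_dsubmx.
exact: mxmeasurable_cst.
Qed.

(** One [e] pays for replacing [V] by [Vphi], the other for replacing the form at [u] by [x]. *)
Lemma EL_reject_qform (R : realType) (k : nat) (c m e e2 Ku x : R)
    (V Vphi : 'M[R]_k) (M : 'M[R]_(1 + k)) (t ts : 'cV[R]_(1 + k)) :
  0 < m -> 0 <= e2 -> k%:R ^+ 2 * e2 * Ku ^+ 2 <= e ->
  (forall a b, `|V a b - Vphi a b| <= e2) ->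
  `|Num.sqrt m *: (t - ts)| <= Ku ->
  (forall z, qform Vphi (dsubmx z) <= qform M z) ->
  `|qform M (Num.sqrt m *: (t - ts)) - x| <= e ->
  EL_reject c m V (beta_of t) (beta_of ts) -> c - 2 * e <= x.
Proof.
move=> m0 e20 ke VV uK Vphi_le uq; rewrite /EL_reject EL_stat_qform ?(ltW m0)//.
set u := Num.sqrt m *: (t - ts) in uK uq.
have -> : Num.sqrt m *: (beta_of t - beta_of ts) = dsubmx u.
  by apply/matrixP => a b; rewrite !mxE.
set v := dsubmx u.
have vK : `|v| <= Ku.
  apply: mx_norm_le => [|a b]; first exact: le_trans uK.
  rewrite mxE; exact: le_trans (mx_entry_norm_le _ _ _) uK.
have V1 : `|qform V v - qform Vphi v| <= e.
  apply: (le_trans (qform_matrix_diff _ _ _)); apply: le_trans ke.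
  apply: ler_pM; rewrite ?mulr_ge0 ?sqr_ge0//.
    rewrite ler_wpM2l ?sqr_ge0//; apply: mx_norm_le => // a b.
    by rewrite !mxE; exact: VV.
  by rewrite lerXn2r ?nnegrE// (le_trans _ uK).
have V2 := Vphi_le u; rewrite -/v in V2.
move: V1 uq; rewrite !ler_norml => /andP[_ H1] /andP[_ H2] H3.
lra.
Qed.

(** The weights add up to one, so the mixture is no farther from [M] than its two terms; one [e] is
    the sampling error, the other the truncation error. *)
Lemma emp_moment_mix_close (R : realType) (n : nat) (rho e : R)
    (E1 E2 MB M : 'M[R]_n) : 0 < rho -> 0 <= e ->
  (forall a b, `|E1 a b - MB a b| <= e) ->
  (forall a b, `|E2 a b - MB a b| <= e) ->
  (forall a b, `|MB a b - M a b| <= e) ->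
  `|(1 + rho)^-1 *: E1 + (rho / (1 + rho)) *: E2 - M| <= 2 * e.
Proof.
move=> rho0 e0 H1 H2 H3.
have r10 : 0 < 1 + rho by lra.
have tri E : (forall a b, `|E a b - MB a b| <= e) ->
    forall a b, `|E a b - M a b| <= 2 * e.
  move=> H a b; have := H a b; have := H3 a b.
  rewrite !ler_norml => /andP[? ?] /andP[? ?]; apply/andP; split; lra.
apply: mx_norm_le => [|a b]; first by rewrite mulr_ge0.
rewrite !mxE.
rewrite [X in `|X|](_ : _ = (1 + rho)^-1 * (E1 a b - M a b) +
    rho / (1 + rho) * (E2 a b - M a b)); last by field; rewrite gt_eqF.
apply: (le_trans (ler_normD _ _)); rewrite !normrM.
rewrite (gtr0_norm (_ : 0 < (1 + rho)^-1)) ?invr_gt0// (gtr0_norm rho0).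
rewrite -[leRHS](_ : (1 + rho)^-1 * (2 * e) + rho / (1 + rho) * (2 * e) = _); last first.
  by field; rewrite gt_eqF.
by apply: lerD; rewrite ler_wpM2l ?tri ?divr_ge0 ?invr_ge0// ltW.
Qed.

(** The three [e] pay for the shrinking by [t], for replacing [M] by [Mh], and for replacing the
    form at [u] by [x]. *)
Lemma Df_reject_qform (R : realType) (n : nat) (c e e3 t Ku A0 x D m F : R)
    (Mh M : 'M[R]_n) (u : 'cV[R]_n) :
  0 < t -> t < 1 -> 0 < m -> 0 < F -> (forall y, 0 <= qform M y) ->
  n%:R ^+ 2 * `|M| * Ku ^+ 2 <= A0 -> t * (3 * A0 + Ku ^+ 2) <= e ->
  n%:R ^+ 2 * (2 * e3) * Ku ^+ 2 <= e ->
  `|Mh - M| <= 2 * e3 -> `|u| <= Ku -> `|qform M u - x| <= e ->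
  (1 - t) ^+ 3 * qform Mh u - t * Ku ^+ 2 <= 2 * m / F * D ->
  c + 3 * e < x -> F / (2 * m) * c <= D.
Proof.
move=> t0 t1 m0 F0 psd MA te e3e MhM uK uq low cx.
have K2 : `|u| ^+ 2 <= Ku ^+ 2 by rewrite lerXn2r ?nnegrE// (le_trans _ uK).
have aA : qform M u <= A0.
  apply: (le_trans (ler_norm _)); apply: (le_trans (bilinear_norm_le _ _ _)).
  apply: le_trans MA; rewrite -mulrA -expr2.
  by rewrite ler_wpM2l// mulr_ge0// sqr_ge0.
have ba : `|qform Mh u - qform M u| <= e.
  apply: (le_trans (qform_matrix_diff _ _ _)); apply: le_trans e3e.
  apply: ler_pM; rewrite ?mulr_ge0 ?sqr_ge0//.
  by rewrite ler_wpM2l ?sqr_ge0.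
have := shrunken_lower_bound t0 t1 (psd u) aA (sqr_ge0 Ku) te ba.
move=> /le_trans/(_ low) H.
have cD : c <= 2 * m / F * D.
  by move: uq; rewrite ler_norml => /andP[H1 H2]; lra.
have mF : 0 < F / (2 * m) by rewrite divr_gt0 ?mulr_gt0.
apply: (@le_trans _ _ (F / (2 * m) * (2 * m / F * D))).
  by rewrite ler_wpM2l// ltW.
rewrite [leLHS](_ : _ = D)//; field.
by rewrite !gt_eqF.
Qed.

Lemma local_parameter_cvg (R : realType) (n : nat) (m : nat -> R)
    (h_ th : nat -> 'cV[R]_n) (h ts : 'cV[R]_n) :
  (forall a, \forall i \near \oo, a < m i) -> h_ @ \oo --> h ->
  (forall i, th i = ts + (Num.sqrt (m i))^-1 *: h_ i) -> th @ \oo --> ts.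
Proof.
move=> my hh thE.
have sm0 : (fun i => (Num.sqrt (m i))^-1) @ \oo --> (0 : R).
  apply/cvgrPdist_lt => b b0; apply: filterS (my (b ^- 2)) => i mi.
  rewrite sub0r normrN ger0_norm ?invr_ge0 ?sqrtr_ge0//.
  exact: invr_sqrt_lt.
rewrite (_ : th = fun i => ts + (Num.sqrt (m i))^-1 *: h_ i); last exact/funext.
have {2}-> : ts = ts + (0 : R) *: h by rewrite scale0r addr0.
exact: (cvgD (cvg_cst ts) (cvgZ sm0 hh)).
Qed.

(** Dominated convergence entry by entry; the entries are finite in number, so one [N] serves them
    all. *)
Lemma good_moment_cvg (R : realType) (dT : measure_display)
    (T : measurableType dT) (mu : {measure set T -> \bar R}) (p : T -> R)
    (n : nat) (g : T -> 'cV[R]_n) (B : nat -> set T) (M : 'M[R]_n) (e : R) :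
  (forall N, measurable (B N)) ->
  (forall N N', (N <= N')%N -> B N `<=` B N') -> (forall x, exists N, B N x) ->
  (forall a b, mu.-integrable setT
    (fun x => (p x * (g x a ord0 * g x b ord0))%:E)) ->
  M = \matrix_(a, b) Edens mu p (fun x => g x a ord0 * g x b ord0) -> 0 < e ->
  exists N, forall a b,
    `|Edens mu p (fun x => \1_(B N) x * (g x a ord0 * g x b ord0)) - M a b| <= e.
Proof.
move=> mB ndB cB gi ME e0.
have : \forall N \near \oo, forall ab : 'I_n * 'I_n,
  `|Edens mu p (fun x => \1_(B N) x * (g x ab.1 ord0 * g x ab.2 ord0))
    - M ab.1 ab.2| <= e.
  apply: filter_forall => -[a b] /=.
  have := Rintegral_indic_cvg mB ndB cB (gi a b).
  move=> /cvgrPdist_le/(_ e e0); apply: filterS => N.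
  rewrite distrC ME mxE /Edens.
  rewrite (_ : Rintegral mu setT (fun x => p x * (\1_(B N) x * _)) =
    Rintegral mu setT (fun x => \1_(B N) x *
      (p x * (g x a ord0 * g x b ord0)))) //.
  by apply: eq_Rintegral => x _; rewrite mulrCA.
by move=> [N _ /(_ N (leqnn _)) H]; exists N => a b; exact: (H (a, b)).
Qed.

Lemma scale_recenter (R : fieldType) (V : lmodType R) (a : R) (t t0 v : V) :
  a != 0 -> a *: (t - (t0 + a^-1 *: v)) + v = a *: (t - t0).
Proof.
by move=> a0; rewrite opprD addrA scalerBr scalerA mulfV// scale1r subrK.
Qed.

Lemma scale_shiftK (R : fieldType) (V : lmodType R) (a : R) (t t0 : V) :
  a != 0 -> t = a^-1 *: (a *: (t - t0)) + t0.
Proof. by move=> a0; rewrite scalerA mulVf// scale1r subrK. Qed.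

Lemma small_fraction (R : realFieldType) (b e : R) : 0 <= b -> 0 < e ->
  exists t, [/\ 0 < t, t < 1 & t * b <= e].
Proof.
move=> b0 e0; have b1 : 0 < b + 1 by rewrite ltr_wpDl.
exists (Num.min (1 / 2) (e / (b + 1))); split.
- by rewrite lt_min !divr_gt0.
- by rewrite gt_min; apply/orP; left; lra.
- apply: (@le_trans _ _ (e / (b + 1) * b)).
    by rewrite ler_wpM2r// ge_min lexx orbT.
  by rewrite mulrAC ler_pdivrMr// ler_wpM2l ?lerDl// ltW.
Qed.

Lemma weighted_tolerance (R : realType) (n : nat) (a K e : R) :
  0 <= a -> 0 < e ->
  exists2 d : R, 0 < d & n%:R ^+ 2 * (a * d) * K ^+ 2 <= e.
Proof.
move=> a0 e0; have b0 : 0 <= a * (n%:R ^+ 2 * K ^+ 2).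
  by apply: mulr_ge0 => //; apply: mulr_ge0; exact: sqr_ge0.
have [d [d0 _ dl]] := small_fraction b0 e0.
exists d => //; rewrite [leLHS](_ : _ = d * (a * (n%:R ^+ 2 * K ^+ 2)))//; ring.
Qed.

Lemma quarters_le (R : realFieldType) (c e : R) :
  0 <= e -> c - e <= c - 2 * (e / 4).
Proof. by move=> e0; lra. Qed.

Lemma three_quarters_le (R : realFieldType) (c e : R) :
  0 <= e -> c + 3 * (e / 4) <= c + e.
Proof. by move=> e0; lra. Qed.

(** Lets the denominator sample, whose density is constantly [p], use the same law of large numbers
    as the numerator sample. *)
Lemma integral_self_dist_cvg (R : realType) (dT : measure_display)
    (T : measurableType dT) (mu : {measure set T -> \bar R}) (p : T -> R) :
  (fun i : nat => (\int[mu]_x `|p x - p x|%:E)%E) @ \oo --> 0%E.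
Proof.
rewrite (_ : (fun i => _) = cst 0%E); first exact: cvg_cst.
apply/funext => i; rewrite /= integral0_eq// => x _.
by rewrite subrr normr0.
Qed.

Lemma two_samples_independent (R : realType) (dO dT : measure_display)
    (O : measurableType dO) (T : measurableType dT) (P : probability O R)
    (mu : {measure set T -> \bar R}) (qn qd : T -> R) (mn md : nat)
    (xn : 'I_mn -> O -> T) (xd : 'I_md -> O -> T) :
  two_samples P mu qn qd xn xd ->
  (forall j j' A A', j != j' -> measurable A -> measurable A' ->
    P (xn j @^-1` A `&` xn j' @^-1` A') =
    (P (xn j @^-1` A) * P (xn j' @^-1` A'))%E) /\
  (forall j j' A A', j != j' -> measurable A -> measurable A' ->
    P (xd j @^-1` A `&` xd j' @^-1` A') =
    (P (xd j @^-1` A) * P (xd j' @^-1` A'))%E).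
Proof.
move=> [_ _ ind]; split => j j' A A' jj' mA mA'.
  exact: (mutually_independent_pair (i := inl j) (j := inl j') ind).
exact: (mutually_independent_pair (i := inr j) (j := inr j') ind).
Qed.

(** * Comparison of the limiting powers *)

Unset Implicit Arguments.

(** An upper limit is compared with a lower limit: this is the inequality between the asymptotic
    powers whenever these limits exist. *)
Theorem theorem6 (R : realType)
  (* data space with reference measure *)
  (dT : measure_display) (T : measurableType dT)
  (mu : {sigma_finite_measure set T -> \bar R})
  (* divergence function; (c) *)
  (f : R -> R)
  (f_convex : strictly_convex_pos f)
  (f_diff : forall x : R, 0 < x -> derivable f x 1)
  (f_diff2 : forall x : R, 0 < x -> derivable (f^`())%classic x 1)
  (f1 : f 1 = 0) (f'1 : (f^`())%classic 1 = 0)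
  (* model *)
  (k : nat) (Theta : set 'cV[R]_(1 + k)) (phi : T -> 'cV[R]_k -> R)
  (r : T -> 'cV[R]_(1 + k) -> R)
  (Theta_open : open Theta)
  (r_def : r = density_ratio phi)
  (r_meas : forall t, Theta t -> measurable_fun setT (fun x => r x t))
  (r_diff : forall x t, Theta t -> differentiable (r x) t)
  (* (a) and (b) *)
  (r_const1 : exists2 t, Theta t & forall x, r x t = 1)
  (r_span1 : forall t, Theta t -> one_in_score_span r t)
  (ts : 'cV[R]_(1 + k)) (Theta_ts : Theta ts) (r_ts : forall x, r x ts = 1)
  (* denominator density *)
  (p : T -> R) (p_density : is_density mu p)
  (* sample sizes *)
  (mn md : nat -> nat) (rho : R)
  (mn_infty : mn @ \oo --> \oo) (md_infty : md @ \oo --> \oo)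
  (rho_gt0 : 0 < rho)
  (rho_lim : (fun i => (mn i)%:R / (md i)%:R : R) @ \oo --> rho)
  (m : nat -> R) (m_def : forall i, m i = eff_size R (mn i) (md i))
  (* local alternatives *)
  (h : 'cV[R]_(1 + k)) (h_ : nat -> 'cV[R]_(1 + k))
  (h_lim : h_ @ \oo --> h)
  (th : nat -> 'cV[R]_(1 + k))
  (th_def : forall i, th i = ts + (Num.sqrt (m i))^-1 *: h_ i)
  (eps : R) (eps_ : nat -> R) (eps_lim : eps_ @ \oo --> eps)
  (s : nat -> T -> R)
  (s_int : forall i, mu.-integrable setT (fun x => (p x * s i x)%:E))
  (s_mean0 : forall i, Edens mu p (s i) = 0)
  (pn : nat -> T -> R) (pn_density : forall i, is_density mu (pn i))
  (pn_def : forall i x,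
    pn i x = p x * (r x (th i) + (s i x + eps_ i) / Num.sqrt (m i)))
  (pn_not_model : forall i,
    ~ exists2 t, Theta t & {ae mu, forall x, pn i x = p x * r x t})
  (* locality: pn i tends to p in L^1(mu) *)
  (pn_local : (fun i => (\int[mu]_x `|pn i x - p x|%:E)%E) @ \oo --> 0%E)
  (* samples *)
  (dO : nat -> measure_display) (O : forall i, measurableType (dO i))
  (P : forall i, probability (O i) R)
  (xn : forall i, 'I_(mn i) -> O i -> T)
  (xd : forall i, 'I_(md i) -> O i -> T)
  (samples : forall i, two_samples (P i) mu (pn i) p (xn i) (xd i))
  (* M and U *)
  (M_exists : \forall t \near ts, forall a b,
    mu.-integrable setT
      (fun x => (p x * (score r x t a ord0 * score r x t b ord0))%:E))
  (M_cont : \forall t \near ts, {for t, continuous (Mmx mu p r)})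
  (M_unit : \forall t \near ts, Mmx mu p r t \in unitmx)
  (U_cont : \forall t \near ts, {for t, continuous (Umx mu p rho r)})
  (U_unit : \forall t \near ts, Umx mu p rho r t \in unitmx)
  (M_sample : cvg_in_prob P
    (fun i w => (mn i)%:R^-1 *: \sum_(j < mn i)
       (grad (r (xn i j w)) ts *m (grad (r (xn i j w)) ts)^T))
    (Mmx mu p r ts))
  (* empirical likelihood estimator *)
  (that : forall i, O i -> 'cV[R]_(1 + k))
  (that_meas : forall i a, measurable_fun setT (fun w => that i w a ord0))
  (that_Theta : forall i w, Theta (that i w))
  (that_sol : (fun i => P i [set w |
     Qstat r (fun j => xn i j w) (fun j => xd i j w) (that i w) = 0])
     @ \oo --> 1%E)
  (that_clt : cvg_in_law_normal P
    (fun i w => Num.sqrt (m i) *: (Umx mu p rho r (th i) *m (that i w - th i)))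
    ((1 + rho) ^- 2 *: covmx mu p (fun x => grad (r x) ts)))
  (* consistent variance estimator; p is the limit of the densities pn i *)
  (Vhat : forall i, O i -> 'M[R]_k)
  (Vhat_meas : forall i a b, measurable_fun setT (fun w => Vhat i w a b))
  (Vhat_consistent : cvg_in_prob P Vhat
    (covmx mu p (fun x => grad (phi x) (beta_of ts))))
  (* common significance level and critical value *)
  (gamma c : R) (gamma_gt0 : 0 < gamma) (gamma_lt1 : gamma < 1)
  (c_def : chi2_point k (1 - gamma) c) :
  (limn_esup (fun i => power (P i) (fun w =>
       EL_reject c (m i) (Vhat i w) (beta_of (that i w)) (beta_of ts)))
   <=
   limn_einf (fun i => power (P i) (fun w =>
       Df_reject f r c (m i) (fun j => xn i j w) (fun j => xd i j w) (that i w))))%E.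
Proof.
have r_gt0 x t : 0 < r x t by rewrite r_def; exact: expR_gt0.
have r_cont x t : Theta t -> {for t, continuous (r x)}.
  by move=> Tt; exact: differentiable_continuous (r_diff x t Tt).
pose g x := grad (r x) ts.
have score_g x : score r x ts = g x.
  rewrite /g r_def; apply: score_eq_grad; rewrite -r_def; first exact: r_diff.
  exact: r_ts.
have g_first x : g x ord0 ord0 = 1 by rewrite -score_g r_def score_first.
have g_rshift x b : g x (rshift 1 b) ord0 = grad (phi x) (beta_of ts) b ord0.
  by rewrite -score_g r_def score_rshift.
have g_meas a : measurable_fun setT (fun x => g x a ord0).
  exact: (measurable_grad Theta_open Theta_ts r_meas r_diff).
have g_int a b : mu.-integrable setT
    (fun x => (p x * (g x a ord0 * g x b ord0))%:E).
  have := nbhs_singleton M_exists a b.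
  by under eq_fun do rewrite score_g.
pose M := Mmx mu p r ts; pose U := Umx mu p rho r ts.
have ME : M = \matrix_(a, b) Edens mu p (fun x => g x a ord0 * g x b ord0).
  apply/matrixP => a b; rewrite [LHS]mxE [RHS]mxE.
  by apply: (congr1 (Edens mu p)); apply/funext => x; rewrite score_g.
have M_psd z : 0 <= qform M z by rewrite ME; exact: second_moment_psd.
have M_sym : M^T = M by rewrite ME; exact: second_moment_sym.
have M00 : M ord0 ord0 = 1.
  rewrite ME mxE /Edens /Rintegral.
  under eq_integral do rewrite !g_first !mulr1.
  by have [_ _ ->] := p_density.
have M_u : M \in unitmx := nbhs_singleton M_unit.
have U_u : U \in unitmx := nbhs_singleton U_unit.
have U_M : U = (1 + rho)^-1 *: M.
  exact: (Umx_at_one rho r_ts (nbhs_singleton M_exists)).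
pose C := covmx mu p (fun x => grad (r x) ts).
have CE : C = M - (row ord0 M)^T *m row ord0 M.
  by rewrite ME; exact: (covmx_second_moment p_density g_int g_first).
have C_dr : covmx mu p (fun x => grad (phi x) (beta_of ts)) = drsubmx C.
  apply/matrixP => a b; rewrite [LHS]mxE [RHS]mxE [RHS]mxE [RHS]mxE.
  have Eg a' : Edens mu p (fun y => grad (phi y) (beta_of ts) a' ord0) =
      Edens mu p (fun y => g y (rshift 1 a') ord0).
    by apply: (congr1 (Edens mu p)); apply/funext => y; rewrite g_rshift.
  apply: (congr1 (Edens mu p)); apply/funext => x.
  by rewrite !Eg -!g_rshift.
(* [0 < k] makes the covariance of the score nonzero; [0 <= c] serves in the case [f''(1) <= 0]. *)
have [k_gt0 c_ge0] := chi2_point_nontrivial (ltac:(lra) : 0 < 1 - gamma)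
  (ltac:(lra) : 1 - gamma < 1) c_def.
have rho1 : 0 < 1 + rho by rewrite addr_gt0.
have C_neq0 : C != 0 by rewrite CE; exact: center_neq0.
have f_ge0 z : 0 < z -> 0 <= f z by exact: divergence_ge0.
have [dY [OY [Q [l [G [A [G_std AA X_law]]]]]]] := that_clt.
pose X i (w : O i) := Num.sqrt (m i) *: (Umx mu p rho r (th i) *m (that i w - th i)).
pose V := invmx U.
(* [X i] is [U] at the local parameter applied to [u - h_ i], so [V z + h] recovers [u] in the
   limit. *)
pose q z := qform M (V *m z + h).
have q_cont : continuous q.
  move=> z; apply: (@continuous_comp _ _ _ (fun z => V *m z + h) (qform M)).
    exact: continuous_affine.
  exact: qform_continuous.
have mthat i : mxmeasurable (that i).
  by move=> a b; rewrite (ord1 b).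
have mX i : mxmeasurable (X i).
  apply: mxmeasurableZ; apply: mxmeasurableM; first exact: mxmeasurable_cst.
  by apply: mxmeasurableB => //; exact: mxmeasurable_cst.
pose Y (w : OY) := A *m \col_i G i w.
have mY : mxmeasurable Y.
  apply: mxmeasurableM; first exact: mxmeasurable_cst.
  have [mG _ _] := G_std; move=> a b.
  rewrite (_ : (fun w => _) = G a); first exact: mG.
  by apply/funext => w; rewrite mxE.
have mq (d : measure_display) (W : measurableType d) (Z : W -> 'cV[R]_(1 + k)) :
    mxmeasurable Z -> measurable_fun setT (q \o Z).
  move=> mZ; apply: measurable_qform; first exact: mxmeasurable_cst.
  apply: mxmeasurableD; last exact: mxmeasurable_cst.
  by apply: mxmeasurableM => //; exact: mxmeasurable_cst.
have ms (d : measure_display) (W : measurableType d) (Z : W -> 'cV[R]_(1 + k)) :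
    mxmeasurable Z -> measurable_fun setT (qform 1%:M \o Z).
  by move=> mZ; apply: measurable_qform => //; exact: mxmeasurable_cst.
have r2 : (1 + rho) ^- 2 != 0.
  exact: invr_neq0 (expf_neq0 _ (lt0r_neq0 rho1)).
have q_null : Q [set w | q (Y w) = c] = 0%E.
  exact: (limit_qform_null h c G_std M_sym M_u M_psd U_u r2 C_neq0 AA).
have mE i : measurable [set w |
    EL_reject c (m i) (Vhat i w) (beta_of (that i w)) (beta_of ts)].
  exact: (measurable_EL_reject c (m i) (beta_of ts) (Vhat_meas i) (mthat i)).
have mD i : measurable [set w | Df_reject f r c (m i) (fun j => xn i j w)
    (fun j => xd i j w) (that i w)].
  have [xnd xdd _] := samples i.
  have mxn j : measurable_fun setT (xn i j) := (xnd j).1.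
  have mxd j : measurable_fun setT (xd i j) := (xdd j).1.
  exact: (measurable_ge_event (measurable_Df_hat Theta_open r_meas r_cont r_gt0
    f_diff mxn mxd (mthat i) (that_Theta i))).
rewrite /power.
(* Size is measured by the sum of squares [qform 1%:M], so both tests need only be compared where
   [X] is bounded. *)
apply: (@limn_power_le _ _ _ P _ X _ _ Q Y X_law q (qform 1%:M) c _ _
  q_cont (fun i => mq _ _ _ (mX i)) (mq _ _ _ mY)
  (@qform_continuous _ _ 1%:M) (fun i => ms _ _ _ (mX i)) (ms _ _ _ mY)
  q_null mE mD).
move=> e K e_gt0.
set F := (f^`(2))%classic 1.
pose K1 := 1 + `|K|.
have K1_ge0 : 0 <= K1 := addr_ge0 ler01 (normr_ge0 K).
(* The empirical likelihood side spends two quarters of [e], the divergence side three. *)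
have e4 : 0 < e / 4 := divr_gt0 e_gt0 (ltr0n R 4).
have [d d_gt0 [Ku Ku_ge0 near_u]] := near_limit_quantities M h U_u K1_ge0 e4.
have h_near : \forall i \near \oo, `|h_ i - h| <= d.
  move/cvgrPdist_le : h_lim => /(_ d d_gt0); apply: filterS => i.
  by rewrite distrC.
have m_infty a : \forall i \near \oo, a < m i.
  have := eff_size_infty a mn_infty md_infty rho_gt0 rho_lim.
  by apply: filterS => i; rewrite m_def.
have th_lim : th @ \oo --> ts := local_parameter_cvg m_infty h_lim th_def.
have U_near : \forall i \near \oo, `|Umx mu p rho r (th i) - U| <= d.
  have Uc : (fun i => Umx mu p rho r (th i)) @ \oo --> U.
    exact: (cvg_comp _ _ th_lim (nbhs_singleton U_cont)).
  move/cvgrPdist_le : Uc => /(_ d d_gt0); apply: filterS => i Ui.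
  rewrite distrC; exact: Ui.
pose u i (w : O i) := Num.sqrt (m i) *: (that i w - ts).
have m_gt0 := m_infty 0.
have u_near : \forall i \near \oo, forall w, qform 1%:M (X i w) <= K ->
    `|u i w| <= Ku /\ `|qform M (u i w) - q (X i w)| <= e / 4.
  have [N1 _ H1] := h_near; have [N2 _ H2] := U_near; have [N3 _ H3] := m_gt0.
  exists (maxn N1 (maxn N2 N3)); first exact: Logic.I.
  move=> i; rewrite /= !geq_max => /and3P[/H1 hi /H2 Ui /H3 mi] w XK.
  have sm : Num.sqrt (m i) != 0 by rewrite lt0r_neq0 ?sqrtr_gt0.
  pose y := Num.sqrt (m i) *: (that i w - th i).
  have -> : u i w = y + h_ i.
    by rewrite /u /y th_def scale_recenter.
  have XE : X i w = Umx mu p rho r (th i) *m y by rewrite /X /y scalemxAr.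
  rewrite XE in XK *.
  exact: near_u Ui hi (norm_le_sum_sqr XK).
pose Vphi := covmx mu p (fun x => grad (phi x) (beta_of ts)).
have Vphi_le z : qform Vphi (dsubmx z) <= qform M z.
  by rewrite /Vphi C_dr CE; exact: qform_dsubmx_le.
have [e2 e2_gt0 e2_small] := weighted_tolerance k Ku ler01 e4.
rewrite mul1r in e2_small.
have V_whp := cvg_in_prob_whp Vhat_meas Vhat_consistent e2_gt0.
have EL_whp : whp P (fun i => [set w | qform 1%:M (X i w) <= K ->
    EL_reject c (m i) (Vhat i w) (beta_of (that i w)) (beta_of ts) ->
    c - e <= q (X i w)]).
  apply: whp_sub V_whp.
  have [N1 _ H1] := m_gt0; have [N2 _ H2] := u_near.
  exists (maxn N1 N2); first exact: Logic.I.
  move=> i; rewrite /= geq_max => /andP[/H1 mi /H2 ui] w Vw XK rej.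
  have [uK uq] := ui w XK.
  have low := EL_reject_qform mi (ltW e2_gt0) e2_small Vw uK Vphi_le uq rej.
  exact: (le_trans (quarters_le c (ltW e_gt0)) low).
(* Strict convexity does not exclude [f''(1) = 0], as [(z - 1)^4] shows; dividing by [F] requires
   the other case. *)
have [F_le0|F_gt0] := leP F 0.
  apply: whp_sub EL_whp.
  apply: filterS m_gt0 => i mi w EL XK; split; first exact: EL.
  move=> _; rewrite /Df_reject -/F.
  apply: (@le_trans _ _ 0); last exact: Df_hat_ge0 (fun x => r_gt0 x _) f_ge0.
  apply: mulr_le0_ge0 c_ge0; apply: mulr_le0_ge0 F_le0 _.
  rewrite invr_ge0; exact: mulr_ge0 (ler0n R 2) (ltW mi).
pose A0 := (1 + k)%:R ^+ 2 * `|M| * Ku ^+ 2.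
have A0_ge0 : 0 <= A0.
  exact: mulr_ge0 (mulr_ge0 (sqr_ge0 _) (normr_ge0 _)) (sqr_ge0 _).
(* The order of choice matters: [t] fixes the accuracy and with it the family of good sets, [e3]
   then selects [N], and [d'] depends on all of these. *)
have [t [t_gt0 t_lt1 t_small]] := small_fraction
  (addr_ge0 (mulr_ge0 (ler0n R 3) A0_ge0) (sqr_ge0 Ku)) e4.
have [e3 e3_gt0 e3_small] := weighted_tolerance (1 + k) Ku (ler0n R 2) e4.
pose B N := good Theta r ts t N.
have mB N : measurable (B N).
  exact: (measurable_good Theta_open Theta_ts r_meas r_diff).
have [N B_close] := good_moment_cvg mB
  (fun N N' NN' => @good_nondecreasing _ _ _ _ Theta r ts t N N' NN')
  (fun x => good_cover Theta_ts r_diff x t_gt0) g_int ME e3_gt0.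
have gB x a : B N x -> `|g x a ord0| <= N%:R by move=> [+ _]; exact.
have d_dens i : forall j, has_density (P i) mu p (xd i j).
  have [_ H _] := samples i; exact: H.
have n_dens i : forall j, has_density (P i) mu (pn i) (xn i j).
  have [H _ _] := samples i; exact: H.
have d_ind i := (two_samples_independent (samples i)).2.
have n_ind i := (two_samples_independent (samples i)).1.
have d_whp := emp_moment_whp p_density (fun=> p_density)
  (integral_self_dist_cvg mu p) md_infty d_dens
  d_ind g_meas (mB N) gB (ler0n R N) e3_gt0.
have n_whp := emp_moment_whp p_density pn_density pn_local mn_infty n_dens
  n_ind g_meas (mB N) gB (ler0n R N) e3_gt0.
have [d' d'_gt0 Df_low] := Df_hat_lower_bound Theta r_gt0 r_ts rho_gt0 f_ge0
  (divergence_quadratic_minorant f_diff f_diff2 f1 f'1) F_gt0 N t_gt0 t_lt1 Ku_ge0.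
have m_big := m_infty (d' ^- 2).
have rho_near : \forall i \near \oo, `|(mn i)%:R / (md i)%:R - rho| < d'.
  move/cvgrPdist_lt : rho_lim => /(_ d' d'_gt0); apply: filterS => i.
  by rewrite distrC.
have mn0 : \forall i \near \oo, (0 < mn i)%N by move/cvgnyPgt : mn_infty; exact.
have md0 : \forall i \near \oo, (0 < md i)%N by move/cvgnyPgt : md_infty; exact.
apply: whp_sub (whpI EL_whp (whpI d_whp n_whp)).
have [N1 _ H1] := m_gt0; have [N2 _ H2] := m_big; have [N3 _ H3] := rho_near.
have [N4 _ H4] := mn0; have [N5 _ H5] := md0; have [N6 _ H6] := u_near.
exists (maxn N1 (maxn N2 (maxn N3 (maxn N4 (maxn N5 N6))))); first exact: Logic.I.
move=> i; rewrite /= !geq_max => /and5P[/H1 mi /H2 mbig /H3 rhoi /H4 mni].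
move=> /andP[/H5 mdi /H6 ui] w [EL [dw nw]] XK; split; first exact: EL.
have [uK uq] := ui w XK.
have sm : Num.sqrt (m i) != 0 by rewrite lt0r_neq0 ?sqrtr_gt0.
have that_u : that i w = (Num.sqrt (m i))^-1 *: u i w + ts.
  exact: scale_shiftK.
have := Df_low (mn i) (md i) (fun j => xn i j w) (fun j => xd i j w) (u i w) (m i)
  mni mdi mi (invr_sqrt_lt d'_gt0 mbig) rhoi uK.
rewrite -that_u => /(_ (that_Theta i w)) low.
pose MB := \matrix_(a, b)
  Edens mu p (fun x => \1_(B N) x * (g x a ord0 * g x b ord0)).
have MBE a b : MB a b = Edens mu p (fun x => \1_(B N) x * (g x a ord0 * g x b ord0)).
  exact: mxE.
have MhM := @emp_moment_mix_close _ _ rho e3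
  (emp_moment g (B N) (fun j => xd i j w)) (emp_moment g (B N) (fun j => xn i j w))
  MB M rho_gt0 (ltW e3_gt0) _ _ _.
have {}MhM := MhM (fun a b => eq_ind_r (fun z => `|_ - z| <= e3) (dw a b) (MBE a b))
  (fun a b => eq_ind_r (fun z => `|_ - z| <= e3) (nw a b) (MBE a b))
  (fun a b => eq_ind_r (fun z => `|z - _| <= e3) (B_close a b) (MBE a b)).
move=> cq; apply: (Df_reject_qform t_gt0 t_lt1 mi F_gt0 M_psd (lexx A0) t_small
  e3_small MhM uK uq low).
exact: le_lt_trans (three_quarters_le c (ltW e_gt0)) cq.
Qed.
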